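(* Let $\mathrm{M}$ be a loopless matroid on a finite ground set $E$, let $\mathcal{G}$ be a building set of its lattice of flats $\mathcal{L}$ such that $(\mathrm{M},\mathcal{G})$ is irreducible, and let $\vartriangleleft$ be a total order on $E$ such that $(\mathrm{M},\mathcal{G})$ is $\vartriangleleft$-complete. Let $\gamma(\mathrm{M},\mathcal{G})(t)$ be the $\gamma$-polynomial of the Chow polynomial $\mathrm{H}(\mathrm{M},\mathcal{G})(t)$. Then \[ \gamma(\mathrm{M},\mathcal{G})(t)=\sum_{\mathcal{S}\in \mathcal{N}(\mathrm{M},\mathcal{G})^{\max}_{\mathrm{stable}}} t^{\mathrm{des}(\mathcal{S})}, \] where descents are taken with respect to $\vartriangleleft$. In particular, $\gamma(\mathrm{M},\mathcal{G})(t)$ has nonnegative coefficients.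
   Context: $\mathcal{L}=\mathcal{L}(\mathrm{M})$ is the lattice of flats ordered by inclusion, with $\hat0=\varnothing$, $\hat1=E$, join $F\vee G=\operatorname{cl}_{\mathrm{M}}(F\cup G)$, and $F\vee e=\operatorname{cl}_{\mathrm{M}}(F\cup\{e\})$ for $e\in E$. A building set is a subset $\mathcal{G}\subseteq\mathcal{L}\setminus\{\hat0\}$ such that for every $F\neq\hat0$, with $\max\mathcal{G}_{\leqslant F}$ the maximal elements of $\{G\in\mathcal{G}:G\leqslant F\}$, the join map $\prod_{G\in\max\mathcal{G}_{\leqslant F}}[\hat0,G]\to[\hat0,F]$ is a poset isomorphism. $(\mathrm{M},\mathcal{G})$ is irreducible if $E\in\mathcal{G}$. A subset $\mathcal{S}\subseteq\mathcal{G}$ is nested if for every antichain $A\subseteq\mathcal{S}$ and every $\{S_1,\dots,S_k\}\subseteq A$ with $k\geqslant2$, $S_1\vee\dots\vee S_k\notin\mathcal{G}$; a maximal nested set is one maximal under inclusion among all nested subsets of $\mathcal{G}$. Chow ring: $\mathrm{CH}(\mathrm{M},\mathcal{G})=\mathbb{Q}[x_G:G\in\mathcal{G}]/(I+J)$, where $I$ is generated by monomials $x_{G_1}\cdots x_{G_k}$ with $\{G_1,\dots,G_k\}$ not nested, and $J$ by the linear forms $\sum_{G\in\mathcal{G},G\geqslant a}x_G$ for each atom $a$ of $\mathcal{L}$. The Chow polynomial $\mathrm{H}(\mathrm{M},\mathcal{G})(t)=\sum_i\dim\mathrm{CH}^i(\mathrm{M},\mathcal{G})t^i$ is palindromic of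 some degree $d$, so uniquely $\mathrm{H}(\mathrm{M},\mathcal{G})(t)=\sum_{i=0}^{\lfloor d/2\rfloor}\gamma_it^i(1+t)^{d-2i}$; the $\gamma$-polynomial is $\sum_i\gamma_it^i$. Completeness: for flats $F\leqslant G$, write $G\setminus F=\{e_1\vartriangleleft\dots\vartriangleleft e_k\}$ and $F_i=\operatorname{cl}_{\mathrm{M}}(F\cup\{e_1,\dots,e_i\})$; $C_\vartriangleleft(F,G)=\{F,F_1,\dots,F_k=G\}$. Let $\mathcal{G}_F=\{F\vee H:H\in\mathcal{G}\}\setminus\{F\}$ and $\mathcal{G}_F^G=\mathcal{G}_F\cap[F,G]$. $(\mathrm{M},\mathcal{G})$ is $\vartriangleleft$-complete if $C_\vartriangleleft(F,G)\subseteq\mathcal{G}_F^G\cup\{F\}$ for all $F\in\mathcal{L}$, $G\in\mathcal{G}$ with $F\leqslant G$. Descents: for a nested set $\mathcal{S}$ and $G\in\mathcal{S}$, $J^G=\bigvee\{H\in\mathcal{S}:H<G\}$. For a maximal nested set $\mathcal{S}$ one has $\operatorname{rk}G-\operatorname{rk}J^G=1$ for every $G\in\mathcal{S}$, and one sets $\lambda_{\mathcal{S}}(G)=\min_\vartriangleleft\{e\in E: J^G\vee e=G\}$. For $G\in\mathcal{S}$ not maximal in $\mathcal{S}$, the set $\{H\in\mathcal{S}:H>G\}$ has a unique minimum $p(G)$ (the parent; $G$ is a child of $p(G)$). $G\in\mathcal{S}$ is a descent if $G$ is not maximal in $\mathcal{S}$ and $\lambda_{\mathcal{S}}(p(G))\vartriangleleft\lambda_{\mathcal{S}}(G)$.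 A descent is a bottom descent if it is minimal in $\mathcal{S}$, and a double descent if it is not minimal in $\mathcal{S}$ and all its children are descents. $\mathrm{Des}(\mathcal{S})$ is the set of descents, $\mathrm{des}(\mathcal{S})=|\mathrm{Des}(\mathcal{S})|$, and $\mathcal{N}(\mathrm{M},\mathcal{G})^{\max}_{\mathrm{stable}}$ is the set of maximal nested sets with no bottom descent and no double descent. *)

(* Defs.v *)
From HB Require Import structures.
From mathcomp Require Import all_boot all_order all_algebra.
From mathcomp Require Import mpoly.
Set Implicit Arguments. Unset Strict Implicit. Unset Printing Implicit Defensive.
Import GRing.Theory.
Local Open Scope ring_scope.

Section Matroid.
Variable E : finType.

Definition is_matroid_rank (r : {set E} -> nat) : Prop :=
  [/\ forall A : {set E}, (r A <= #|A|)%N,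
      forall A B : {set E}, A \subset B -> (r A <= r B)%N
    & forall A B : {set E}, (r (A :|: B) + r (A :&: B) <= r A + r B)%N].

Definition loopless (r : {set E} -> nat) : Prop := forall e : E, r [set e] = 1%N.

Variable r : {set E} -> nat.

Definition cl (A : {set E}) : {set E} := [set e | r (e |: A) == r A].
Definition flat (F : {set E}) : bool := cl F == F.
Definition fjoin (F G : {set E}) : {set E} := cl (F :|: G).
Definition bigjoin (T : {set {set E}}) : {set E} := cl (\bigcup_(H in T) H).
(* atoms of the lattice of flats (bottom = cl set0 = set0 for loopless M) *)
Definition atom (a : {set E}) : bool :=
  [&& flat a, a != cl set0 &
      [forall F : {set E}, (flat F && (F \proper a)) ==> (F == cl set0)]].

Definition maxG (BG : {set {set E}}) (F : {set E}) : {set {set E}} :=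
  [set G in BG | (G \subset F) &&
     [forall G' in BG, ((G' \subset F) && (G \subset G')) ==> (G' == G)]].

(* building set: BG is a set of nonbottom flats such that for every flat F <> bottom
   the join map  prod_{G in max G_{<=F}} [bottom, G] -> [bottom, F]  is a poset
   isomorphism (surjective and an order embedding for the product order). *)
Definition building_set (BG : {set {set E}}) : Prop :=
  (forall G, G \in BG -> flat G /\ G != cl set0) /\
  forall F, flat F -> F != cl set0 ->
    let Mx := maxG BG F in
    let valid (X : {set E} -> {set E}) :=
        forall G, G \in Mx -> flat (X G) /\ X G \subset G in
    let jmap (X : {set E} -> {set E}) := cl (\bigcup_(G in Mx) X G) in
    (forall H, flat H -> H \subset F -> exists X, valid X /\ jmap X = H) /\
    (forall X Y, valid X -> valid Y ->
       (jmap X \subset jmap Y <-> forall G, G \in Mx -> X G \subset Y G)).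

Definition antichain (A : {set {set E}}) : bool :=
  [forall G in A, forall H in A, (G \subset H) ==> (G == H)].

Definition nested (BG S : {set {set E}}) : bool :=
  (S \subset BG) &&
  [forall A : {set {set E}}, ((A \subset S) && antichain A) ==>
     [forall T : {set {set E}}, ((T \subset A) && (2 <= #|T|)%N) ==>
        (bigjoin T \notin BG)]].

Definition max_nested (BG S : {set {set E}}) : bool :=
  nested BG S && [forall S' : {set {set E}}, (S \proper S') ==> ~~ nested BG S'].

(* The total order on E is  e <| f  iff  o e < o f, with o injective. *)
Variable o : E -> nat.

Definition complete (BG : {set {set E}}) : Prop :=
  forall F G, flat F -> G \in BG -> F \subset G ->
    forall e, e \in G :\: F ->
      let Fe := cl (F :|: [set x in G :\: F | (o x <= o e)%N]) in
      Fe = F \/ exists H, H \in BG /\ Fe = fjoin F H.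

Definition JG (S : {set {set E}}) (G : {set E}) : {set E} :=
  bigjoin [set H in S | H \proper G].

Definition lam_is (S : {set {set E}}) (G : {set E}) (e : E) : bool :=
  (cl (e |: JG S G) == G) &&
  [forall e' : E, (cl (e' |: JG S G) == G) ==> (o e <= o e')%N].

Definition is_maxin (S : {set {set E}}) (G : {set E}) : bool :=
  [forall H in S, ~~ (G \proper H)].
Definition is_minin (S : {set {set E}}) (G : {set E}) : bool :=
  [forall H in S, ~~ (H \proper G)].

Definition parent_is (S : {set {set E}}) (G P : {set E}) : bool :=
  [&& P \in S, G \proper P & [forall H in S, (G \proper H) ==> (P \subset H)]].

Definition descent (S : {set {set E}}) (G : {set E}) : bool :=
  [&& G \in S, ~~ is_maxin S G &
      [exists P, parent_is S G P &&
         [exists a, exists b, [&& lam_is S P a, lam_is S G b & (o a < o b)%N]]]].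

Definition children (S : {set {set E}}) (G : {set E}) : {set {set E}} :=
  [set H in S | parent_is S H G].

Definition bottom_descent S G := descent S G && is_minin S G.
Definition double_descent S G :=
  [&& descent S G, ~~ is_minin S G & [forall H in children S G, descent S H]].

Definition des (S : {set {set E}}) : nat := #|[set G in S | descent S G]|.

Definition stable_max_nested (BG : {set {set E}}) : {set {set {set E}}} :=
  [set S | max_nested BG S &&
     [forall G in S, ~~ bottom_descent S G && ~~ double_descent S G]].

(* The Chow ring CH(M,BG) = Q[x_G : G in BG]/(I+J).  Variables are indexed by
   'I_#|BG|, the variable i standing for the flat enum_val i of BG. *)
Section Chow.
Variable BG : {set {set E}}.
Local Notation n := #|BG|.
Definition vG (i : 'I_n) : {set E} := @enum_val _ (mem BG) i.

Definition chow_ideal (p : {mpoly rat[n]}) : Prop :=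
  exists (cI : {set 'I_n} -> {mpoly rat[n]}) (cJ : {set E} -> {mpoly rat[n]}),
    p = \sum_(T : {set 'I_n} | ~~ nested BG (vG @: T)) cI T * \prod_(i in T) 'X_i
      + \sum_(a : {set E} | atom a) cJ a * \sum_(i : 'I_n | a \subset vG i) 'X_i.

Definition homog_deg (d : nat) (p : {mpoly rat[n]}) : bool :=
  all (fun m => mdeg m == d) (msupp p).

Definition chow_dim_is (d k : nat) : Prop :=
  exists b : 'I_k -> {mpoly rat[n]},
    [/\ forall j, homog_deg d (b j),
        forall p, homog_deg d p ->
          exists c : 'I_k -> rat, chow_ideal (p - \sum_j c j *: b j)
      & forall c : 'I_k -> rat, chow_ideal (\sum_j c j *: b j) -> forall j, c j = 0].
End Chow.
End Matroid.

(* g is the gamma-polynomial of H:  H(t) = sum_i g_i t^i (1+t)^(d-2i), with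
   g_i = 0 for 2i > d, for the palindromicity degree d. *)
Definition is_gamma_poly (H g : {poly rat}) : Prop :=
  exists d : nat, (forall i, (d < 2 * i)%N -> g`_i = 0) /\
    H = \sum_(i < size g) g`_i *: ('X^i * (1 + 'X) ^+ (d - 2 * i)).

(* Main.v *)
(** The exponents of the Feichtner-Yuzvinsky monomials are indexed by pairs
    [(T, V)] of a maximal nested set [T] and a set [V] of ascents of [T] that
    contains a child of every descent: to [W = T \ V] corresponds the exponent
    [m_W(P) = rk P - rk J^P_W - 1] of [P] in [W].  Completeness yields, for each
    nested set [S] containing [E], a unique maximal nested set [T] containing
    [S] such that all elements of [T \ S] are ascents, and it forbids two
    ascents with the same parent.  Hence [T] is a disjoint union of chains of
    ascents, and the pairs [(T, V)] with [T] fixed are counted by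
    [t^des (1 + t)^(rk - 1 - 2 des)] when [T] is stable; otherwise there are
    none.

    With [h_G] the sum of the [x_B] for [B] above [G], the monomials [x^(m_W)]
    span the Chow ring because [x_A h_G^d = 0] for [d = rk G - rk (join A)].
    The monomials [h^(m_W)] are linearly independent: the functional attached to
    [W] that sends a monomial in the [h_G] to [1] or [0], according to the dragon
    Hall-Rado condition on each minor [[J^P_W, P]], vanishes on the Chow ideal,
    and the matrix of these functionals on the monomials is unitriangular with
    respect to the sum of [m_G |G|]. *)
Require Import Defs.
From HB Require Import structures.
From mathcomp Require Import all_boot all_order all_algebra.
From mathcomp Require Import mpoly zify ring.
Set Implicit Arguments. Unset Strict Implicit. Unset Printing Implicit Defensive.
Import GRing.Theory.

(** * Closure, building sets and nested sets *)

(** Refinements are forced because an ascent has a smaller label than its parent: in any refinement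
    [T] of [S] the elements below [G] outside [J^G_S] have smaller labels than [G], so [J^G_T] is
    the member of rank [r G - 1] of the chain from [J^G_S] to [G], and completeness reads one new
    element of [T] off it. The set [V] needs a child of every descent so that all descents lie in
    the support of the exponent, and [T] can be recovered as the refinement of this support together
    with [E].

    Spanning and independence concern two families, in the [x_G] and in the [h_G], with the same
    exponents; the number of exponents is thus both an upper and a lower bound for the dimension.
    For the functionals the [h_G] serve as coordinates, in which a non-nested monomial in the [x_G]
    is a signed sum without visible structure. It is reached through the products of [h_i - h_g]
    with [g] the join of the [i]: in one well-chosen factor, exchanging [h_i] for [h_g] preserves
    the Hall-Rado condition however the other factors are expanded, so all multiples of the product
    are sent to zero. *)

Section Closure.
Variables (E : finType) (r : {set E} -> nat).
Hypothesis rM : is_matroid_rank r.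
Implicit Types (A B F G : {set E}) (e : E).

Lemma rk_mono A B : A \subset B -> r A <= r B.
Proof. by case: rM => _ h _; apply: h. Qed.

Lemma rk_submod A B : r (A :|: B) + r (A :&: B) <= r A + r B.
Proof. by case: rM. Qed.

Lemma rk0 : r set0 = 0.
Proof. by case: rM => /(_ set0); rewrite cards0; lia. Qed.

Lemma rkU A B : r (A :|: B) <= r A + r B.
Proof. by have := rk_submod A B; lia. Qed.

Lemma rkU1 e A : r (e |: A) <= (r A).+1.
Proof.
have := rkU [set e] A; case: rM => /(_ [set e]); rewrite cards1; lia.
Qed.

Lemma sub_cl A : A \subset cl r A.
Proof. by apply/subsetP=> e eA; rewrite inE (setUidPr _) // sub1set. Qed.

(** A largest set of rank [r A] between [A] and [cl r A] absorbs every point of the closure by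
    submodularity. *)
Lemma rk_cl A : r (cl r A) = r A.
Proof.
pose P B := [&& A \subset B, B \subset cl r A & r B == r A].
have PA : P A by rewrite /P subxx sub_cl eqxx.
case: (@arg_maxnP _ A P (fun B => #|B|) PA) => B /and3P[AB BA /eqP rB] Bmax.
suff -> : cl r A = B by [].
apply/eqP; rewrite eqEsubset BA andbT; apply/subsetP=> e eA.
apply: contraT => eB; suff PeB : P (e |: B).
  by have := Bmax _ PeB; rewrite cardsU1 eB; lia.
rewrite /P (subset_trans AB (subsetUr _ _)) subUset sub1set eA BA /=.
rewrite eqn_leq; apply/andP; split; last first.
  by rewrite rk_mono // (subset_trans AB (subsetUr _ _)).
have := rk_submod B (e |: A); move: eA; rewrite inE => /eqP->.
rewrite setUCA (setUidPl AB) rB.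
have /rk_mono : A \subset B :&: (e |: A) by rewrite subsetI AB subsetUr.
lia.
Qed.

Lemma sub_cl_rk A B : r (A :|: B) <= r A -> B \subset cl r A.
Proof.
move=> h; apply/subsetP=> e eB; rewrite inE eqn_leq.
rewrite (rk_mono (subsetUr _ _)) andbT (leq_trans _ h) // rk_mono //.
by rewrite subUset subsetUl sub1set inE eB orbT.
Qed.

Lemma cl_mono A B : A \subset B -> cl r A \subset cl r B.
Proof.
move=> AB; apply: sub_cl_rk; have := rk_submod B (cl r A); rewrite rk_cl.
have /rk_mono : A \subset B :&: cl r A by rewrite subsetI AB sub_cl.
lia.
Qed.

Lemma cl_id A : cl r (cl r A) = cl r A.
Proof.
apply/eqP; rewrite eqEsubset sub_cl andbT; apply: sub_cl_rk.
rewrite -[leqRHS]rk_cl -[leqRHS]rk_cl rk_mono // subUset subxx andbT.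
exact: subset_trans (sub_cl _) (sub_cl _).
Qed.

Lemma flat_cl A : flat r (cl r A).
Proof. by rewrite /flat cl_id. Qed.

Lemma cl_flat F : flat r F -> cl r F = F.
Proof. by move/eqP. Qed.

Lemma cl_sub A F : flat r F -> A \subset F -> cl r A \subset F.
Proof. by move=> /cl_flat <- /cl_mono; rewrite cl_id. Qed.

Lemma cl_subP A F : flat r F -> (cl r A \subset F) = (A \subset F).
Proof.
by move=> fF; apply/idP/idP => [/(subset_trans (sub_cl A))|/(cl_sub fF)].
Qed.

Lemma flat_rkU1 e F : flat r F -> e \notin F -> r (e |: F) = (r F).+1.
Proof.
move=> /cl_flat cF eF; have := rkU1 e F; have := rk_mono (subsetUr [set e] F).
by case: (eqVneq (r (e |: F)) (r F)) => [h|]; [move: eF; rewrite -cF inE h eqxx | lia].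
Qed.

Lemma sub_eq_rk F G : flat r F -> F \subset G -> r G <= r F -> F = G.
Proof.
move=> fF FG h; apply/eqP; rewrite eqEsubset FG -(cl_flat fF) sub_cl_rk //.
by rewrite (setUidPr FG).
Qed.

Lemma proper_rk F G : flat r F -> F \proper G -> r F < r G.
Proof.
move=> fF /andP[FG GF]; rewrite ltnNge; apply: contra GF => h.
by rewrite (sub_eq_rk fF FG h).
Qed.

Lemma bigjoin_sub (D : {set {set E}}) F :
  flat r F -> (forall X, X \in D -> X \subset F) -> bigjoin r D \subset F.
Proof. by move=> fF h; rewrite /bigjoin cl_subP //; apply/bigcupsP. Qed.

Lemma sub_bigjoin (D : {set {set E}}) X : X \in D -> X \subset bigjoin r D.
Proof. by move=> XD; apply: subset_trans (sub_cl _); apply: bigcup_sup. Qed.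

Lemma flat_bigjoin (D : {set {set E}}) : flat r (bigjoin r D).
Proof. exact: flat_cl. Qed.

Lemma flat_JG S G : flat r (JG r S G).
Proof. exact: flat_cl. Qed.

Lemma sub_JG (S : {set {set E}}) X G : X \in S -> X \proper G -> X \subset JG r S G.
Proof. by move=> XS XG; apply: sub_bigjoin; rewrite inE XS. Qed.

Lemma JG_sub S G : flat r G -> JG r S G \subset G.
Proof.
by move=> fG; apply: bigjoin_sub => // X; rewrite inE => /andP[_ /proper_sub].
Qed.

Lemma bigjoin_mono (D D' : {set {set E}}) :
  D \subset D' -> bigjoin r D \subset bigjoin r D'.
Proof.
move=> /subsetP h; apply: bigjoin_sub => [|X /h]; first exact: flat_cl.
exact: sub_bigjoin.
Qed.

Lemma JG_mono (S S' : {set {set E}}) G : S \subset S' -> JG r S G \subset JG r S' G.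
Proof.
move=> /subsetP h; apply: bigjoin_mono; apply/subsetP=> X.
by rewrite !inE => /andP[/h-> ->].
Qed.

End Closure.

(** * Building sets and nested sets *)

Section Building.
Variables (E : finType) (r : {set E} -> nat) (BG : {set {set E}}).
Hypotheses (rM : is_matroid_rank r) (rL : loopless r) (bG : building_set r BG).
Implicit Types (A B F G H X Y : {set E}) (S T D : {set {set E}}).

Lemma cl0 : cl r set0 = set0.
Proof.
apply/setP=> e; rewrite !inE setU0 (rk0 rM) rL; lia.
Qed.

Lemma flat0 : flat r set0.
Proof. by rewrite -cl0 flat_cl. Qed.

Lemma BG_flat G : G \in BG -> flat r G.
Proof. by case: bG => h _ /h[]. Qed.

Lemma BG_neq0 G : G \in BG -> G != set0.
Proof. by case: bG => h _ /h[_]; rewrite cl0. Qed.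

Lemma maxG_sup F G : G \in BG -> G \subset F ->
  exists2 M, M \in maxG BG F & G \subset M.
Proof.
move=> GB GF; pose P M := [&& M \in BG, M \subset F & G \subset M].
have PG : P G by rewrite /P GB GF subxx.
case: (@arg_maxnP _ G P (fun B => #|B|) PG) => M /and3P[MB MF GM] Mmax.
exists M => //; rewrite inE MB MF; apply/forall_inP => M' M'B.
apply/implyP=> /andP[M'F MM']; rewrite eq_sym eqEcard MM' /=; apply: Mmax.
by rewrite /P M'B M'F (subset_trans GM).
Qed.

Lemma maxG_P F M : M \in maxG BG F ->
  [/\ M \in BG, M \subset F &
      forall G, G \in BG -> G \subset F -> M \subset G -> G = M].
Proof.
rewrite inE => /and3P[MB MF /forall_inP h]; split=> // G GB GF MG.
by apply/eqP; have := h G GB; rewrite GF MG.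
Qed.

(** The tuples whose only nonempty entry is [cl {e}], placed at [M] or at [M'], have the same join,
    so the order embedding forces [M = M']. *)
Lemma maxG_disjoint F M M' e : flat r F -> M \in maxG BG F -> M' \in maxG BG F ->
  e \in M -> e \in M' -> M = M'.
Proof.
move=> fF hM hM' eM eM'; apply/eqP; apply: contraT => neq.
have F0 : F != cl r set0.
  rewrite cl0; apply/set0Pn; exists e.
  by have [_ /subsetP h _] := maxG_P hM; apply: h.
case: bG => _ /(_ F fF F0) [_ emb].
pose X (N N' : {set E}) := if N' == N then cl r [set e] else set0.
have vX (N : {set E}) : e \in N -> N \in maxG BG F ->
    forall G, G \in maxG BG F -> flat r (X N G) /\ X N G \subset G.
  move=> eN hN G hG; rewrite /X; case: eqP => [->|_]; last by rewrite flat0 sub0set.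
  rewrite flat_cl // cl_sub ?sub1set //; apply: BG_flat.
  by case: (maxG_P hN).
have jX N : N \in maxG BG F -> \bigcup_(G in maxG BG F) X N G = cl r [set e].
  move=> hN; rewrite (bigD1 N) //= /X eqxx big1 ?setU0 // => G /andP[_ /negPf->] //.
have := (emb _ _ (vX M eM hM) (vX M' eM' hM')).1; rewrite !jX // subxx.
move=> /(_ isT M hM); rewrite /X eqxx (negPf neq) => /subsetP/(_ e).
by rewrite in_set0 (subsetP (sub_cl _ _)) ?set11 // => /(_ isT).
Qed.

(** The factors of the join that contain [X] and [Y] share [e], so they are one factor, which is
    then the whole join. *)
Lemma BG_joinU X Y e : X \in BG -> Y \in BG -> e \in X -> e \in Y ->
  cl r (X :|: Y) \in BG.
Proof.
move=> XB YB eX eY; set F := cl r _.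
have fF : flat r F by apply: (flat_cl rM).
have [XF YF] : X \subset F /\ Y \subset F.
  by split; apply: subset_trans (sub_cl _ _); rewrite ?subsetUl ?subsetUr.
have [M hM XM] := maxG_sup XB XF; have [M' hM' YM] := maxG_sup YB YF.
have eMM' : M = M'.
  by apply: (maxG_disjoint fF hM hM' (e := e)); [apply: (subsetP XM)|apply: (subsetP YM)].
have [MB MF _] := maxG_P hM.
suff <- : M = F by [].
apply/eqP; rewrite eqEsubset MF /= cl_subP ?BG_flat // subUset XM.
by rewrite eMM' YM.
Qed.

Lemma BG_atom e : cl r [set e] \in BG.
Proof.
set F := cl r _; have fF : flat r F by apply: (flat_cl rM).
have eF : e \in F by rewrite (subsetP (sub_cl _ _)) ?inE.
have F0 : F != cl r set0 by rewrite cl0; apply/set0Pn; exists e.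
case: bG => _ /(_ F fF F0) [sur _].
have [X [_ jX]] := sur F fF (subxx _).
case: (set_0Vmem (maxG BG F)) => [m0|[M hM]].
  by move: F0; rewrite -jX m0 big_set0 eqxx.
have [MB MF _] := maxG_P hM.
suff <- : M = F by [].
apply: (sub_eq_rk rM (BG_flat MB) MF).
rewrite rk_cl // rL; have := proper_rk rM flat0 (G := M).
by rewrite (rk0 rM) proper0 => -> //; apply: BG_neq0.
Qed.

Lemma atom_BG a : atom r a -> a \in BG.
Proof.
move=> /and3P[fa]; rewrite cl0 => /set0Pn[e ea] /forallP h.
suff <- : cl r [set e] = a by apply: BG_atom.
apply/eqP; apply: contraT => ne; have := h (cl r [set e]).
rewrite flat_cl //= properEneq ne cl_sub ?sub1set //= => /eqP c0.
by have := BG_neq0 (BG_atom e); rewrite c0 eqxx.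
Qed.

Definition maxs T := [set X in T | is_maxin T X].

Lemma maxs_sup T X : X \in T -> exists2 M, M \in maxs T & X \subset M.
Proof.
move=> XT; pose P M := (M \in T) && (X \subset M).
have PX : P X by rewrite /P XT subxx.
case: (@arg_maxnP _ X P (fun B => #|B|) PX) => M /andP[MT XM] Mmax.
exists M => //; rewrite inE MT; apply/forall_inP => M' M'T.
apply/negP => /[dup] MM' /proper_card.
rewrite ltnNge => /negP; apply; apply: Mmax.
by rewrite /P M'T (subset_trans XM) ?proper_sub.
Qed.

Lemma antichain_maxs T : antichain (maxs T).
Proof.
apply/forall_inP=> X; rewrite inE => /andP[XT mX].
apply/forall_inP=> Y; rewrite inE => /andP[YT mY]; apply/implyP=> XY.
by apply: contraT => ne; move/forall_inP/(_ Y YT): mX; rewrite properEneq ne XY.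
Qed.

Lemma nestedP S : reflect
  (S \subset BG /\ forall T, T \subset S -> antichain T -> 1 < #|T| -> bigjoin r T \notin BG)
  (nested r BG S).
Proof.
apply: (iffP andP) => [[SB /forallP h]|[SB h]]; split=> //.
  by move=> T TS aT cT; have := h T; rewrite TS aT => /forallP/(_ T); rewrite subxx cT.
apply/forallP=> A; apply/implyP=> /andP[AS aA]; apply/forallP=> T.
apply/implyP=> /andP[TA cT]; apply: h => //; first exact: subset_trans AS.
apply/forall_inP=> X /(subsetP TA) XA; apply/forall_inP=> Y /(subsetP TA) YA.
by move/forall_inP/(_ X XA)/forall_inP: aA; apply.
Qed.

Lemma nested_sub S T : T \subset S -> nested r BG S -> nested r BG T.
Proof.
move=> TS /nestedP[SB h]; apply/nestedP; split; first exact: subset_trans SB.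
by move=> A AT; apply: h; apply: subset_trans TS.
Qed.

Lemma nested_BG S X : nested r BG S -> X \in S -> X \in BG.
Proof. by move=> /nestedP[/subsetP h _]; apply: h. Qed.

(** Inside the factor [M] of the join that contains [G], the maximal members of [S] already join to
    [M]; being an antichain with join in [BG], they reduce to a single one. Most later arguments use
    nestedness in this form. *)
Lemma nested_cover S G : nested r BG S -> G \in BG -> G \subset bigjoin r S ->
  exists2 X, X \in S & G \subset X.
Proof.
move=> nS GB GF; set F := bigjoin r S in GF.
have fF : flat r F by apply: (flat_cl rM).
have F0 : F != cl r set0.
  by rewrite cl0; apply: contraTneq GF => ->; rewrite subset0 BG_neq0.
have [M hM GM] := maxG_sup GB GF; have [MB MF _] := maxG_P hM.
case: bG => _ /(_ F fF F0) [_ emb].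
pose A (N : {set E}) := [set X in maxs S | X \subset N].
pose X N := bigjoin r (A N).
have vX N : N \in maxG BG F -> flat r (X N) /\ X N \subset N.
  move=> /maxG_P[NB _ _]; split; first exact: (flat_cl rM).
  by apply: (bigjoin_sub rM); rewrite ?BG_flat // => Z; rewrite inE => /andP[].
have vI N : N \in maxG BG F -> flat r N /\ N \subset N.
  by move=> /maxG_P[NB _ _]; rewrite BG_flat.
(* The tuple of all factors and the tuple of the joins [X N] both join to [F]; the order embedding
   compares them entry by entry. *)
have MA : M \subset X M.
  apply: ((emb id X vI vX).1 _ M hM).
  apply: (subset_trans (_ : _ \subset F)).
    by apply: cl_sub => //; apply/bigcupsP=> N /maxG_P[].
  apply: (bigjoin_sub rM) => [|Z ZS]; first exact: (flat_cl rM).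
  have [N NS ZN] := maxs_sup ZS; apply: (subset_trans ZN) => {Z ZS ZN}.
  have NS' : N \in S by move: NS; rewrite inE => /andP[].
  have [M' hM' NM'] := maxG_sup (nested_BG nS NS') (sub_bigjoin r NS').
  apply: subset_trans (sub_cl _ _); apply: (subset_trans _ (bigcup_sup M' hM')).
  by apply: sub_bigjoin => //; rewrite inE NS.
have eM : M = X M by apply/eqP; rewrite eqEsubset MA; case: (vX M hM).
have AS : A M \subset S by apply/subsetP=> Z; rewrite !inE => /andP[/andP[]].
have aA : antichain (A M).
  apply/forall_inP=> Z; rewrite inE => /andP[ZS _].
  apply/forall_inP=> Y; rewrite inE => /andP[YS _].
  by have /forall_inP/(_ Z ZS)/forall_inP/(_ Y YS) := antichain_maxs S.
case/nestedP: nS => SB /(_ _ AS aA); rewrite -/(X M) -eM MB.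
case: (leqP #|A M| 1) => [cA _|_ /(_ isT) //].
case: (set_0Vmem (A M)) => [A0|[Z ZA]].
  by move: (BG_neq0 MB); rewrite eM /X A0 /bigjoin big_set0 cl0 eqxx.
exists Z; first exact: (subsetP AS).
apply: (subset_trans GM); rewrite eM; apply: (bigjoin_sub rM) => [|Y YA].
  by apply: BG_flat; apply: (subsetP SB); apply: (subsetP AS).
by move/card_le1_eqP: cA => /(_ Y Z YA ZA) ->.
Qed.

(** Incomparable members sharing a point would form an antichain whose join is in [BG] by
    [BG_joinU]. *)
Lemma nested_laminar S X Y e : nested r BG S -> X \in S -> Y \in S ->
  e \in X -> e \in Y -> (X \subset Y) || (Y \subset X).
Proof.
move=> nS XS YS eX eY; have [XB YB] := (nested_BG nS XS, nested_BG nS YS).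
apply: contraT; rewrite negb_or => /andP[nXY nYX].
case/nestedP: nS => _ /(_ [set X; Y]); rewrite subUset !sub1set XS YS => /(_ isT).
rewrite cards2; have -> : X != Y by apply: contraNneq nXY => ->.
rewrite /bigjoin bigcup_setU !big_set1 (BG_joinU XB YB eX eY).
have -> : antichain [set X; Y]; last by move=> /(_ isT isT).
apply/forall_inP=> A; rewrite !inE => /orP[]/eqP->; apply/forall_inP=> B;
  by rewrite !inE => /orP[]/eqP->; rewrite ?eqxx ?implybT ?(negPf nXY) ?(negPf nYX).
Qed.

Lemma mem_JG S G e : nested r BG S -> e \in JG r S G ->
  exists X, [/\ X \in S, X \proper G & e \in X].
Proof.
move=> nS eJ; have nD : nested r BG [set H in S | H \proper G].
  by apply: nested_sub nS; apply/subsetP=> X; rewrite inE => /andP[].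
have [|X] := nested_cover nD (BG_atom e); first by rewrite cl_subP ?flat_cl // sub1set.
rewrite inE => /andP[XS XG] /subsetP h; exists X; split=> //.
by apply: h; rewrite (subsetP (sub_cl _ _)) ?inE.
Qed.

Lemma sub_JG_ex S G X : nested r BG S -> X \in BG -> X \subset JG r S G ->
  exists Y, [/\ Y \in S, Y \proper G & X \subset Y].
Proof.
move=> nS XB XJ; have nD : nested r BG [set H in S | H \proper G].
  by apply: nested_sub nS; apply/subsetP=> Y; rewrite inE => /andP[].
by have [Y] := nested_cover nD XB XJ; rewrite inE => /andP[YS YG] XY; exists Y.
Qed.

Lemma JG_proper S G : nested r BG S -> G \in BG -> JG r S G \proper G.
Proof.
move=> nS GB; rewrite properE JG_sub ?BG_flat //; apply/negP => GJ.
have [Y [_ YG GY]] := sub_JG_ex nS GB GJ.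
by move: YG; rewrite properE GY andbF.
Qed.

Lemma JG_rk S G : nested r BG S -> G \in BG -> r (JG r S G) < r G.
Proof. by move=> nS GB; apply: proper_rk => //; [apply: (flat_cl rM)|apply: JG_proper]. Qed.

End Building.

(** * Refinement of nested sets along the chains of completeness *)

Section Refinement.
Variables (E : finType) (r : {set E} -> nat) (BG : {set {set E}}) (o : E -> nat).
Hypotheses (rM : is_matroid_rank r) (rL : loopless r) (bG : building_set r BG).
Hypotheses (EB : [set: E] \in BG) (oI : injective o) (cG : complete r o BG).
Implicit Types (A B F G H J X Y P : {set E}) (S T D : {set {set E}}).

(** Indexed by the values of [o] rather than by the elements of [G]: the chain starts at the closure
    of [J] for [n = 0] and may be stationary. *)
Definition chain J G n := cl r (J :|: [set x in G | o x < n]).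

Lemma flat_chain J G n : flat r (chain J G n).
Proof. exact: (flat_cl rM). Qed.

Lemma sub_chain J G n : J \subset chain J G n.
Proof. exact: subset_trans (subsetUl _ _) (sub_cl _ _). Qed.

Lemma mem_chain J G n x : x \in G -> o x < n -> x \in chain J G n.
Proof. by move=> xG xn; rewrite (subsetP (sub_cl _ _)) // in_setU [x \in finset _]inE xG xn orbT. Qed.

Lemma chain_subP J G n F : flat r F -> J \subset F ->
  (forall x, x \in G -> o x < n -> x \in F) -> chain J G n \subset F.
Proof.
move=> fF JF h; rewrite cl_subP // subUset JF; apply/subsetP=> x.
by rewrite inE => /andP[]; apply: h.
Qed.

Lemma chain_mono J G m n : m <= n -> chain J G m \subset chain J G n.
Proof.
move=> mn; apply: chain_subP; [exact: flat_chain|exact: sub_chain|].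
by move=> x xG xm; apply: mem_chain => //; apply: leq_trans mn.
Qed.

Lemma chain0 J G : flat r J -> chain J G 0 = J.
Proof.
by move=> fJ; apply/eqP; rewrite eqEsubset sub_chain andbT; apply: chain_subP.
Qed.

Lemma chain_sub J G n : flat r G -> J \subset G -> chain J G n \subset G.
Proof. by move=> fG JG; apply: chain_subP. Qed.

Lemma chain_top J G : flat r G -> J \subset G -> exists n, chain J G n == G.
Proof.
move=> fG JG; exists (\max_x o x).+1; rewrite eqEsubset chain_sub //.
by apply/subsetP=> x xG; apply: mem_chain => //; rewrite ltnS; apply: leq_bigmax.
Qed.

Lemma chainS J G n : chain J G n.+1 = chain J G n \/
  exists x, [/\ x \in G, o x = n & chain J G n.+1 = cl r (x |: chain J G n)].
Proof.
case: (pickP [pred x | (x \in G) && (o x == n)]) => [x /andP[xG /eqP xn]|none].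
  right; exists x; split=> //; apply/eqP; rewrite eqEsubset; apply/andP; split.
    apply: chain_subP; first exact: (flat_cl rM).
      exact: subset_trans (sub_chain _ _ _) (subset_trans (subsetUr _ _) (sub_cl _ _)).
    move=> y yG; rewrite ltnS leq_eqVlt => /predU1P[yn|yn].
      have -> : y = x by apply: oI; rewrite yn xn.
      by rewrite (subsetP (sub_cl _ _)) ?setU11.
    by rewrite (subsetP (sub_cl _ _)) // in_setU mem_chain ?orbT.
  rewrite cl_subP ?flat_chain // subUset chain_mono // sub1set andbT.
  by apply: mem_chain; rewrite ?xn.
left; apply/eqP; rewrite eqEsubset (chain_mono _ _ (leqnSn n)) andbT.
apply: chain_subP; [exact: flat_chain|exact: sub_chain|].
move=> y yG; rewrite ltnS leq_eqVlt => /orP[yn|yn]; last exact: mem_chain.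
by have := none y; rewrite /= yG yn.
Qed.

Lemma chain_rkS J G n : r (chain J G n.+1) <= (r (chain J G n)).+1.
Proof.
case: (chainS J G n) => [->|[x [_ _ ->]]]; first exact: leqnSn.
by rewrite (rk_cl rM (x |: _)) rkU1.
Qed.

(** Completeness speaks of the elements of [G :\: J]; the member of index [n] is the one attached to
    the [o]-largest such element below [n]. *)
Lemma chain_BG J G n : flat r J -> G \in BG -> J \subset G ->
  chain J G n = J \/ exists2 N, N \in BG & chain J G n = cl r (J :|: N).
Proof.
move=> fJ GB JG; pose Q x := (x \in G :\: J) && (o x < n).
case: (pickP Q) => [x0 Qx0|none]; last first.
  left; apply/eqP; rewrite eqEsubset sub_chain andbT; apply: chain_subP => // x xG xn.
  by apply: contraFT (none x) => xJ; rewrite /Q inE xJ xG xn.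
case: (@arg_maxnP _ x0 Q o Qx0) => e /andP[eGJ en] emax.
have := cG fJ GB JG eGJ; rewrite /=.
have -> : cl r (J :|: [set x in G :\: J | o x <= o e]) = chain J G n.
  apply/eqP; rewrite eqEsubset; apply/andP; split.
    rewrite cl_subP ?flat_chain // subUset sub_chain; apply/subsetP=> x.
    rewrite inE => /andP[/setDP[xG _] xe]; apply: mem_chain => //.
    exact: leq_ltn_trans en.
  apply: chain_subP; first exact: (flat_cl rM).
    exact: subset_trans (subsetUl _ _) (sub_cl _ _).
  move=> x xG xn; rewrite (subsetP (sub_cl _ _)) // in_setU.
  case xJ : (x \in J) => //=; rewrite inE inE xJ xG /=; apply: emax.
  by rewrite /Q inE xJ xG.
by case=> [->|[N [NB ->]]]; [left|right; exists N].
Qed.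

Lemma chain_last J G : flat r J -> flat r G -> J \proper G ->
  exists n, chain J G n != G /\ r G = (r (chain J G n)).+1.
Proof.
move=> fJ fG JG; have JG' := proper_sub JG.
have ex := chain_top fG JG'; case: (ex_minnP ex) => [[|n]].
  by rewrite chain0 // => /eqP eJ; move: JG; rewrite eJ properxx.
move=> /eqP hn hmin; exists n.
have ne : chain J G n != G.
  by apply/negP => /hmin; rewrite ltnn.
split=> //; have := chain_rkS J G n; rewrite hn.
have : r (chain J G n) < r G.
  by apply: (proper_rk rM (flat_chain _ _ _)); rewrite properEneq ne chain_sub.
lia.
Qed.

(* [F] is the last proper member of the chain from [J^G] to [G], and [H] the
   factor of [F] that is not already covered by [J^G]. *)
Definition insertable S G n H :=
  let F := chain (JG r S G) G n in
  [/\ r G = (r F).+1, H \in maxG BG F, H \notin S, H \proper G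
    & F = cl r (JG r S G :|: H)].

(** Completeness writes [F] as the join of [J^G] with some [N], and [H] is the factor of [F]
    containing [N]. If [H] were in [S] it would lie in [J^G], leaving no rank gap of two. *)
Lemma insertable_ex S G : nested r BG S -> G \in S -> (r (JG r S G)).+1 < r G ->
  exists n H, insertable S G n H.
Proof.
move=> nS GS d2; have GB := nested_BG nS GS; have fG := BG_flat bG GB.
have JGp := JG_proper rM rL bG nS GB.
have [n [ne rG]] := chain_last (flat_JG rM S G) fG JGp.
have [e|[N NB eF]] := chain_BG n (flat_JG rM S G) GB (proper_sub JGp).
  by move: d2; rewrite rG e; lia.
have NF : N \subset chain (JG r S G) G n.
  by rewrite eF; apply: subset_trans (sub_cl _ _); apply: subsetUr.
have [H hH NH] := maxG_sup NB NF; have [HB HF _] := maxG_P hH.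
have HG : H \proper G.
  by apply: (sub_proper_trans HF); rewrite properEneq ne chain_sub ?proper_sub.
exists n, H; split=> //.
  apply/negP=> HS; have HJ := sub_JG r HS HG.
  move: d2; rewrite rG ltnS eF rk_cl // (setUidPl _) ?ltnn //.
  exact: subset_trans HJ.
apply/eqP; rewrite eqEsubset (cl_subP _ _ (flat_chain _ _ _)) ?subUset ?sub_chain ?HF //.
by rewrite eF cl_mono // setUS.
Qed.

(** A bad antichain must contain [H]. If its other members all lie strictly below [G], its join
    stays in [F] and equals [H] by maximality; otherwise replacing the members below [G] by [G]
    gives a bad antichain of [S], as the old join and [G] share a point of [H]. *)
Lemma insertable_nested S G n H : nested r BG S -> G \in S ->
  insertable S G n H -> nested r BG (H |: S).
Proof.
move=> nS GS [rG hH HnS HG eF]; have [HB HF Hmax] := maxG_P hH.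
have /set0Pn[e eH] := BG_neq0 rM rL bG HB; have GB := nested_BG nS GS.
have [SB nSP] := nestedP _ _ _ nS.
apply/nestedP; split; first by rewrite subUset sub1set HB.
move=> T TS aT cT; apply/negP => NB.
have inT X : X \in T -> X != H -> X \in S.
  by move=> /(subsetP TS); rewrite !inE => /predU1P[->|//]; rewrite eqxx.
have antiT X Y : X \in T -> Y \in T -> X \subset Y -> X = Y.
  by move=> XT YT XY; apply/eqP; move/forall_inP/(_ X XT)/forall_inP/(_ Y YT)/implyP: aT; apply.
have HT : H \in T.
  apply: contraT => HnT; suff TS' : T \subset S by case/negP: (nSP T TS' aT cT).
  apply/subsetP=> X XT; apply: inT => //.
  by apply: contraNneq HnT => <-.
have HN : H \subset bigjoin r T by apply: sub_bigjoin.
case: (pickP [pred X in T | (X != H) && ~~ (X \proper G)]) => [B|none].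
  move=> /and3P[BT BH BG'].
  pose T' := G |: [set X in T | ~~ (X \proper G)].
  have incomp X : X \in T -> ~~ (X \proper G) -> (X \in S) * (X \subset G = false) * (G \subset X = false).
    move=> XT XG; have XH : X != H by apply: contraNneq XG => ->.
    have GX : G \subset X = false.
      apply/negP=> GX; case/eqP: XH; apply/esym/antiT => //.
      exact: subset_trans (proper_sub HG) GX.
    rewrite GX inT //; split=> //; split=> //; apply: contraNF XG => XG.
    by rewrite properE XG GX.
  have T'S : T' \subset S.
    by rewrite subUset sub1set GS; apply/subsetP=> X; rewrite inE => /andP[XT XG]; rewrite incomp.
  have aT' : antichain T'.
    apply/forall_inP=> X; rewrite !inE => hX; apply/forall_inP=> Y; rewrite !inE => hY.
    apply/implyP=> XY; case/predU1P: hX XY => [->|/andP[XT XG]].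
      by case/predU1P: hY => [->|/andP[YT YG]] //; rewrite incomp.
    case/predU1P: hY => [->|/andP[YT YG]]; first by rewrite incomp.
    by move=> XY; apply/eqP/antiT.
  have cT' : 1 < #|T'|.
    rewrite cardsU1 inE properxx andbT (_ : G \in T = false); last first.
      by apply/negP=> /(incomp G)/(_ (introT negPf (properxx _))); rewrite subxx => -[[_]].
    by rewrite ltnS card_gt0; apply/set0Pn; exists B; rewrite inE BT BG'.
  have := nSP _ T'S aT' cT'; rewrite (_ : bigjoin r T' = cl r (bigjoin r T :|: G)); last first.
    apply/eqP; rewrite eqEsubset; apply/andP; split.
      apply: (bigjoin_sub rM); first exact: (flat_cl rM).
      move=> X; rewrite !inE => /predU1P[->|/andP[XT _]]; apply: subset_trans (sub_cl _ _).
        exact: subsetUr.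
      exact: subset_trans (sub_bigjoin r XT) (subsetUl _ _).
    have GT' : G \subset bigjoin r T' by apply: sub_bigjoin; rewrite setU11.
    rewrite cl_subP ?flat_bigjoin // subUset GT' andbT.
    apply: (bigjoin_sub rM) => [|X XT]; first exact: flat_bigjoin.
    case XG : (X \proper G); first exact: subset_trans (proper_sub XG) GT'.
    by apply: sub_bigjoin; rewrite !inE XT XG orbT.
  by rewrite (BG_joinU rM rL bG NB GB (e := e)) ?(subsetP HN) ?(subsetP (proper_sub HG)).
have NH : bigjoin r T = H.
  apply: Hmax => //; apply: (bigjoin_sub rM) => [|X XT]; first exact: flat_chain.
  case: (eqVneq X H) => [->//|XH]; apply: subset_trans (sub_chain _ _ _).
  apply: sub_JG; first exact: inT.
  by have := none X; rewrite /= XT XH /= => /negbFE.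
have := cT; rewrite (_ : T = [set H]) ?cards1 //; apply/eqP; rewrite eqEsubset sub1set HT andbT.
apply/subsetP=> X XT; rewrite inE; apply/eqP/antiT => //.
by rewrite -NH sub_bigjoin.
Qed.

Lemma nested_setT S : nested r BG S -> nested r BG (setT |: S).
Proof.
move=> /nestedP[SB nS]; apply/nestedP; split; first by rewrite subUset sub1set EB.
move=> T TS aT cT; case TT : (setT \in T).
  have := cT; rewrite (_ : T = [set setT]) ?cards1 //; apply/eqP.
  rewrite eqEsubset sub1set TT andbT; apply/subsetP=> X XT; rewrite inE.
  by move/forall_inP/(_ X XT)/forall_inP/(_ setT TT): aT; rewrite subsetT.
apply: nS => //; apply/subsetP=> X XT; have := subsetP TS X XT.
by rewrite !inE => /predU1P[eX|//]; move: XT; rewrite eX TT.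
Qed.

Lemma max_nestedP T : reflect
  (nested r BG T /\ forall X, nested r BG (X |: T) -> X \in T) (max_nested r BG T).
Proof.
apply: (iffP andP) => [[nT /forallP h]|[nT h]]; split=> //.
  move=> X nX; apply: contraT => XT; have /implyP := h (X |: T).
  by rewrite nX; apply; rewrite properE subsetUr subUset sub1set (negPf XT).
apply/forallP=> S; apply/implyP=> /properP[TS [X XS XT]].
apply: contra XT => nS; apply: h; apply: nested_sub nS.
by rewrite subUset sub1set XS.
Qed.

Lemma max_nested_nested T : max_nested r BG T -> nested r BG T.
Proof. by case/andP. Qed.

Lemma max_nested_setT T : max_nested r BG T -> setT \in T.
Proof. by case/max_nestedP=> nT; apply; apply: nested_setT. Qed.

Lemma max_nested_rk T G : max_nested r BG T -> G \in T -> r G = (r (JG r T G)).+1.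
Proof.
case/max_nestedP=> nT h GT; have := JG_rk rM rL bG nT (nested_BG nT GT).
rewrite leq_eqVlt => /predU1P[//|d2].
have [n [H ins]] := insertable_ex nT GT d2.
have := h _ (insertable_nested nT GT ins); case: ins => _ _ /negPf -> //.
Qed.

Definition downset S D :=
  D \subset S /\ forall X Y, X \in D -> Y \in S -> Y \subset X -> Y \in D.

(** A downset stays one when an element of largest size is removed. The ranks of joins of downsets
    are computed in this order. *)
Lemma downset_ind S (Q : {set {set E}} -> Prop) :
  Q set0 ->
  (forall D X, downset S D -> X \in S -> X \notin D ->
     (forall Y, Y \in S -> Y \proper X -> Y \in D) -> Q D -> Q (X |: D)) ->
  forall D, downset S D -> Q D.
Proof.
move=> Q0 QS D; move: {2}#|D| (leqnn #|D|) => k.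
elim: k D => [|k IH] D kD [DS dD].
  by move: kD; rewrite leqn0 cards_eq0 => /eqP->.
case: (set_0Vmem D) => [->//|[X0 X0D]].
case: (@arg_maxnP _ X0 (mem D) (fun B => #|B|) X0D) => X; move=> /= XD Xmax.
rewrite -(setD1K XD); have dX : downset S (D :\ X).
  split; first exact: subset_trans (subsetDl _ _) DS.
  move=> Y Z /setD1P[YX YD] ZS ZY; rewrite !inE (dD Y) // andbT.
  apply: contraNneq YX => eZ; rewrite eq_sym eqEcard -{1}eZ ZY; exact: Xmax.
apply: QS => //; first exact: (subsetP DS).
- by rewrite setD11.
- move=> Y YS YX; rewrite !inE (dD X) ?(proper_sub YX) // andbT.
  by apply: contraTneq YX => ->; rewrite properxx.
- by apply: IH => //; move: kD; rewrite (cardsD1 X D) (_ : X \in D).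
Qed.

Lemma bigjoinU1 X D : bigjoin r (X |: D) = cl r (X :|: bigjoin r D).
Proof.
apply/eqP; rewrite eqEsubset; apply/andP; split.
  apply: (bigjoin_sub rM) => [|Y]; first exact: (flat_cl rM).
  rewrite !inE => /predU1P[->|YD]; apply: subset_trans (sub_cl _ _); first exact: subsetUl.
  exact: subset_trans (sub_bigjoin r YD) (subsetUr _ _).
rewrite cl_subP ?flat_bigjoin // subUset sub_bigjoin ?setU11 //=.
by apply: bigjoin_mono => //; apply: subsetUr.
Qed.

Lemma downset_notin S D X : nested r BG S -> downset S D -> X \in S -> X \notin D ->
  ~~ (X \subset bigjoin r D).
Proof.
move=> nS [DS dD] XS; apply: contra => XJ.
have [Y YD XY] := nested_cover rM rL bG (nested_sub DS nS) (nested_BG nS XS) XJ.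
exact: dD XY.
Qed.

(** A member outside the downset is not under its join, by [nested_cover], so adding it raises the
    rank. *)
Lemma rk_downset_ge S D : nested r BG S -> downset S D -> #|D| <= r (bigjoin r D).
Proof.
move=> nS; elim/downset_ind=> [|{}D X dD XS XD _ IH]; first by rewrite cards0.
rewrite cardsU1 XD add1n (leq_ltn_trans IH) // bigjoinU1 rk_cl //.
apply: (proper_rk rM); first exact: flat_bigjoin.
by rewrite properE subsetUr subUset subxx andbT (downset_notin nS).
Qed.

(** Since [J^X] lies in both [X] and the join of the downset, submodularity limits the increase
    caused by [X] to the gap, which is one. *)
Lemma rk_downset S D : nested r BG S -> (forall G, G \in S -> r G = (r (JG r S G)).+1) ->
  downset S D -> r (bigjoin r D) = #|D|.
Proof.
move=> nS d1 dD; apply/eqP; rewrite eqn_leq (rk_downset_ge nS) // andbT.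
elim/downset_ind: D / dD => [|D X dD XS XD below IH].
  by rewrite /bigjoin big_set0 rk_cl // rk0.
rewrite cardsU1 XD add1n bigjoinU1 rk_cl //.
have JD : JG r S X \subset bigjoin r D.
  by apply: bigjoin_mono => //; apply/subsetP=> Y; rewrite inE => /andP[]; apply: below.
have JX : JG r S X \subset X by apply: JG_sub => //; apply: BG_flat (nested_BG nS XS).
have := rk_submod rM X (bigjoin r D); rewrite (d1 X XS).
have /(rk_mono rM) : JG r S X \subset X :&: bigjoin r D by rewrite subsetI JX JD.
move: IH; lia.
Qed.

Lemma bigjoin_setT S : setT \in S -> bigjoin r S = setT.
Proof. by move=> h; apply/eqP; rewrite eqEsubset subsetT sub_bigjoin. Qed.

Lemma card_nested S : nested r BG S -> #|S| <= r setT.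
Proof.
move=> nS; have := rk_downset_ge (S := S) (D := S) nS.
rewrite /downset => /(_ (conj (subxx _) _)) h; apply: leq_trans (h _) _ => //.
by rewrite rk_mono // subsetT.
Qed.

Lemma card_tight S : nested r BG S -> setT \in S ->
  (forall G, G \in S -> r G = (r (JG r S G)).+1) -> #|S| = r setT.
Proof. by move=> nS TS d1; rewrite -(rk_downset nS d1 (D := S)) // bigjoin_setT. Qed.

Lemma card_max_nested T : max_nested r BG T -> #|T| = r setT.
Proof.
move=> mT; apply: card_tight; [exact: max_nested_nested|exact: max_nested_setT|].
by move=> G; apply: max_nested_rk.
Qed.

Lemma tight_max_nested S : nested r BG S -> setT \in S ->
  (forall G, G \in S -> r G = (r (JG r S G)).+1) -> max_nested r BG S.
Proof.
move=> nS TS d1; rewrite /max_nested nS; apply/forallP=> S'; apply/implyP=> /proper_card.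
rewrite (card_tight nS) // ltnNge; apply: contra; exact: card_nested.
Qed.

Lemma lam_ex T G : max_nested r BG T -> G \in T -> exists g, lam_is r o T G g.
Proof.
move=> mT GT; have nT := max_nested_nested mT; have GB := nested_BG nT GT.
have /properP[JG' [x xG xJ]] := JG_proper rM rL bG nT GB.
pose Q x := x \in G :\: JG r T G.
have Qx : Q x by rewrite /Q inE xJ.
case: (@arg_minnP _ x Q o Qx) => g; rewrite /Q inE => /andP[gJ gG] gmin.
exists g; rewrite /lam_is; apply/andP; split.
  apply/eqP/(sub_eq_rk rM); rewrite ?flat_cl // ?cl_subP ?(BG_flat bG) //.
    by rewrite subUset sub1set gG.
  by rewrite rk_cl // flat_rkU1 ?flat_JG // (max_nested_rk mT GT).
apply/forallP=> y; apply/implyP=> /eqP ey; apply: gmin.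
have yG : y \in G by rewrite -ey (subsetP (sub_cl _ _)) ?setU11.
rewrite inE yG andbT; apply/negP=> yJ; move: ey; rewrite (setUidPr _) ?sub1set //.
rewrite cl_flat ?flat_JG // => eJ; have := JG_proper rM rL bG nT GB.
by rewrite eJ properxx.
Qed.

(** As the rank gap is one, every element of [G] outside [J^G] generates [G] over [J^G]; the label
    is the least of them. *)
Lemma lamP T G g : max_nested r BG T -> G \in T -> lam_is r o T G g ->
  [/\ g \in G, g \notin JG r T G & forall x, x \in G -> o x < o g -> x \in JG r T G].
Proof.
move=> mT GT /andP[/eqP eg /forallP hg]; have nT := max_nested_nested mT.
have GB := nested_BG nT GT; have fG := BG_flat bG GB.
have gG : g \in G by rewrite -eg (subsetP (sub_cl _ _)) ?setU11.
split=> //.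
  apply/negP=> gJ; move: eg; rewrite (setUidPr _) ?sub1set //.
  rewrite cl_flat ?flat_JG // => eJ; have := JG_proper rM rL bG nT GB.
  by rewrite eJ properxx.
move=> x xG; rewrite ltnNge; apply: contraNT => xJ.
have := hg x; rewrite (_ : cl r _ = G) ?eqxx //.
apply/(sub_eq_rk rM); rewrite ?flat_cl // ?cl_subP //.
  by rewrite subUset sub1set xG JG_sub.
by rewrite rk_cl // flat_rkU1 ?flat_JG // (max_nested_rk mT GT).
Qed.

Lemma parent_ex T X : nested r BG T -> setT \in T -> X \in T -> X != setT ->
  exists P, parent_is T X P.
Proof.
move=> nT TT XT XnT; pose Q P := (P \in T) && (X \proper P).
have QT : Q setT by rewrite /Q TT properT.
case: (@arg_minnP _ setT Q (fun B => #|B|) QT) => P /andP[PT XP] Pmin.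
exists P; rewrite /parent_is PT XP; apply/forall_inP=> H HT; apply/implyP=> XH.
have /set0Pn[e eX] := BG_neq0 rM rL bG (nested_BG nT XT).
have [eP eH] := (subsetP (proper_sub XP) _ eX, subsetP (proper_sub XH) _ eX).
case/orP: (nested_laminar rM rL bG nT PT HT eP eH) => // HP.
have /eqP -> // : H == P by rewrite eqEcard HP Pmin // /Q HT.
Qed.

Lemma parent_uniq T X P Q : parent_is T X P -> parent_is T X Q -> P = Q.
Proof.
move=> /and3P[PT XP /forall_inP hP] /and3P[QT XQ /forall_inP hQ].
apply/eqP; rewrite eqEsubset.
by move: (hP Q QT) (hQ P PT); rewrite XP XQ /= => -> ->.
Qed.

Lemma parent_sub T X P Y : parent_is T X P -> Y \in T -> X \proper Y -> P \subset Y.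
Proof. by move=> /and3P[_ _ /forall_inP h] YT XY; have := h Y YT; rewrite XY. Qed.

Definition asc T X := [&& X \in T, X != setT & ~~ descent r o T X].

Lemma asc_lam T X P x p : asc T X -> parent_is T X P ->
  lam_is r o T X x -> lam_is r o T P p -> o x <= o p.
Proof.
move=> /and3P[XT _ nd] pP lx lp; rewrite leqNgt; apply: contra nd => h.
rewrite /descent XT /=; apply/andP; split.
  case/and3P: pP => PT XP _; apply/negP; rewrite /is_maxin => /forall_inP h'.
  by have := h' P PT; rewrite XP.
apply/existsP; exists P; rewrite pP; apply/existsP; exists p; apply/existsP; exists x.
by rewrite lp lx.
Qed.

Lemma asc_lam_lt T X P x p : max_nested r BG T -> asc T X -> parent_is T X P ->
  lam_is r o T X x -> lam_is r o T P p -> o x < o p.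
Proof.
move=> mT aX pP lx lp; rewrite ltn_neqAle (asc_lam aX pP lx lp) andbT.
case/and3P: (pP) (aX) => PT XP _ /and3P[XT _ _].
have [xX _ _] := lamP mT XT lx; have [_ pJ _] := lamP mT PT lp.
apply: contraNneq pJ => /oI <-; apply: (subsetP (sub_JG r XT XP)) => //.
Qed.

Definition refines T S :=
  [/\ max_nested r BG T, S \subset T & forall X, X \in T -> X \notin S -> asc T X].

Lemma refines_setT T S : refines T S -> setT \in S.
Proof.
case=> mT _ h; apply: contraT => nS; have := h _ (max_nested_setT mT) nS.
by rewrite /asc eqxx andbF.
Qed.

Lemma refines_nested T S : refines T S -> nested r BG S.
Proof. by case=> /max_nested_nested nT ST _; apply: nested_sub nT. Qed.

(* Elements of [T] below [G] outside [J^G_S] are joined to [G] by ascents only,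
   so their labels are smaller than that of [G]. *)
Lemma refines_lam T S G X x g : refines T S -> G \in S -> lam_is r o T G g ->
  X \in T -> X \proper G -> ~~ (X \subset JG r S G) -> lam_is r o T X x -> o x < o g.
Proof.
move=> [mT ST hT] GS lg; have nT := max_nested_nested mT.
(* The induction climbs from [X] to its parent until [G] is reached. *)
move: {2}#|~: X| (leqnn #|~: X|) => k; elim: k X x => [|k IH] X x kX XT XG XJ lx.
  move: kX; rewrite leqn0 cards_eq0 => /eqP X0; move: XG.
  by rewrite -[X]setCK X0 setC0 properE subsetT andbF.
have GT := subsetP ST _ GS.
have XS : X \notin S by apply: contra XJ => XS; apply: sub_JG.
have aX := hT X XT XS; have [_ XnT _] := and3P aX.
have [P pP] := parent_ex nT (max_nested_setT mT) XT XnT.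
have [PT XP _] := and3P pP; have PG := parent_sub pP GT XG.
case: (eqVneq P G) => [eP|neP]; first by apply: (asc_lam_lt mT aX pP lx); rewrite eP.
have [p lp] := lam_ex mT PT; apply: leq_ltn_trans (asc_lam aX pP lx lp) _.
apply: (IH P p) => //.
- rewrite -ltnS (leq_trans _ kX) //; apply: proper_card.
  by rewrite properE !setCS -properE.
- by rewrite properEneq neP.
- by apply: contra XJ; apply: subset_trans (proper_sub XP).
Qed.

(** Each [X] in [T] is generated by its label over [J^X], so by [refines_lam] all members of [T]
    below [G] are generated over [J^G_S] by elements of [G] smaller than the label of [G].
    Conversely, these elements lie in [J^G_T] by minimality of the label. *)
Lemma refines_JG T S G g : refines T S -> G \in S -> lam_is r o T G g ->
  JG r T G = chain (JG r S G) G (o g).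
Proof.
move=> rT GS lg; case: (rT) => mT ST hT; have GT := subsetP ST _ GS.
apply/eqP; rewrite eqEsubset; apply/andP; split; last first.
  apply: chain_subP; [exact: flat_JG|exact: JG_mono|].
  by case: (lamP mT GT lg).
apply: (bigjoin_sub rM) => [|X]; first exact: flat_chain.
rewrite inE => /andP[XT XG].
move: {2}#|X| (leqnn #|X|) => k; elim: k X XT XG => [|k IH] X XT XG kX.
  by move: kX; rewrite leqn0 cards_eq0 => /eqP->; rewrite sub0set.
case XJ : (X \subset JG r S G); first exact: subset_trans XJ (sub_chain _ _ _).
have [x lx] := lam_ex mT XT; have [xX _ _] := lamP mT XT lx.
have ox : o x < o g by apply: (refines_lam rT GS lg XT XG _ lx); rewrite XJ.
have /eqP eX : cl r (x |: JG r T X) == X by case/andP: lx.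
rewrite -eX cl_subP ?flat_chain // subUset sub1set.
rewrite mem_chain ?(subsetP (proper_sub XG)) //=.
apply: (bigjoin_sub rM) => [|Y]; first exact: flat_chain.
rewrite inE => /andP[YT YX]; apply: IH => //; first exact: proper_trans YX XG.
by rewrite -ltnS (leq_trans (proper_card YX)).
Qed.

(** [J^G_T] and [F] are members of one chain, both of rank [r G - 1], so they agree. The member of
    [T] below [G] that covers [H] lies in [F], hence is [H] by maximality. *)
Lemma insertable_in T S G n H : refines T S -> G \in S -> insertable S G n H -> H \in T.
Proof.
move=> rT GS [rG hH _ _ _]; case: (rT) => mT ST _; have GT := subsetP ST _ GS.
have [g lg] := lam_ex mT GT; have eJ := refines_JG rT GS lg.
have [HB HF Hmax] := maxG_P hH; have rJ := max_nested_rk mT GT.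
have eF : JG r T G = chain (JG r S G) G n.
  move: rJ; rewrite eJ rG => [[rk]]; case: (leqP (o g) n) => h.
    by apply: (sub_eq_rk rM (flat_chain _ _ _) (chain_mono _ _ h)); rewrite rk.
  by apply/esym/(sub_eq_rk rM (flat_chain _ _ _) (chain_mono _ _ (ltnW h))); rewrite rk.
have [|Y [YT YG HY]] := sub_JG_ex rM rL bG (S := T) (G := G) (max_nested_nested mT) HB.
  by rewrite eF.
by rewrite -(Hmax Y) // ?(nested_BG (max_nested_nested mT)) // -eF sub_JG.
Qed.

(** By ranks [F = J^G_T], and maximality of [H] makes [G] its parent. If the label of [H] exceeded
    that of [G], the points of [H] used to generate [F] would already lie in [J^H]; the other
    members below [G] would then generate [F], and one of them would contain [H]. *)
Lemma insertable_asc T S G n H : G \in S -> insertable S G n H ->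
  max_nested r BG T -> H |: S \subset T -> asc T H.
Proof.
move=> GS [rG hH HnS HG eF] mT; rewrite subUset sub1set => /andP[HT ST].
have [HB HF Hmax] := maxG_P hH; have nT := max_nested_nested mT.
have GT := subsetP ST _ GS.
have eJ : chain (JG r S G) G n = JG r T G.
  apply: (sub_eq_rk rM (flat_chain _ _ _)).
    by rewrite eF cl_subP ?flat_JG // subUset JG_mono // sub_JG.
  by have := max_nested_rk mT GT; rewrite rG => -[->].
rewrite /asc HT /=; apply/andP; split.
  by apply: contraTneq HG => ->; rewrite properE subsetT andbF.
apply/negP => /and3P[_ _ /existsP[P /andP[pP /existsP[a /existsP[b /and3P[la lb ab]]]]]].
have [PT HP _] := and3P pP.
have eP : P = G.
  apply/eqP; have PG := parent_sub pP GT HG; apply: contraT => neP.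
  have PF : P \subset chain (JG r S G) G n.
    by rewrite eJ; apply: sub_JG; rewrite ?properEneq ?neP.
  have := Hmax P (nested_BG nT PT) PF (proper_sub HP) => eP.
  by move: HP; rewrite eP properxx.
rewrite {}eP in la pP HP PT; have [aG aJ _] := lamP mT GT la.
have na : n <= o a by rewrite leqNgt; apply: contra aJ => an; rewrite -eJ mem_chain.
have [bH bJ hb] := lamP mT HT lb.
pose D := [set X in T | (X \proper G) && (X != H)].
have DT : D \subset T by apply/subsetP=> X; rewrite inE => /andP[].
have FD : chain (JG r S G) G n \subset bigjoin r D.
  apply: chain_subP; first exact: flat_bigjoin.
    apply: bigjoin_mono => //; apply/subsetP=> X; rewrite !inE => /andP[XS ->].
    by rewrite (subsetP ST) //=; apply: contraNneq HnS => <-.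
  move=> x xG xn; have : x \in JG r T G by rewrite -eJ mem_chain.
  case/(mem_JG rM rL bG nT) => X [XT XG xX].
  case: (eqVneq X H) => [eX|XH]; last first.
    by apply: (subsetP (sub_bigjoin r (D := D) (X := X) _)) => //; rewrite inE XT XG.
  have : x \in JG r T H.
    apply: hb; first by rewrite -eX.
    exact: leq_trans xn (leq_trans na (ltnW ab)).
  apply/subsetP; apply: bigjoin_mono => //; apply/subsetP=> Y; rewrite !inE => /andP[-> YH] /=.
  rewrite (proper_trans YH HG); apply: contraTneq YH => ->; rewrite properxx //.
have [Y] := nested_cover rM rL bG (nested_sub DT nT) HB (subset_trans HF FD).
rewrite inE => /and3P[YT YG YH] HY; case/eqP: YH; apply: Hmax => //.
  exact: nested_BG nT YT.
by rewrite eJ sub_JG.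
Qed.

Lemma not_tight S : nested r BG S -> (forall G, G \in S -> r G = (r (JG r S G)).+1) \/
  exists G, G \in S /\ (r (JG r S G)).+1 < r G.
Proof.
move=> nS; case: (pickP [pred G in S | (r (JG r S G)).+1 < r G]) => [G /andP[GS h]|none].
  by right; exists G.
left=> G GS; have := JG_rk rM rL bG nS (nested_BG nS GS); have := none G.
rewrite /= GS; lia.
Qed.

Lemma refines_ex S : nested r BG S -> setT \in S -> exists T, refines T S.
Proof.
move: {2}(r setT - #|S|) (leqnn (r setT - #|S|)) => k.
elim: k S => [|k IH] S kS nS TS.
all: case: (not_tight nS) => [d1|[G [GS d2]]].
1,3: by exists S; split=> //; [exact: tight_max_nested|move=> X ->].
all: have [n [H ins]] := insertable_ex nS GS d2.
all: have nHS := insertable_nested nS GS ins; have HnS : H \notin S by case: ins.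
all: have := card_nested nHS; rewrite cardsU1 HnS => cH.
  by move: kS cH; lia.
have [||T [mT ST hT]] := IH (H |: S) _ nHS; [by rewrite cardsU1 HnS; lia|by rewrite inE TS orbT|].
exists T; split=> //; first by apply: subset_trans ST; apply: subsetUr.
move=> X XT XS; case: (eqVneq X H) => [->|XH]; first exact: insertable_asc ins mT ST.
by apply: hT; rewrite // !inE negb_or XH.
Qed.

Lemma refines_tight S T : refines T S ->
  (forall G, G \in S -> r G = (r (JG r S G)).+1) -> S = T.
Proof.
move=> rT d1; have nS := refines_nested rT; case: (rT) => mT ST _.
apply/eqP; rewrite eqEcard ST (card_max_nested mT).
by rewrite (card_tight nS (refines_setT rT) d1) leqnn.
Qed.

(** Every refinement of [S] contains the insertable [H], so it is also a refinement of [H |: S]. *)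
Lemma refines_uniq S T T' : refines T S -> refines T' S -> T = T'.
Proof.
move: {2}(r setT - #|S|) (leqnn (r setT - #|S|)) => k.
elim: k S => [|k IH] S kS rT rT'; have nS := refines_nested rT.
all: case: (not_tight nS) => [d1|[G [GS d2]]].
1,3: by rewrite -(refines_tight rT d1) -(refines_tight rT' d1).
all: have [n [H ins]] := insertable_ex nS GS d2.
all: have nHS := insertable_nested nS GS ins; have HnS : H \notin S by case: ins.
all: have := card_nested nHS; rewrite cardsU1 HnS => cH.
  by move: kS cH; lia.
have up T0 : refines T0 S -> refines T0 (H |: S).
  move=> rT0; have HT := insertable_in rT0 GS ins; case: rT0 => mT ST hT; split=> //.
    by rewrite subUset sub1set HT.
  by move=> X XT; rewrite !inE negb_or => /andP[_ XS]; apply: hT.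
by apply: (IH (H |: S)); [rewrite cardsU1 HnS; lia|exact: up|exact: up].
Qed.

(** [T] refines the set left after deleting [H] and [K], so [J^G_T] is generated over [J^G_S] by at
    most one [N] in [BG]. Some [X] in [T] below [G] contains [N], and the one of [H], [K] that
    differs from [X] would be covered by the other members below [G]. *)
Lemma asc_child_uniq T G H K : max_nested r BG T -> asc T H -> asc T K ->
  parent_is T H G -> parent_is T K G -> H = K.
Proof.
move=> mT aH aK pH pK; apply/eqP; apply: contraT => neHK.
have nT := max_nested_nested mT.
have [GT HG _] := and3P pH; have [_ KG _] := and3P pK.
have [HT _ _] := and3P aH; have [KT _ _] := and3P aK.
have child L Y : parent_is T L G -> Y \in T -> Y \proper G -> L \subset Y -> Y = L.
  move=> pL YT YG LY; apply/esym/eqP; apply: contraT => ne.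
  have := parent_sub pL YT; rewrite properEneq ne LY => /(_ isT) GY.
  by move: YG; rewrite properE GY andbF.
pose S := T :\: [set H; K].
have GS : G \in S.
  rewrite !inE GT andbT negb_or; apply/andP; split; apply/eqP=> e.
    by move: HG; rewrite e properxx.
  by move: KG; rewrite e properxx.
have rT : refines T S.
  split; [exact: mT|exact: subsetDl|].
  by move=> X XT; rewrite !inE XT andbT negbK => /orP[]/eqP->.
have [g lg] := lam_ex mT GT; have eJ := refines_JG rT GS lg.
have nS := refines_nested rT.
have [e|[N NB eN]] := chain_BG (o g) (flat_JG rM S G) (nested_BG nT GT) (JG_sub rM S (BG_flat bG (nested_BG nT GT))).
  have := sub_JG r HT HG; rewrite eJ e.
  case/(sub_JG_ex rM rL bG nS (nested_BG nT HT)) => Y [YS YG HY].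
  move: (YS); rewrite !inE => /andP[+ YT]; rewrite (child H Y) // eqxx //.
have : N \subset JG r T G by rewrite eJ eN; apply: subset_trans (sub_cl _ _); apply: subsetUr.
case/(sub_JG_ex rM rL bG nT NB) => X [XT XG NX].
have key L : parent_is T L G -> L \in T -> L \notin S -> X != L -> False.
  move=> pL LT LnS XL; have [_ LG _] := and3P pL.
  pose D := [set Y in T | (Y \proper G) && (Y != L)].
  have DT : D \subset T by apply/subsetP=> Y; rewrite inE => /andP[].
  have [|Y] := nested_cover rM rL bG (nested_sub DT nT) (nested_BG nT LT).
    apply: (subset_trans (sub_JG r LT LG)); rewrite eJ eN cl_subP ?flat_bigjoin //.
    rewrite subUset; apply/andP; split.
      apply: bigjoin_mono => //; apply/subsetP=> Y; rewrite inE => /andP[YS YG].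
      have YT : Y \in T by move: YS; rewrite inE => /andP[].
      by rewrite inE YT YG; apply: contraNneq LnS => <-.
    by apply: (subset_trans NX); apply: sub_bigjoin; rewrite inE XT XG.
  by rewrite inE => /and3P[YT YG YL] LY; move: YL; rewrite (child L Y) ?eqxx.
case: (eqVneq X H) => [eX|XH].
  by case: (key K) => //; rewrite ?eX // !inE eqxx orbT.
by case: (key H) => //; rewrite !inE eqxx.
Qed.

End Refinement.

(** * Exponent vectors *)

Section Exponents.
Variables (E : finType) (r : {set E} -> nat) (BG : {set {set E}}) (o : E -> nat).
Hypotheses (rM : is_matroid_rank r) (rL : loopless r) (bG : building_set r BG).
Hypotheses (EB : [set: E] \in BG) (oI : injective o) (cG : complete r o BG).
Implicit Types (A B F G H J X Y Z P : {set E}) (S T D V W : {set {set E}}).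

(** For a nested [S] containing [E] and a nonempty [X], laminarity makes this the least member of
    [S] above [X]. *)
Definition cov S X := \bigcap_(Y in S | X \subset Y) Y.

Lemma sub_cov S X : X \subset cov S X.
Proof. by apply/bigcapsP=> Y /andP[]. Qed.

Lemma cov_min S X Y : Y \in S -> X \subset Y -> cov S X \subset Y.
Proof. by move=> YS XY; apply: bigcap_inf; rewrite YS. Qed.

Lemma cov_id S X : X \in S -> cov S X = X.
Proof. by move=> XS; apply/eqP; rewrite eqEsubset sub_cov cov_min. Qed.

Lemma cov_mono S X Y : X \subset Y -> cov S X \subset cov S Y.
Proof.
move=> XY; apply/bigcapsP=> Z /andP[ZS YZ]; apply: cov_min => //.
exact: subset_trans YZ.
Qed.

Lemma cov_anti S W X : S \subset W -> cov W X \subset cov S X.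
Proof. by move=> SW; apply/bigcapsP=> Z /andP[ZS XZ]; apply: cov_min => //; apply: (subsetP SW). Qed.

Lemma cov_in S X : nested r BG S -> setT \in S -> X != set0 -> cov S X \in S.
Proof.
move=> nS TS /set0Pn[e eX]; pose Q P := (P \in S) && (X \subset P).
have QT : Q setT by rewrite /Q TS subsetT.
case: (@arg_minnP _ setT Q (fun B => #|B|) QT) => P /andP[PS XP] Pmin.
suff -> : cov S X = P by [].
apply/eqP; rewrite eqEsubset cov_min //=; apply/bigcapsP=> Y /andP[YS XY].
case/orP: (nested_laminar rM rL bG nS PS YS (subsetP XP _ eX) (subsetP XY _ eX)) => // YP.
by have /eqP -> // : Y == P by rewrite eqEcard YP Pmin // /Q YS.
Qed.

Definition block T S P := [set Z in T | cov S Z == P].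

Lemma max_nested_neq0 T X : max_nested r BG T -> X \in T -> X != set0.
Proof. by move=> /max_nested_nested nT XT; apply: (BG_neq0 rM rL bG); apply: nested_BG nT XT. Qed.

Lemma max_nested_flat T X : max_nested r BG T -> X \in T -> flat r X.
Proof. by move=> /max_nested_nested nT XT; apply: (BG_flat bG); apply: nested_BG nT XT. Qed.

(** The members of [T] below [P], and those below some member of [S] strictly under [P], are
    downsets with joins [P] and [J^P_S]. Their sizes are the ranks of these joins, and they differ
    by the block. *)
Lemma card_block T S P : max_nested r BG T -> S \subset T -> setT \in S -> P \in S ->
  r P = r (JG r S P) + #|block T S P|.
Proof.
move=> mT ST TS PS; have nT := max_nested_nested mT; have nS := nested_sub ST nT.
have PT := subsetP ST _ PS; have fP := max_nested_flat mT PT.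
have d1 G : G \in T -> r G = (r (JG r T G)).+1 by exact: (max_nested_rk rM rL bG EB oI cG).
pose D1 := [set Z in T | Z \subset P].
pose D2 := [set Z in T | [exists X in S, (X \proper P) && (Z \subset X)]].
have dD1 : downset T D1.
  split=> [|X Y]; first by apply/subsetP=> Z; rewrite inE => /andP[].
  by rewrite !inE => /andP[_ XP] -> YX; apply: subset_trans XP.
have dD2 : downset T D2.
  split=> [|X Y]; first by apply/subsetP=> Z; rewrite inE => /andP[].
  rewrite !inE => /andP[_ /exists_inP[Q QS /andP[QP XQ]]] -> YX.
  by apply/exists_inP; exists Q; rewrite // QP (subset_trans YX).
have e1 : bigjoin r D1 = P.
  apply/eqP; rewrite eqEsubset sub_bigjoin ?inE ?PT //= andbT.
  by apply: (bigjoin_sub rM) => // Z; rewrite inE => /andP[].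
have e2 : bigjoin r D2 = JG r S P.
  apply/eqP; rewrite eqEsubset; apply/andP; split.
    apply: (bigjoin_sub rM) => [|Z]; first exact: flat_JG.
    rewrite inE => /andP[_ /exists_inP[Q QS /andP[QP ZQ]]].
    exact: subset_trans ZQ (sub_JG r QS QP).
  apply: (bigjoin_sub rM) => [|Z]; first exact: flat_bigjoin.
  rewrite inE => /andP[ZS ZP]; apply: sub_bigjoin; rewrite inE (subsetP ST) //=.
  by apply/exists_inP; exists Z; rewrite // ZP subxx.
rewrite -{1}e1 -e2 !(rk_downset rM rL bG EB nT d1) // -(cardsID D2 D1).
have -> : D1 :&: D2 = D2.
  apply/setIidPr; apply/subsetP=> Z; rewrite !inE => /andP[-> /exists_inP[Q _ /andP[QP ZQ]]].
  exact: subset_trans ZQ (proper_sub QP).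
congr (_ + _); apply: eq_card => Z; rewrite !inE; case ZT : (Z \in T) => //=.
have cS := cov_in nS TS (max_nested_neq0 mT ZT).
apply/andP/eqP => [[nex ZP]|cP].
  apply/eqP; apply: contraNT nex => neP; apply/exists_inP; exists (cov S Z) => //.
  by rewrite properEneq neP cov_min // sub_cov.
rewrite -cP sub_cov; split=> //; apply/exists_inP=> [[Q QS /andP[QP ZQ]]].
by move: QP; rewrite properE (cov_min QS ZQ) andbF.
Qed.

Lemma block_self T S P : S \subset T -> P \in S -> P \in block T S P.
Proof. by move=> ST PS; rewrite inE (subsetP ST) //= cov_id. Qed.

Lemma child_sup T X Z : nested r BG T -> setT \in T -> X \in T -> Z \in T -> X \proper Z ->
  exists C, [/\ C \in T, parent_is T C Z & X \subset C].
Proof.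
move=> nT TT XT ZT XZ; pose Q C := [&& C \in T, C \proper Z & X \subset C].
have QX : Q X by rewrite /Q XT XZ subxx.
case: (@arg_maxnP _ X Q (fun B => #|B|) QX) => C /and3P[CT CZ XC] Cmax.
exists C; split=> //.
have [|P pP] := parent_ex rM rL bG nT TT CT.
  by apply: contraTneq CZ => ->; rewrite properE subsetT andbF.
have [PT CP _] := and3P pP.
suff <- : P = Z by [].
apply/eqP; apply: contraT => neP; have := proper_card CP; rewrite ltnNge => /negP; case.
apply: Cmax; rewrite /Q PT properEneq neP (parent_sub pP ZT CZ).
exact: subset_trans XC (proper_sub CP).
Qed.

Local Notation asc := (asc r o).
Local Notation refines := (refines r BG o).

(** Incomparable elements of a block would lie under different children of their least common cover
    in [T]. These children are outside [S], hence ascents with a common parent. *)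
Lemma block_chain T S P X Y : refines T S ->
  X \in block T S P -> Y \in block T S P -> (X \subset Y) || (Y \subset X).
Proof.
move=> rT; case: (rT) => mT ST hT; rewrite !inE => /andP[XT /eqP cX] /andP[YT /eqP cY].
have nT := max_nested_nested mT; have TS := refines_setT EB rT.
have TT := subsetP ST _ TS; have nS := nested_sub ST nT.
apply: contraT; rewrite negb_or => /andP[nXY nYX].
have X0 := max_nested_neq0 mT XT.
have XY0 : X :|: Y != set0 by rewrite setU_eq0 negb_and X0.
pose Z := cov T (X :|: Y); have ZT : Z \in T by apply: cov_in.
have [XZ YZ] : X \proper Z /\ Y \proper Z.
  have /andP[sX sY] : (X \subset Z) && (Y \subset Z) by rewrite -subUset sub_cov.
  by split; rewrite properEneq ?sX ?sY andbT; [apply: contraNneq nYX => ->|apply: contraNneq nXY => ->].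
have ZP : Z \subset P.
  have PS : P \in S by rewrite -cX; apply: cov_in.
  by apply: cov_min; rewrite ?(subsetP ST) // subUset -{1}cX -cY !sub_cov.
have [C [CT pC XC]] := child_sup nT TT XT ZT XZ.
have [D [DT pD YD]] := child_sup nT TT YT ZT YZ.
have ascC (K L : {set E}) : parent_is T K Z -> K \in T -> L \subset K -> cov S L = P -> asc T K.
  move=> pK KT LK cL; apply: hT => //; apply/negP=> KS; case/and3P: pK => _ KZ _.
  have := cov_min KS LK; rewrite cL => PK; move: KZ.
  by rewrite properE (subset_trans ZP PK) andbF.
have eCD : C = D.
  apply: (asc_child_uniq rM rL bG EB oI cG mT _ _ pC pD).
    exact: ascC pC CT XC cX.
  exact: ascC pD DT YD cY.
have ZC : Z \subset C by apply: cov_min => //; rewrite subUset XC eCD.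
by case/and3P: pC => _; rewrite properE ZC andbF.
Qed.

(* [mexp W P] is the exponent of [P] in the monomial attached to [W]; the
   predecessor is harmless since [r (JG r W P) < r P] for [P] in a nested [W]. *)
Definition mexp W P := if P \in W then (r P - r (JG r W P)).-1 else 0.

Definition ascents T := [set X in T | asc T X].

Definition admissible T V :=
  (V \subset ascents T) &&
  [forall G in T, descent r o T G ==> [exists X in V, parent_is T X G]].

Lemma admissible_asc T V X : admissible T V -> X \in V -> asc T X.
Proof. by move=> /andP[/subsetP h _] /h; rewrite inE => /andP[]. Qed.

Lemma refines_diff T V : max_nested r BG T -> V \subset ascents T -> refines T (T :\: V).
Proof.
move=> mT VA; split; [exact: mT|exact: subsetDl|].
move=> X XT; rewrite !inE XT andbT negbK => /(subsetP VA).
by rewrite inE => /andP[].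
Qed.

Lemma card_block_mexp T W P : refines T W -> P \in W -> #|block T W P| = (mexp W P).+1.
Proof.
move=> rT PW; case: (rT) => mT WT _; rewrite /mexp PW.
have TW := refines_setT EB rT.
have := card_block mT WT TW PW.
have : 0 < #|block T W P| by rewrite card_gt0; apply/set0Pn; exists P; apply: block_self.
by move: (r _) (r _) #|_| => a b c; lia.
Qed.

(** The blocks partition [T], and each has one element more than the exponent of its top, so the
    degree is [#|T| - #|T :\: V|]. *)
Lemma sum_mexp T V : max_nested r BG T -> V \subset ascents T ->
  \sum_(P in T :\: V) mexp (T :\: V) P = #|V|.
Proof.
move=> mT VA; have rT := refines_diff mT VA; set W := T :\: V in rT *.
have VT : V \subset T by apply: (subset_trans VA); apply/subsetP=> X; rewrite inE => /andP[].
have nT := max_nested_nested mT; have nW := nested_sub (subsetDl _ _ : W \subset T) nT.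
have TW := refines_setT EB rT.
have : #|T| = \sum_(P in W) #|block T W P|.
  rewrite -sum1_card (partition_big (cov W) (mem W)) /=.
    by apply: eq_bigr => P PW; rewrite sum1dep_card; apply: eq_card => Z; rewrite !inE.
  by move=> Z ZT; apply: cov_in => //; apply: max_nested_neq0 mT ZT.
rewrite (eq_bigr _ (fun P PW => card_block_mexp rT PW)).
under eq_bigr => P _ do rewrite -add1n.
rewrite big_split /= sum1_card; have := cardsID V T; rewrite (setIidPr VT) -/W.
by move=> <- /eqP; rewrite addnC eqn_add2l => /eqP.
Qed.

Lemma mexp_gt0 T W C P : refines T W -> P \in W -> C \in T -> C != P -> cov W C = P ->
  0 < mexp W P.
Proof.
move=> rT PW CT CP cC; case: (rT) => mT WT _.
rewrite -ltnS -(card_block_mexp rT PW) (cardsD1 P) (block_self WT PW) ltnS.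
by rewrite card_gt0; apply/set0Pn; exists C; rewrite !inE CP CT cC eqxx.
Qed.

Lemma cov_child T W X P : refines T W -> X \in T -> X \notin W -> P \in W ->
  parent_is T X P -> cov W X = P.
Proof.
move=> rT XT XW PW pP; have [PT XP _] := and3P pP; case: (rT) => mT WT _.
apply/eqP; rewrite eqEsubset cov_min ?(proper_sub XP) //=.
have TW := refines_setT EB rT.
have nW := refines_nested rT.
apply: (parent_sub pP); first by apply/(subsetP WT)/cov_in => //; apply: max_nested_neq0 mT XT.
rewrite properEneq sub_cov andbT; apply: contraNneq XW => ->.
by apply: cov_in => //; apply: max_nested_neq0 mT XT.
Qed.

Definition mexp_supp W := [set P | 0 < mexp W P].

(** A descent is not in [V], and its child in [V] makes its block nontrivial; so only ascents of [T]
    can be missing from the support. *)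
Lemma admissible_refines T V : max_nested r BG T -> admissible T V ->
  refines T (setT |: mexp_supp (T :\: V)).
Proof.
move=> mT aV; have VA : V \subset ascents T by case/andP: aV.
have rT := refines_diff mT VA; have nT := max_nested_nested mT.
split=> //.
  rewrite subUset sub1set (max_nested_setT EB mT); apply/subsetP=> P.
  by rewrite inE /mexp; case: ifP => // /setDP[].
move=> X XT; rewrite !inE negb_or => /andP[XnT m0]; rewrite /asc XT XnT /=.
apply: contra m0 => dX; case/andP: (aV) => _ /forall_inP/(_ X XT).
rewrite dX => /exists_inP[C CV pC].
have CA := admissible_asc aV CV; have [CT _ _] := and3P CA.
have XW : X \in T :\: V.
  rewrite inE XT andbT; apply/negP=> /(admissible_asc aV)/and3P[_ _].
  by rewrite dX.
have CW : C \notin T :\: V by rewrite inE CV.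
apply: (mexp_gt0 rT XW CT); last exact: (cov_child rT).
by case/and3P: pC => _; rewrite properEneq => /andP[].
Qed.

Lemma cov_between S W Z P : S \subset W -> P \in S -> cov W Z = P -> cov S Z = P.
Proof.
move=> SW PS cZ; apply/eqP; rewrite eqEsubset -{2}cZ cov_anti // andbT.
by apply: cov_min => //; rewrite -cZ sub_cov.
Qed.

Lemma block_up T W P Z Z' : Z \in block T W P -> P \in W -> Z' \in T ->
  Z \subset Z' -> Z' \subset P -> Z' \in block T W P.
Proof.
rewrite !inE => /andP[_ /eqP cZ] PW -> ZZ' Z'P; rewrite eqEsubset cov_min //=.
by rewrite -cZ cov_mono.
Qed.

(* Blocks of [W] and [W'] with a common top are up-closed subsets of equal size
   of a common chain, hence equal. *)
Lemma diff_sub T V V' : max_nested r BG T -> admissible T V -> admissible T V' ->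
  mexp (T :\: V) =1 mexp (T :\: V') -> T :\: V \subset T :\: V'.
Proof.
move=> mT aV aV' em; set W := T :\: V in em *; set W' := T :\: V' in em *.
have VA : V \subset ascents T by case/andP: aV.
have VA' : V' \subset ascents T by case/andP: aV'.
have rT := refines_diff mT VA; have rT' := refines_diff mT VA'.
have rS := admissible_refines mT aV; rewrite -/W in rT rS; rewrite -/W' in rT'.
set S := setT |: _ in rS.
have eS : S = setT |: mexp_supp W' by apply/setP=> P; rewrite !inE em.
have SW : S \subset W.
  rewrite subUset sub1set (refines_setT EB rT).
  by apply/subsetP=> P; rewrite inE /mexp; case: ifP.
have SW' : S \subset W'.
  rewrite eS subUset sub1set (refines_setT EB rT').
  by apply/subsetP=> P; rewrite inE /mexp; case: ifP.
apply/subsetP=> Y YW; have YT : Y \in T by move: YW; rewrite inE => /andP[].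
apply: contraT => YW'.
pose P := cov W' Y.
have PW' : P \in W'.
  apply: cov_in; [exact: refines_nested rT'|exact: (refines_setT EB rT')|].
  exact: max_nested_neq0 mT YT.
have neYP : Y != P by apply: contraNneq YW' => ->.
have PS : P \in S.
  by rewrite !inE em (mexp_gt0 rT' PW' YT neYP) ?orbT.
have PW := subsetP SW _ PS; have PT : P \in T by move: PW; rewrite inE => /andP[].
have cB : #|block T W P| = #|block T W' P|.
  by rewrite (card_block_mexp rT PW) (card_block_mexp rT' PW') em.
have YB' : Y \in block T W' P by rewrite inE YT /= eqxx.
have YB : Y \notin block T W P by rewrite inE YT cov_id.
have inS W0 Z : S \subset W0 -> Z \in block T W0 P -> Z \in block T S P.
  by move=> SW0; rewrite !inE => /andP[-> /eqP/(cov_between SW0 PS)->]; rewrite eqxx.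
have : block T W P \subset block T W' P :\ Y.
  apply/subsetP=> Z ZB; have ZT : Z \in T by move: ZB; rewrite inE => /andP[].
  have ZP : Z \subset P by move: ZB; rewrite inE => /andP[_ /eqP<-]; apply: sub_cov.
  have YP : Y \subset P by apply: sub_cov.
  rewrite in_setD1; apply/andP; split; first by apply: contraNneq YB => <-.
  case/orP: (block_chain rS (inS _ _ SW ZB) (inS _ _ SW' YB')) => [ZY|YZ].
    by case/negP: YB; apply: block_up ZB PW YT ZY YP.
  exact: block_up YB' PW' ZT YZ ZP.
by move/subset_leq_card; rewrite cB [X in X <= _](cardsD1 Y) YB' ltnn.
Qed.

(** The support determines [T] by uniqueness of refinements; the block sizes then determine [V]. *)
Lemma mexp_inj T V T' V' : max_nested r BG T -> max_nested r BG T' ->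
  admissible T V -> admissible T' V' ->
  mexp (T :\: V) =1 mexp (T' :\: V') -> (T, V) = (T', V').
Proof.
move=> mT mT' aV aV' em; have rS := admissible_refines mT aV.
have rS' := admissible_refines mT' aV'.
have eS : mexp_supp (T :\: V) = mexp_supp (T' :\: V') by apply/setP=> P; rewrite !inE em.
rewrite -eS in rS'; have eT := refines_uniq rM rL bG EB oI cG rS rS'.
rewrite -{}eT in mT' aV' em eS rS' *; congr (_, _).
have eW : T :\: V = T :\: V'.
  apply/eqP; rewrite eqEsubset (diff_sub mT aV aV' em).
  by apply: (diff_sub mT aV' aV) => P; rewrite em.
have sub U : admissible T U -> T :\: (T :\: U) = U.
  move=> /andP[UA _]; rewrite setDDr setDv set0U; apply/setIidPr.
  by apply: (subset_trans UA); apply/subsetP=> X; rewrite inE => /andP[].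
by rewrite -(sub V) // eW sub.
Qed.

(** In a chain, the number of elements strictly above is injective with values below [#|C|], hence
    takes each of these values once. *)
Lemma card_chain_top (C : {set {set E}}) m :
  (forall X Y, X \in C -> Y \in C -> (X \subset Y) || (Y \subset X)) -> m < #|C| ->
  #|[set Z in C | #|[set Y in C | Z \proper Y]| <= m]| = m.+1.
Proof.
move=> chC mC; pose d Z := #|[set Y in C | Z \proper Y]|.
have dlt Z : Z \in C -> d Z < #|C|.
  move=> ZC; apply: proper_card; rewrite properE; apply/andP; split.
    by apply/subsetP=> Y; rewrite inE => /andP[].
  by apply/subsetPn; exists Z; rewrite // inE properxx andbF.
have d_anti X Y : X \in C -> Y \in C -> X \proper Y -> d Y < d X.
  move=> XC YC XY; apply: proper_card; rewrite properE; apply/andP; split.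
    by apply/subsetP=> Z; rewrite !inE => /andP[-> YZ]; apply: proper_trans YZ.
  by apply/subsetPn; exists Y; rewrite !inE YC ?XY // properxx.
have dI : {in C &, injective d}.
  move=> X Y XC YC eq; apply/eqP; apply: contraT => ne.
  case/orP: (chC X Y XC YC) => h.
    by have := d_anti X Y XC YC; rewrite properEneq ne h eq ltnn => /(_ isT).
  by have := d_anti Y X YC XC; rewrite properEneq eq_sym ne h eq ltnn => /(_ isT).
have [k ck] : exists k, #|C| = k.+1 by case: #|C| mC => // k _; exists k.
pose f Z : 'I_k.+1 := inord (d Z).
have fE Z : Z \in C -> f Z = d Z :> nat by move=> ZC; rewrite inordK // -ck dlt.
have fI : {in C &, injective f}.
  by move=> X Y XC YC /(congr1 val) /=; rewrite !fE //; apply: dI.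
have fC : f @: C = setT.
  by apply/eqP; rewrite eqEcard subsetT cardsT card_ord card_in_imset // ck leqnn.
pose I := [set i : 'I_k.+1 | i <= m].
have -> : [set Z in C | d Z <= m] = C :&: f @^-1: I.
  by apply/setP=> Z; rewrite !inE; case ZC : (Z \in C) => //=; rewrite fE.
rewrite -(card_in_imset (f := f)); last by move=> X Y /setIP[XC _] /setIP[YC _]; apply: fI.
have -> : f @: (C :&: f @^-1: I) = I.
  apply/setP=> i; apply/imsetP/idP => [[Z /setIP[_]]|im]; first by rewrite inE => + ->.
  have : i \in f @: C by rewrite fC inE.
  by case/imsetP=> Z ZC ei; exists Z; rewrite // !inE ZC -ei; move: im; rewrite inE.
have mk : m.+1 <= k.+1 by rewrite -ck.
have wI : injective (widen_ord mk) by move=> a b /(congr1 val) /= e; apply: val_inj.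
rewrite -[RHS]card_ord -(card_imset _ wI).
apply: eq_card => i; rewrite inE; apply/idP/imsetP => [im|[j _ ->]].
  by exists (Ordinal (im : i < m.+1)) => //; apply: val_inj.
by rewrite -ltnS /= ltn_ord.
Qed.

(** In a refinement [T] of [S] with [E] added, each block is a chain ending at its top [P]. Putting
    the [m P] elements just below [P] into [V] gives [P] a block of size [m P + 1] in [W]. *)
Lemma mexp_onto (m : {set E} -> nat) :
  let S := [set P | 0 < m P] in nested r BG S ->
  (forall P, P \in S -> m P < r P - r (JG r S P)) ->
  exists T V, [/\ max_nested r BG T, admissible T V & mexp (T :\: V) =1 m].
Proof.
move=> S nS hm; pose S' := setT |: S; have nS' : nested r BG S' by apply: nested_setT.
have TS' : setT \in S' by rewrite setU11.
have [T rT] := refines_ex rM rL bG EB oI cG nS' TS'.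
case: (rT) => mT ST hT; have nT := max_nested_nested mT; have TT := subsetP ST _ TS'.
pose d Z := #|[set Y in T | (Z \proper Y) && (Y \subset cov S' Z)]|.
pose V := [set Y in T | (Y \notin S') && (d Y <= m (cov S' Y))].
have VA : V \subset ascents T.
  by apply/subsetP=> Y; rewrite !inE => /and3P[YT YS _]; rewrite YT hT // !inE.
have rW := refines_diff mT VA; set W := T :\: V in rW.
have SW : S' \subset W.
  by apply/subsetP=> P PS; rewrite in_setD (subsetP ST _ PS) in_set PS /= !andbF.
have nW := refines_nested rW; have TW := subsetP SW _ TS'.
have sm P : P \in S' -> m P < #|block T S' P|.
  move=> PS; have := card_block mT ST TS' PS.
  have c0 : 0 < #|block T S' P| by rewrite card_gt0; apply/set0Pn; exists P; apply: block_self.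
  (* Outside [S] only [E] with exponent zero remains, where a nonempty block suffices. *)
  case PS0 : (P \in S); last by move: PS0; rewrite inE => /negbT; rewrite -leqNgt leqn0 => /eqP->.
  have -> : JG r S' P = JG r S P.
    rewrite /JG; congr bigjoin; apply/setP=> X; rewrite !inE.
    by case: eqVneq => [->|//]; rewrite properE subsetT !andbF.
  by move=> e; have := hm P PS0; rewrite e addKn.
have bE P : P \in S' -> block T W P =
    [set Z in block T S' P | #|[set Y in block T S' P | Z \proper Y]| <= m P].
  move=> PS; apply/setP=> Z; rewrite [LHS]in_set [RHS]in_set.
  case ZT : (Z \in T); last by rewrite in_set ZT.
  have Z0 := max_nested_neq0 mT ZT.
  have dE : cov S' Z = P -> #|[set Y in block T S' P | Z \proper Y]| = d Z.
    move=> cZ; apply: eq_card => Y; rewrite !inE -andbA; case YT : (Y \in T) => //=.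
    rewrite andbC; case ZY : (Z \proper Y) => //=; apply/eqP/idP => [cY|YP].
      by rewrite cZ -cY sub_cov.
    apply/eqP; rewrite eqEsubset cov_min -?cZ //; last by rewrite cZ.
    by rewrite cov_mono // proper_sub.
  rewrite in_set ZT /=; apply/eqP/andP => [cZ|[/eqP cZ]].
    have cS := cov_between SW PS cZ; rewrite cS dE //; split=> //.
    case: (eqVneq Z P) => [eZ|neZ].
      rewrite /d cS eZ (_ : finset _ = set0) ?cards0 //; apply/setP=> Y.
      by rewrite !inE properE; case: (Y \subset P); rewrite ?andbF.
    have : Z \notin W by apply: contra neZ => ZW; rewrite -cZ cov_id.
    by rewrite inE ZT andbT negbK !inE cS => /and3P[].
  rewrite dE // => dZ; pose Y := cov W Z.
  have YW : Y \in W by apply: cov_in.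
  have YP : Y \subset P by apply: cov_min; rewrite ?(subsetP SW) // -cZ sub_cov.
  have ZY : Z \subset Y by apply: sub_cov.
  apply/eqP; apply: contraT; rewrite -/Y => neY.
  have cY : cov S' Y = P.
    by apply/eqP; rewrite eqEsubset cov_min //= -cZ cov_mono.
  have YT : Y \in T by move: YW; rewrite inE => /andP[].
  have YS : Y \notin S' by apply: contra neY => YS; rewrite -cY cov_id.
  move: YW; rewrite inE YT andbT inE YT YS cY /= => /negP; case.
  apply: leq_trans dZ; apply: subset_leq_card; apply/subsetP=> X.
  by rewrite !inE cY cZ => /and3P[-> YX ->]; rewrite (sub_proper_trans ZY).
have mE P : P \in S' -> mexp W P = m P.
  move=> PS; apply: succn_inj; rewrite -(card_block_mexp rW (subsetP SW _ PS)) bE //.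
  by apply: card_chain_top; [move=> X Y; apply: block_chain rT|apply: sm].
exists T, V; split=> //.
  rewrite /admissible VA; apply/forall_inP=> G GT; apply/implyP=> dG.
  have GS' : G \in S'.
    by apply: contraT => /(hT G GT)/and3P[_ _]; rewrite dG.
  have neGT : G != setT.
    apply: contraTneq dG => ->; rewrite /descent negb_and negb_and; apply/orP; right.
    apply/orP; left; rewrite negbK; apply/forall_inP=> H _.
    by rewrite properE subsetT andbF.
  have GS : G \in S by move: GS'; rewrite inE in_set1 (negPf neGT).
  have : 1 < #|block T S' G| by apply: leq_ltn_trans (sm G GS'); move: GS; rewrite inE.
  rewrite (cardsD1 G) block_self // ltnS card_gt0 => /set0Pn[Z].
  rewrite !inE => /and3P[neZ ZT /eqP cZ].
  have ZG : Z \proper G by rewrite properEneq neZ -cZ sub_cov.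
  have [C [CT pC ZC]] := child_sup nT TT ZT GT ZG.
  have [_ CG _] := and3P pC.
  have cC : cov S' C = G.
    apply/eqP; rewrite eqEsubset cov_min ?(proper_sub CG) //=.
    by rewrite -cZ cov_mono.
  have CS : C \notin S'.
    by apply/negP=> CS; move: CG; rewrite -cC cov_id // properxx.
  apply/exists_inP; exists C => //; rewrite inE CT CS cC /=.
  apply: leq_trans (_ : 1 <= _); last by move: GS; rewrite inE.
  rewrite /d cC -(cards1 G); apply: subset_leq_card; apply/subsetP=> Y.
  rewrite !inE => /and3P[YT CY YG]; rewrite eqEsubset YG.
  exact: parent_sub pC YT CY.
(* An element [P] of [W] outside [S'] has a trivial block: an element of [V] in it would be deeper
   in the same chain, and [P] would be in [V] as well. *)
move=> P; case PS : (P \in S'); first by rewrite mE.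
have m0 : m P = 0.
  by apply/eqP; rewrite -leqn0 leqNgt; apply: contraFN PS => h; rewrite !inE h orbT.
rewrite m0; apply/eqP; rewrite -leqn0 leqNgt; apply/negP => h.
have PW : P \in W by move: h; rewrite /mexp; case: ifP.
have PT : P \in T by move: PW; rewrite inE => /andP[].
move: h; rewrite -ltnS -(card_block_mexp rW PW) (cardsD1 P) block_self ?subsetDl //.
rewrite ltnS card_gt0 => /set0Pn[Z]; rewrite !inE => /and3P[neZ ZT /eqP cZ].
have Z0 := max_nested_neq0 mT ZT.
have ZP : Z \subset P by rewrite -cZ sub_cov.
have : Z \notin W by apply: contra neZ => ZW; rewrite -cZ cov_id.
rewrite !inE ZT andbT negbK /= => /andP[_ dZ].
have QS := cov_in nS' TS' Z0; set Q := cov S' Z in QS dZ.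
have PQ : P \subset Q by rewrite -cZ; apply: cov_anti.
have cP : cov S' P = Q by apply/eqP; rewrite eqEsubset cov_min //= cov_mono.
move: PW; rewrite inE PT andbT inE PT PS cP /= => /negP; case.
apply: leq_trans dZ; apply: subset_leq_card; apply/subsetP=> X.
by rewrite !inE cP -/Q => /and3P[-> PX ->]; rewrite (sub_proper_trans ZP).
Qed.

End Exponents.

(** * Counting stable maximal nested sets *)

Section Counting.

(** This expands the product with factor [X] on [C], [1 + X] on [A :\: C] and [1] elsewhere. *)
Lemma sum_subsets_between (I : finType) (A C : {set I}) : C \subset A ->
  (\sum_(V : {set I} | (C \subset V) && (V \subset A)) 'X^#|V| =
   'X^#|C| * (1 + 'X) ^+ (#|A| - #|C|) :> {poly rat})%R.
Proof.
move=> CA; pose F i : {poly rat} := (if i \in A then 'X else 0)%R.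
pose G i : {poly rat} := (if i \in C then 0 else 1)%R.
transitivity (\prod_i (F i + G i))%R.
  rewrite bigA_distr [RHS](bigID (fun V : {set I} => (C \subset V) && (V \subset A))) /=.
  rewrite [X in (_ + X)%R]big1 ?addr0 => [|V].
    apply: eq_bigr => V /andP[CV VA]; rewrite (bigID (mem V)) /=.
    rewrite (eq_bigr (fun=> 'X%R)) => [|i iV]; last by rewrite iV /F (subsetP VA).
    rewrite prodr_const [X in (_ * X)%R]big1 ?mulr1 // => i iV.
    by rewrite (negPf iV) /G; case: ifP => // /(subsetP CV); rewrite (negPf iV).
  rewrite negb_and => /orP[]/subsetPn[i i1 i2]; rewrite (bigD1 i) //=.
    by rewrite (negPf i2) /G i1 mul0r.
  by rewrite i1 /F (negPf i2) mul0r.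
rewrite (bigID (mem A)) /= [X in (_ * X)%R]big1 ?mulr1 => [|i iA]; last first.
  rewrite /F /G (negPf iA) add0r; case: ifP => // /(subsetP CA).
  by rewrite (negPf iA).
rewrite (bigID (mem C)) /=; congr (_ * _)%R.
  rewrite (eq_bigr (fun=> 'X%R)) => [|i /andP[iA iC]]; last by rewrite /F /G iA iC addr0.
  rewrite prodr_const; congr (_ ^+ _)%R; apply: eq_card => i.
  rewrite unfold_in /=; case iC : (i \in C); rewrite ?andbF ?andbT //.
  exact: (subsetP CA).
rewrite (eq_bigr (fun=> (1 + 'X)%R)) => [|i /andP[iA /negPf iC]]; last first.
  by rewrite /F /G iA iC addrC.
rewrite prodr_const; congr (_ ^+ _)%R; rewrite -(cardsID C A) (setIidPr CA) addKn.
by apply: eq_card => i; rewrite unfold_in /= inE andbC.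
Qed.

Variables (E : finType) (r : {set E} -> nat) (BG : {set {set E}}) (o : E -> nat).
Hypotheses (rM : is_matroid_rank r) (rL : loopless r) (bG : building_set r BG).
Hypotheses (EB : [set: E] \in BG) (oI : injective o) (cG : complete r o BG).
Implicit Types (A B F G H J X Y Z P : {set E}) (S T D V W : {set {set E}}).

Local Notation asc := (asc r o).
Local Notation desc T := (descent r o T).

Lemma card_ascents T : max_nested r BG T -> r setT = #|ascents r o T| + (des r o T).+1.
Proof.
move=> mT; rewrite -(card_max_nested rM rL bG EB oI cG mT).
rewrite (cardsD1 setT) (max_nested_setT EB mT) add1n addnS; congr _.+1.
rewrite -(cardsID (ascents r o T) (T :\ setT)); congr (_ + _).
  apply: eq_card => X; rewrite !inE /asc; case: (X \in T); rewrite ?andbF //=.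
  by case: (X != setT).
apply: eq_card => X; rewrite !inE /asc; case XT : (X \in T); rewrite ?andbF //=.
case: eqVneq => [->|_] /=; last by rewrite negbK andbT.
rewrite /descent; apply/esym/negP => /and3P[_ + _]; rewrite negb_forall => /existsP[H].
by rewrite negb_imply negbK properE subsetT !andbF.
Qed.

(** Bottom descents have no children and double descents have only descents as children; these are
    the two ways for a descent to lack an ascent among its children. *)
Lemma stableP T : max_nested r BG T -> reflect
  (forall G, G \in T -> desc T G -> exists X, asc T X /\ parent_is T X G)
  (T \in stable_max_nested r o BG).
Proof.
move=> mT; rewrite inE mT /=; apply: (iffP forall_inP) => h G GT.
  move=> dG; have := h G GT; rewrite /bottom_descent /double_descent dG /=.
  move=> /andP[-> /=]; rewrite negb_forall => /existsP[X].
  rewrite negb_imply inE => /andP[/andP[XT pX] dX]; exists X; split=> //.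
  rewrite /asc XT dX andbT /=; case/and3P: pX => _ XG _.
  by apply: contraTneq XG => ->; rewrite properE subsetT andbF.
rewrite /bottom_descent /double_descent; case dG : (desc T G) => //=.
have [X [/and3P[XT _ dX] pX]] := h G GT dG; have [_ XG _] := and3P pX.
apply/andP; split; first by apply/negP=> /forall_inP/(_ X XT); rewrite XG.
apply/negP=> /andP[_ /forall_inP/(_ X)]; rewrite inE XT pX => /(_ isT).
exact/negP.
Qed.

Definition forced T := [set X in ascents r o T | [exists G in T, desc T G && parent_is T X G]].

(** In a stable set a descent has exactly one ascent as a child, by [asc_child_uniq], so this child
    must be in [V] and the admissible sets form an interval. *)
Lemma admissibleE T V : max_nested r BG T -> T \in stable_max_nested r o BG ->
  admissible r o T V = (forced T \subset V) && (V \subset ascents r o T).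
Proof.
move=> mT /(stableP mT) st; rewrite /admissible andbC; case VA : (V \subset _); rewrite ?andbF ?andbT //.
apply/forall_inP/subsetP => [h X|h G GT].
  rewrite inE => /andP[XA /exists_inP[G GT /andP[dG pX]]].
  have := h G GT; rewrite dG => /exists_inP[Y YV pY].
  have := subsetP VA _ YV; move: XA; rewrite !inE => /andP[_ aX] /andP[_ aY].
  by rewrite (asc_child_uniq rM rL bG EB oI cG mT aX aY pX pY).
apply/implyP=> dG; have [X [aX pX]] := st G GT dG; apply/exists_inP; exists X => //.
apply: h; rewrite !inE aX andbT; have [-> _ _] := and3P aX.
by apply/exists_inP; exists G; rewrite // dG.
Qed.

(** Taking parents is a bijection from the forced ascents onto the descents. *)
Lemma card_forced T : max_nested r BG T -> T \in stable_max_nested r o BG ->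
  #|forced T| = des r o T.
Proof.
move=> mT /(stableP mT) st.
pose par X := odflt setT [pick P | parent_is T X P].
have parE X P : parent_is T X P -> par X = P.
  move=> pP; rewrite /par; case: pickP => [Q pQ|/(_ P)]; last by rewrite pP.
  exact: parent_uniq pQ pP.
rewrite /des -(card_in_imset (f := par)); last first.
  move=> X Y; rewrite !inE => /andP[/andP[_ aX] /exists_inP[G _ /andP[_ pG]]].
  move=> /andP[/andP[_ aY] /exists_inP[G' _ /andP[_ pG']]].
  rewrite (parE _ _ pG) (parE _ _ pG') => eG; rewrite -eG in pG'.
  exact: (asc_child_uniq rM rL bG EB oI cG mT aX aY pG pG').
apply: eq_card => G; apply/imsetP/idP => [[X]|].
  rewrite inE => /andP[_ /exists_inP[G' G'T /andP[dG pG]]] ->.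
  by rewrite (parE _ _ pG) inE G'T.
rewrite inE => /andP[GT dG]; have [X [aX pX]] := st G GT dG.
exists X; last by rewrite (parE _ _ pX).
rewrite !inE aX andbT; have [-> _ _] := and3P aX.
by apply/exists_inP; exists G; rewrite // dG.
Qed.

Lemma forced_sub T : forced T \subset ascents r o T.
Proof. by apply/subsetP=> X; rewrite inE => /andP[]. Qed.

Lemma des_le T : T \in stable_max_nested r o BG -> 2 * des r o T <= (r setT).-1.
Proof.
move=> sT; have mT : max_nested r BG T by move: sT; rewrite inE => /andP[].
rewrite (card_ascents mT) addnS /= mul2n -addnn leq_add2r.
by rewrite -(card_forced mT sT) subset_leq_card // forced_sub.
Qed.

Lemma sum_admissible T : max_nested r BG T ->
  (\sum_(V | admissible r o T V) 'X^#|V| =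
   if T \in stable_max_nested r o BG then
     'X^(des r o T) * (1 + 'X) ^+ ((r setT).-1 - 2 * des r o T) else 0 :> {poly rat})%R.
Proof.
move=> mT; case: ifP => sT.
  rewrite (eq_bigl _ _ (fun V => admissibleE V mT sT)) sum_subsets_between ?forced_sub //.
  rewrite card_forced // (card_ascents mT) addnS /= mul2n -addnn; congr (_ * _ ^+ _)%R.
  by rewrite subnDr.
rewrite big_pred0 // => V; apply: contraFF sT => /andP[/subsetP VA /forall_inP h].
apply/stableP=> // G GT dG; have := h G GT; rewrite dG => /exists_inP[X XV pX].
by exists X; split=> //; have := VA X XV; rewrite inE => /andP[].
Qed.

Definition index_set i : {set {set {set E}} * {set {set E}}} :=
  [set p | [&& max_nested r BG p.1, admissible r o p.1 p.2 & #|p.2| == i]].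

Lemma gamma_of_index_set (Hp : {poly rat}) :
  (forall i, Hp`_i = #|index_set i|%:R)%R ->
  is_gamma_poly Hp (\sum_(S in stable_max_nested r o BG) 'X^(des r o S))%R.
Proof.
move=> hH; exists (r setT).-1; set g := (\sum_(S in _) _)%R; split.
  move=> i di; rewrite coef_sum big1 // => T sT; rewrite coefXn.
  by case: eqP => // ei; move: di; rewrite ei ltnNge des_le.
have -> : Hp = (\sum_(T in stable_max_nested r o BG)
    'X^(des r o T) * (1 + 'X) ^+ ((r setT).-1 - 2 * des r o T))%R.
  transitivity (\sum_(T | max_nested r BG T) \sum_(V | admissible r o T V) 'X^#|V| : {poly rat})%R.
    apply/polyP=> i; rewrite hH pair_big_dep /= coef_sum.
    under eq_bigr => p _ do rewrite coefXn.
    rewrite -natr_sum; congr (_%:R)%R; rewrite -sum1dep_card big_mkcond [RHS]big_mkcond /=.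
    apply: eq_bigr => p _; case: (max_nested _ _ _) => //=.
    by case: (admissible _ _ _ _) => //=; rewrite eq_sym; case: (_ == _).
  rewrite (eq_bigr _ (fun T mT => sum_admissible mT)) -big_mkcondr /=.
  apply: eq_bigl => T; rewrite andb_idl // inE => /andP[] //.
pose F i : {poly rat} := ('X^i * (1 + 'X) ^+ ((r setT).-1 - 2 * i))%R.
(* The range is extended beyond every [des], so that the sums over [i] and over [T] can be
   exchanged. *)
pose N := size g + (r setT).+1.
have -> : (\sum_(i < size g) g`_i *: F i = \sum_(i < N) g`_i *: F i)%R.
  rewrite big_split_ord /= [X in (_ + X)%R]big1 ?addr0 // => i _.
  by rewrite nth_default ?scale0r // leq_addr.
under [RHS]eq_bigr => i _ do rewrite /g coef_sum scaler_suml.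
rewrite [RHS]exchange_big /=; apply: eq_bigr => T sT.
have dN : des r o T < N.
  have := des_le sT; rewrite /N; move: (des _ _ _) (r _) (size _) => a b c; lia.
rewrite (bigD1 (Ordinal dN)) //= coefXn eqxx scale1r big1 ?addr0 // => i ni.
rewrite coefXn; case: eqP => [ei|_]; last by rewrite scale0r.
by case/eqP: ni; apply: val_inj.
Qed.

End Counting.

(** * Relations in the Chow ring *)

Section ChowIdeal.
Local Open Scope ring_scope.
Variables (E : finType) (r : {set E} -> nat) (BG : {set {set E}}).
Local Notation n := #|BG|.
Local Notation poly := {mpoly rat[n]}.
Local Notation vG := (@vG E BG).
Local Notation ideal := (@chow_ideal E r BG).
Implicit Types (p q : poly) (i j g : 'I_n) (A : {set 'I_n}) (m : 'X_{1..n}).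

Lemma vG_in i : vG i \in BG.
Proof. exact: enum_valP. Qed.

Lemma vG_inj : injective vG.
Proof. exact: enum_val_inj. Qed.

Lemma vG_ex G : G \in BG -> exists i, vG i = G.
Proof. by move=> GB; exists (enum_rank_in GB G); rewrite /Defs.vG enum_rankK_in. Qed.

Lemma idealD p q : ideal p -> ideal q -> ideal (p + q).
Proof.
move=> [c [d ->]] [c' [d' ->]].
exists (fun T => c T + c' T), (fun a => d a + d' a).
rewrite addrACA -!big_split /=; congr (_ + _); apply: eq_bigr => x _; exact/esym/mulrDl.
Qed.

Lemma idealM q p : ideal p -> ideal (q * p).
Proof.
move=> [c [d ->]]; exists (fun T => q * c T), (fun a => q * d a).
by rewrite mulrDr !mulr_sumr; congr (_ + _); apply: eq_bigr => x _; rewrite mulrA.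
Qed.

Lemma idealMr q p : ideal p -> ideal (p * q).
Proof. by rewrite mulrC; apply: idealM. Qed.

Lemma ideal0 : ideal 0.
Proof.
exists (fun=> 0), (fun=> 0).
by rewrite !big1 ?addr0 // => x _; rewrite mul0r.
Qed.

Lemma idealZ (c : rat) p : ideal p -> ideal (c *: p).
Proof. by rewrite -mul_mpolyC; apply: idealM. Qed.

Lemma idealN p : ideal p -> ideal (- p).
Proof. by rewrite -scaleN1r; apply: idealZ. Qed.

Lemma idealB p q : ideal p -> ideal q -> ideal (p - q).
Proof. by move=> ip iq; apply: idealD => //; apply: idealN. Qed.

Lemma ideal_sum (I : Type) (s : seq I) (P : pred I) (F : I -> poly) :
  (forall x, P x -> ideal (F x)) -> ideal (\sum_(x <- s | P x) F x).
Proof. by move=> h; apply: big_ind => //; [exact: ideal0|exact: idealD]. Qed.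

Lemma ideal_nonnested A : ~~ nested r BG (vG @: A) -> ideal (\prod_(i in A) 'X_i).
Proof.
move=> nA; exists (fun T => (T == A)%:R), (fun=> 0).
rewrite [X in _ + X]big1 ?addr0 => [|a _]; last by rewrite mul0r.
rewrite (bigD1 A) //= eqxx mul1r [X in _ = _ + X]big1 ?addr0 // => T /andP[_ /negPf->].
by rewrite mul0r.
Qed.

Definition hvar g : poly := \sum_(i | vG g \subset vG i) 'X_i.

Lemma ideal_hvar g : atom r (vG g) -> ideal (hvar g).
Proof.
move=> ag; exists (fun=> 0), (fun a => (a == vG g)%:R).
rewrite big1 ?add0r => [|T _]; last by rewrite mul0r.
rewrite (bigD1 (vG g)) //= eqxx mul1r [X in _ = _ + X]big1 ?addr0 // => T /andP[_ /negPf->].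
by rewrite mul0r.
Qed.

Definition msup m : {set 'I_n} := [set i | (0 < m i)%N].

Lemma prod_varsE A : \prod_(i in A) 'X_i = 'X_[[multinom (i \in A : nat) | i < n]] :> poly.
Proof.
rewrite mpolyXE_id big_mkcond; apply: eq_bigr => i _; rewrite mnmE.
by case: (i \in A); rewrite ?expr1 ?expr0.
Qed.

Lemma ideal_mon m : ~~ nested r BG (vG @: msup m) -> ideal 'X_[m].
Proof.
move=> nm; set M := [multinom (i \in msup m : nat) | i < n].
have -> : m = (m - M + M)%MM.
  by apply/mnmP=> i; rewrite mnmDE mnmBE mnmE inE; case: (m i) => // k; rewrite subn1 addn1.
by rewrite mpolyXD -prod_varsE; apply: idealM; apply: ideal_nonnested.
Qed.

Hypotheses (rM : is_matroid_rank r) (rL : loopless r) (bG : building_set r BG).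

Lemma ideal_mon_cover m g : vG g \subset bigjoin r (vG @: msup m) ->
  (forall i, (0 < m i)%N -> ~~ (vG g \subset vG i)) -> ideal 'X_[m].
Proof.
move=> gs h; apply: ideal_mon; apply/negP=> nm.
have [X /imsetP[i]] := nested_cover rM rL bG nm (vG_in g) gs.
by rewrite inE => mi -> gi; case/negP: (h i mi).
Qed.

Lemma atom_cl1 e : atom r (cl r [set e]).
Proof.
rewrite /atom flat_cl // (cl0 rM rL) (BG_neq0 rM rL bG) ?(BG_atom rM rL bG) //=.
apply/forallP=> F; apply/implyP=> /andP[fF FA].
have := proper_rk rM fF FA; rewrite rk_cl // rL ltnS leqn0 => /eqP rF.
rewrite eq_sym; apply/eqP; apply: (sub_eq_rk rM (flat0 rM rL)); first exact: sub0set.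
by rewrite rF.
Qed.

End ChowIdeal.

(** * Vanishing powers of the h_g *)

Section Spanning.
Local Open Scope ring_scope.
Variables (E : finType) (r : {set E} -> nat) (BG : {set {set E}}) (o : E -> nat).
Hypotheses (rM : is_matroid_rank r) (rL : loopless r) (bG : building_set r BG).
Hypotheses (EB : [set: E] \in BG) (oI : injective o) (cG : complete r o BG).
Local Notation n := #|BG|.
Local Notation poly := {mpoly rat[n]}.
Local Notation vG := (@vG E BG).
Local Notation ideal := (@chow_ideal E r BG).
Local Notation hvar := (@hvar E BG).
Implicit Types (p q : poly) (i j g : 'I_n) (A : {set 'I_n}) (m : 'X_{1..n}).

(** A bad antichain contains [H], and its join lies under that of [S] and [H], so it is [H] by
    maximality. *)
Lemma nested_add_max (S : {set {set E}}) H : nested r BG S ->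
  H \in maxG BG (cl r (bigjoin r S :|: H)) -> nested r BG (H |: S).
Proof.
move=> nS hH; have [HB HF Hmax] := maxG_P hH; have [SB nSP] := nestedP _ _ _ nS.
apply/nestedP; split; first by rewrite subUset sub1set HB.
move=> T TS aT cT; apply/negP => NB.
have inT X : X \in T -> X != H -> X \in S.
  by move=> /(subsetP TS); rewrite !inE => /predU1P[->|//]; rewrite eqxx.
have HT : H \in T.
  apply: contraT => HnT; suff TS' : T \subset S by case/negP: (nSP T TS' aT cT).
  apply/subsetP=> X XT; apply: inT => //.
  by apply: contraNneq HnT => <-.
have HN : H \subset bigjoin r T by apply: sub_bigjoin.
have NH : bigjoin r T = H.
  apply: Hmax => //; apply: (bigjoin_sub rM) => [|X XT]; first exact: (flat_cl rM).
  case: (eqVneq X H) => [->//|XH]; apply: subset_trans (sub_cl _ _).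
  apply: (subset_trans _ (subsetUl _ _)).
  by apply: sub_bigjoin; apply: inT.
have := cT; rewrite (_ : T = [set H]) ?cards1 //; apply/eqP; rewrite eqEsubset sub1set HT andbT.
apply/subsetP=> X XT; rewrite inE.
move/forall_inP/(_ X XT)/forall_inP/(_ H HT)/implyP: aT; apply.
by rewrite -NH sub_bigjoin.
Qed.

Lemma hvar_diff a g : vG a \subset vG g ->
  hvar a - hvar g = \sum_(i | (vG a \subset vG i) && ~~ (vG g \subset vG i)) 'X_i.
Proof.
move=> ag; rewrite /hvar (bigID (fun i => vG g \subset vG i)) /=.
rewrite (eq_bigl (fun i => vG g \subset vG i)) ?addrK //; last first.
  by move=> i; rewrite andb_idl // => gi; apply: subset_trans gi.
by rewrite [X in X - _]addrC addrK.
Qed.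

Local Notation xA A := (\prod_(i in A) 'X_i : poly).

Lemma ideal_prod1 A g b : vG g \subset cl r (bigjoin r (vG @: A) :|: vG b) ->
  (forall i, i \in A -> ~~ (vG g \subset vG i)) -> ~~ (vG g \subset vG b) ->
  ideal (xA A * 'X_b).
Proof.
move=> gs hA hb; rewrite prod_varsE -mpolyXD; apply: (ideal_mon_cover rM rL bG (g := g)).
  apply: (subset_trans gs); rewrite cl_subP ?flat_bigjoin // subUset; apply/andP; split.
    apply: bigjoin_mono => //; apply: imsetS; apply/subsetP=> i iA.
    by rewrite inE mnmDE mnmE iA.
  by apply: sub_bigjoin; apply: imset_f; rewrite inE mnmDE mnm1E eqxx addn1.
move=> i; rewrite mnmDE mnmE mnm1E; case iA : (i \in A); first by move=> _; apply: hA.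
by case: eqP => [<-|] //=.
Qed.

Lemma ideal_prod2 A g b c :
  vG g \subset cl r (bigjoin r (vG @: A) :|: vG b :|: vG c) ->
  (forall i, i \in A -> ~~ (vG g \subset vG i)) -> ~~ (vG g \subset vG b) ->
  ~~ (vG g \subset vG c) -> ideal (xA A * ('X_b * 'X_c)).
Proof.
move=> gs hA hb hc; rewrite prod_varsE -!mpolyXD; apply: (ideal_mon_cover rM rL bG (g := g)).
  apply: (subset_trans gs); rewrite cl_subP ?flat_bigjoin // !subUset -andbA; apply/and3P; split.
  - apply: bigjoin_mono => //; apply: imsetS; apply/subsetP=> i iA.
    by rewrite inE mnmDE mnmE iA.
  - by apply: sub_bigjoin; apply: imset_f; rewrite inE !mnmDE !mnm1E eqxx addnCA.
  - by apply: sub_bigjoin; apply: imset_f; rewrite inE !mnmDE !mnm1E eqxx !addn1 !addnS.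
move=> i; rewrite !mnmDE mnmE !mnm1E; case iA : (i \in A); first by move=> _; apply: hA.
by case: eqP => [<-|] //=; case: eqP => [<-|].
Qed.

(* Multiplied by [x_A], the power of [h_g] vanishes one step later than that of
   the predecessor [h_g'] in the chain, as [x_A h_g^2 = x_A h_g h_g']. *)
Lemma ideal_chain A G k : nested r BG (vG @: A) -> G \in BG ->
  let J := bigjoin r (vG @: A) in J \subset G ->
  let C := chain r o J G k in
  C = J \/ exists g, [/\ (r J < r C)%N, vG g \in maxG BG C, C = cl r (J :|: vG g)
    & ideal (xA A * hvar g ^+ (r C - r J))].
Proof.
move=> nA GB J JG; have fJ : flat r J by apply: flat_bigjoin.
elim: k => [|k IH]; first by left; rewrite chain0.
case: (chainS rM oI J G k) => [->//|[a [aG oa eC]]].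
set C := chain r o J G k in IH eC; set C' := chain r o J G k.+1 in eC *.
have fC : flat r C by apply: flat_chain.
have fC' : flat r C' by apply: flat_chain.
case aC : (a \in C).
  by have -> : C' = C by rewrite eC (setUidPr _) ?sub1set // cl_flat.
have rC' : r C' = (r C).+1 by rewrite eC rk_cl // flat_rkU1 // aC.
have JC : J \subset C by apply: sub_chain.
have rJC := rk_mono rM JC.
have [e|[N0 N0B eN0]] := chain_BG rM cG k.+1 fJ GB JG.
  by move: rC' rJC; rewrite /C' e; lia.
rewrite -/C' in eN0; right.
have N0C' : N0 \subset C' by rewrite eN0; apply: subset_trans (sub_cl _ _); apply: subsetUr.
have [N hN N0N] := maxG_sup N0B N0C'; have [NB NC' _] := maxG_P hN.
have eN : C' = cl r (J :|: N).
  apply/eqP; rewrite eqEsubset {1}eN0 cl_mono ?setUS //=.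
  by rewrite cl_subP // subUset NC' andbT; apply: sub_chain.
have nNA : nested r BG (N |: vG @: A) by apply: nested_add_max; rewrite // -/J -eN.
have NJ : ~~ (N \subset J).
  apply/negP=> NJ; move: rC'; rewrite eN (setUidPl NJ) cl_flat // => h.
  by move: rJC; rewrite h ltnn.
have [g eg] := vG_ex NB.
have subN X : X \in BG -> X \subset C' -> ~~ (X \subset J) -> X \subset N.
  move=> XB XC' XJ; have XJ' : X \subset bigjoin r (N |: vG @: A).
    by rewrite (bigjoinU1 rM) setUC -/J -eN.
  have [Y] := nested_cover rM rL bG nNA XB XJ'.
  rewrite !inE => /predU1P[->//|YA] XY; case/negP: XJ.
  exact: subset_trans XY (sub_bigjoin r YA).
have [b eb] := vG_ex (BG_atom rM rL bG a).
have bC' : vG b \subset C' by rewrite eb eC cl_mono // subsetUl.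
have ab : a \in vG b by rewrite eb (subsetP (sub_cl _ _)) ?set11.
have bN : vG b \subset vG g.
  rewrite eg; apply: subN => //; first exact: vG_in.
  apply: contraFN aC => /subsetP/(_ a); rewrite ab => /(_ isT).
  exact: (subsetP JC).
have NA i : i \in A -> ~~ (vG g \subset vG i).
  move=> iA; rewrite eg; apply: contra NJ => Ni; apply: (subset_trans Ni).
  by apply: sub_bigjoin; apply: imset_f.
have idb : ideal (hvar b) by apply: (ideal_hvar (r := r)); rewrite eb; apply: (atom_cl1 rM rL bG).
exists g; rewrite eg; split=> //; first by rewrite rC' ltnS.
case: IH => [eCJ|[g' [rJ hg' eCg' idg']]].
  (* Base case: [h_b] is the relation of the atom spanned by [a], and the terms [x_A x_c] with [c]
     above [b] but not above [g] have non-nested support, so [x_A h_g] agrees with [x_A h_b]. *)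
  have -> : (r C' - r J = 1)%N by rewrite rC' eCJ subSn // subnn.
  rewrite expr1; have -> : hvar g = hvar b - (hvar b - hvar g) by rewrite opprB addrC subrK.
  rewrite mulrBr; apply: idealB; first exact: idealM.
  rewrite hvar_diff // mulr_sumr; apply: ideal_sum => c /andP[bc gc].
  apply: ideal_prod1 gc => //; rewrite eg; apply: (subset_trans NC').
  rewrite eC cl_subP ?flat_cl // eCJ; apply: subset_trans (sub_cl _ _).
  rewrite setUC setUS // sub1set; exact: (subsetP bc).
have [g'B g'C _] := maxG_P hg'.
have g'N : vG g' \subset vG g.
  rewrite eg; apply: subN => //.
    by apply: (subset_trans g'C); apply: chain_mono.
  apply/negP=> h; move: rJ; rewrite eCg' (setUidPl h) cl_flat // ltnn //.
(* In each term [x_A x_c x_d] the flat [c] contains [a] and [d] contains [g'], so over [J] they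
   generate [C'], while no factor is above [g]. Together with [h_b = 0] this yields
   [x_A h_g h_g' = x_A h_g^2]. *)
have id2 : ideal (xA A * ((hvar b - hvar g) * (hvar g' - hvar g))).
  rewrite !hvar_diff // mulr_suml mulr_sumr; apply: ideal_sum => c /andP[bc gc].
  rewrite mulr_sumr mulr_sumr; apply: ideal_sum => d /andP[g'd gd].
  apply: ideal_prod2 gc gd => //; rewrite eg; apply: (subset_trans NC').
  rewrite eC cl_subP ?flat_cl // subUset sub1set; apply/andP; split.
    rewrite (subsetP (sub_cl _ _)) //; rewrite !in_setU (subsetP bc) ?orbT //.
  rewrite eCg' cl_subP ?flat_cl // subUset; apply/andP; split; apply: subset_trans (sub_cl _ _).
    by rewrite -setUA subsetUl.
  by apply: (subset_trans g'd); apply: subsetUr.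
have id3 : ideal (xA A * (hvar g * (hvar g' - hvar g))).
  have -> : xA A * (hvar g * (hvar g' - hvar g)) =
     hvar b * (xA A * (hvar g' - hvar g)) - xA A * ((hvar b - hvar g) * (hvar g' - hvar g)).
    by move: (xA A) (hvar b) (hvar g) (hvar g') => u v w z; ring.
  by apply: idealB => //; apply: idealMr.
have -> : (r C' - r J = (r C - r J).+1)%N by rewrite rC' subSn.
set d := (r C - r J)%N.
have -> : xA A * hvar g ^+ d.+1 = hvar g * (xA A * hvar g' ^+ d) -
    xA A * (hvar g * (hvar g' - hvar g)) * (\sum_(l < d) hvar g' ^+ (d.-1 - l) * hvar g ^+ l).
  rewrite -!mulrA -subrXX exprS.
  by move: (xA A) (hvar g) (_ ^+ d) (_ ^+ d) => u v w z; ring.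
by apply: idealB; [apply: idealM|apply: idealMr].
Qed.

(** The chain ends at [vG g], whose only factor is [vG g] itself. *)
Lemma ideal_power A g : nested r BG (vG @: A) ->
  let J := bigjoin r (vG @: A) in J \proper vG g ->
  ideal (xA A * hvar g ^+ (r (vG g) - r J)).
Proof.
move=> nA J Jg; have gB := vG_in g.
have [k /eqP ek] := chain_top o rM (BG_flat bG gB) (proper_sub Jg).
case: (ideal_chain k nA gB (proper_sub Jg)) => [e|[g' [_ hg' _]]]; rewrite -/J.
  by move: Jg; rewrite -ek e properxx.
rewrite ek in hg' *; have [_ g'G gmax] := maxG_P hg'.
suff <- : g = g' by [].
by apply: vG_inj; apply: gmax.
Qed.

End Spanning.

(** * Reduction of monomials by increasing weight *)

Section Reduction.
Local Open Scope ring_scope.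
Variables (E : finType) (r : {set E} -> nat) (BG : {set {set E}}) (o : E -> nat).
Hypotheses (rM : is_matroid_rank r) (rL : loopless r) (bG : building_set r BG).
Hypotheses (EB : [set: E] \in BG) (oI : injective o) (cG : complete r o BG).
Local Notation n := #|BG|.
Local Notation poly := {mpoly rat[n]}.
Local Notation vG := (@vG E BG).
Local Notation ideal := (@chow_ideal E r BG).
Local Notation hvar := (@hvar E BG).
Implicit Types (p q : poly) (i j g : 'I_n) (A : {set 'I_n}) (m : 'X_{1..n}).

Definition wt m := (\sum_i m i * #|vG i|)%N.

Lemma wtD m m' : wt (m + m')%MM = (wt m + wt m')%N.
Proof. by rewrite /wt -big_split; apply: eq_bigr => i _; rewrite mnmDE mulnDl. Qed.

Lemma wt1 i : wt U_(i)%MM = #|vG i|.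
Proof.
rewrite /wt (bigD1 i) //= mnm1E eqxx mul1n big1 ?addn0 // => j /negPf ji.
by rewrite mnm1E eq_sym ji.
Qed.

Lemma wtMn m k : wt (m *+ k)%MM = (k * wt m)%N.
Proof.
by rewrite /wt big_distrr /=; apply: eq_bigr => i _; rewrite mulmnE mulnAC mulnC.
Qed.

Lemma wt_le m : (wt m <= mdeg m * #|E|)%N.
Proof.
rewrite mdegE big_distrl /=; apply: leq_sum => i _.
by rewrite leq_mul2l max_card orbT.
Qed.

Definition graded_ge d w p := forall m, m \in msupp p -> mdeg m = d /\ (w <= wt m)%N.

Lemma graded_ge0 d w : graded_ge d w 0.
Proof. by move=> m; rewrite msupp0. Qed.

Lemma graded_geD d w p q : graded_ge d w p -> graded_ge d w q -> graded_ge d w (p + q).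
Proof. by move=> hp hq m /msuppD_le; rewrite mem_cat => /orP[/hp|/hq]. Qed.

Lemma graded_geN d w p : graded_ge d w p -> graded_ge d w (- p).
Proof. by move=> hp m; rewrite (perm_mem (msuppN _)) => /hp. Qed.

Lemma graded_ge_sum d w (I : Type) (s : seq I) (P : pred I) (F : I -> poly) :
  (forall x, P x -> graded_ge d w (F x)) -> graded_ge d w (\sum_(x <- s | P x) F x).
Proof. by move=> h; apply: big_ind => //; [exact: graded_ge0|exact: graded_geD]. Qed.

Lemma graded_geM d w d' w' p q : graded_ge d w p -> graded_ge d' w' q ->
  graded_ge (d + d') (w + w') (p * q).
Proof.
move=> hp hq m /msuppM_le /allpairsP[[m1 m2] /= [/hp[e1 l1] /hq[e2 l2] ->]].
by rewrite mdegD wtD e1 e2; split=> //; apply: leq_add.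
Qed.

Lemma graded_ge_mon m : graded_ge (mdeg m) (wt m) 'X_[m].
Proof. by move=> m'; rewrite msuppX inE => /eqP->. Qed.

Lemma graded_geX d w p k : graded_ge d w p -> graded_ge (k * d) (k * w) (p ^+ k).
Proof.
move=> hp; elim: k => [|k IH]; last by rewrite exprS !mulSn; apply: graded_geM.
by rewrite expr0 -mpolyX0 => m; rewrite msuppX inE => /eqP->; rewrite mdeg0.
Qed.

Lemma graded_ge_var i : graded_ge 1 #|vG i| 'X_i.
Proof. by have := @graded_ge_mon U_(i)%MM; rewrite mdeg1 wt1. Qed.

Lemma graded_ge_hvar g : graded_ge 1 #|vG g| (hvar g).
Proof.
apply: graded_ge_sum => i gi m /graded_ge_var[-> h]; split=> //.
exact: leq_trans (subset_leq_card gi) h.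
Qed.

(** The difference of the powers is divisible by [h_g - X_g], a sum of variables of strictly larger
    flats. *)
Lemma graded_ge_power g d : graded_ge d.+1 (d.+1 * #|vG g|).+1 ('X_g ^+ d.+1 - hvar g ^+ d.+1).
Proof.
rewrite subrXX -[X in graded_ge X]add1n mulSn -addSn; apply: graded_geM.
  rewrite -opprB; apply: graded_geN; rewrite /hvar (bigD1 g) //= [X in X - _]addrC addrK.
  apply: graded_ge_sum => i /andP[gi ig] m /graded_ge_var[-> h]; split=> //.
  apply: leq_trans h; apply: proper_card; rewrite properEneq gi andbT.
  by apply: contraNneq ig => /vG_inj->.
apply: graded_ge_sum => l _ m hm.
have := graded_geM (graded_geX (k := (d.+1.-1 - l)%N) (@graded_ge_var g)) (graded_geX (k := l) (@graded_ge_hvar g)) hm.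
by rewrite !muln1 -mulnDl subnK // -ltnS.
Qed.

Local Notation index_set := (index_set r BG o).

Definition mindex (x : {set {set E}} * {set {set E}}) : 'X_{1..n} :=
  [multinom mexp r (x.1 :\: x.2) (vG i) | i < n].

Lemma sum_vG (F : {set E} -> nat) : (\sum_(G in BG) F G = \sum_i F (vG i))%N.
Proof. exact: big_enum_val. Qed.

Lemma mdeg_mindex x d : x \in index_set d -> mdeg (mindex x) = d.
Proof.
rewrite inE => /and3P[mT aV /eqP <-]; have VA : x.2 \subset ascents r o x.1 by case/andP: aV.
rewrite mdegE -(sum_mexp rM rL bG EB oI cG mT VA).
under eq_bigr do rewrite mnmE.
rewrite -(sum_vG (mexp r (x.1 :\: x.2))) [RHS]big_mkcond [LHS]big_mkcond /=.
apply: eq_bigr => P _; rewrite /mexp; case: ifP; case: ifP => // PW /negP[].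
move: PW; rewrite inE => /andP[_ PT]; exact: (nested_BG (max_nested_nested mT) PT).
Qed.

(** If an exponent reaches the rank gap [d] of its flat over the smaller flats [A] of the support,
    [x_A X_g^d] is replaced by [x_A (X_g^d - h_g^d)], of larger weight. Otherwise [mexp_onto]
    recognizes the exponent. *)
Lemma monomial_cases m : ideal 'X_[m] \/
  (exists2 x, x \in index_set (mdeg m) & mindex x = m) \/
  (exists2 p, graded_ge (mdeg m) (wt m).+1 p & ideal ('X_[m] - p)).
Proof.
pose S := vG @: msup m; case nS : (nested r BG S); last first.
  by left; apply: ideal_mon; rewrite nS.
case: (pickP [pred g | (0 < m g)%N && (r (vG g) - r (JG r S (vG g)) <= m g)%N]) => [g|none].
  move=> /= /andP[mg dg]; right; right.
  pose A := [set i in msup m | vG i \proper vG g].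
  have eA : vG @: A = [set H in S | H \proper vG g].
    apply/setP=> H; rewrite inE; apply/imsetP/andP => [[i]|[/imsetP[i im ->] ig]].
      by rewrite inE => /andP[im ig] ->; split=> //; apply: imset_f.
    by exists i; rewrite // inE im.
  have eJ : JG r S (vG g) = bigjoin r (vG @: A) by rewrite eA.
  have nA : nested r BG (vG @: A).
    by apply: nested_sub nS; rewrite eA; apply/subsetP=> X; rewrite inE => /andP[].
  have Jg : bigjoin r (vG @: A) \proper vG g by rewrite -eJ (JG_proper rM rL bG nS) ?vG_in.
  have idg := ideal_power rM rL bG EB oI cG nA Jg.
  have d0 := JG_rk rM rL bG nS (vG_in g); rewrite eJ in dg d0.
  case ed : (r (vG g) - r (bigjoin r (vG @: A)))%N dg idg => [|d] dg idg.
    by move/eqP: ed; rewrite subn_eq0 leqNgt d0.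
  pose M := [multinom (i \in A : nat) | i < n].
  pose m' : 'X_{1..n} := (m - M - U_(g) *+ d.+1)%MM.
  have em : m = (m' + (M + U_(g) *+ d.+1))%MM.
    apply/mnmP=> i; rewrite !mnmDE !mnmBE mulmnE mnmE mnm1E inE.
    case: eqVneq => [<-|_]; last first.
      by rewrite mul0n subn0 addn0 subnK //; case: andP => // -[]; rewrite inE.
    by rewrite properxx andbF subn0 add0n mul1n subnK.
  exists ('X_[m'] * (\prod_(i in A) 'X_i * ('X_g ^+ d.+1 - hvar g ^+ d.+1))).
    rewrite {1 2}em !mdegD !wtD -!addnS; apply: graded_geM; first exact: graded_ge_mon.
    rewrite prod_varsE -/M; apply: graded_geM; first exact: graded_ge_mon.
    by rewrite mdegMn mdeg1 mul1n wtMn wt1; apply: graded_ge_power.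
  have -> : 'X_[m] - 'X_[m'] * (\prod_(i in A) 'X_i * ('X_g ^+ d.+1 - hvar g ^+ d.+1)) =
      'X_[m'] * (\prod_(i in A) 'X_i * hvar g ^+ d.+1).
    rewrite {1}em !mpolyXD -mpolyXn -prod_varsE.
    by move: 'X_[m'] (\prod_(i in A) _) (_ ^+ _) (_ ^+ _) => u v w z; ring.
  exact: idealM.
right; left.
(* The exponent as a function on all sets, zero outside [BG], as [mexp_onto] requires. *)
pose mm (P : {set E}) := (\sum_(i | vG i == P) m i)%N.
have mmE i : mm (vG i) = m i.
  rewrite /mm (big_pred1 i) // => j; apply/eqP/eqP => [/vG_inj //|-> //].
have mm0 P : P \notin BG -> mm P = 0%N.
  by move=> PB; rewrite /mm big_pred0 // => i; apply: contraNF PB => /eqP<-; apply: vG_in.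
have eS : [set P | (0 < mm P)%N] = S.
  apply/setP=> P; rewrite inE; apply/idP/imsetP => [h|[i]]; last by rewrite inE => h ->; rewrite mmE.
  case PB : (P \in BG); last by move: h; rewrite mm0 ?PB.
  by have [i ei] := vG_ex PB; exists i; rewrite // inE -mmE ei.
have [||T [V [mT aV eV]]] := mexp_onto rM rL bG EB oI cG (m := mm); rewrite ?eS //.
  move=> P /imsetP[i]; rewrite inE => mi ->; rewrite mmE ltnNge.
  by have := none i; rewrite /= mi /= => ->.
have e : mindex (T, V) = m by apply/mnmP=> i; rewrite mnmE eV mmE.
have xI : (T, V) \in index_set #|V| by rewrite inE mT aV eqxx.
by exists (T, V) => //; rewrite -e (mdeg_mindex xI).
Qed.

Definition spanned d p := exists c, ideal (p - \sum_(x in index_set d) c x *: 'X_[mindex x]).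

Lemma spannedD d p q : spanned d p -> spanned d q -> spanned d (p + q).
Proof.
move=> [c hc] [c' hc']; exists (fun x => c x + c' x).
under eq_bigr do rewrite scalerDl.
by rewrite big_split opprD addrACA; apply: idealD.
Qed.

Lemma spannedZ d (a : rat) p : spanned d p -> spanned d (a *: p).
Proof.
move=> [c hc]; exists (fun x => a * c x).
under eq_bigr do rewrite -scalerA.
by rewrite -scaler_sumr -scalerBr; apply: idealZ.
Qed.

Lemma spanned_ideal d p : ideal p -> spanned d p.
Proof.
by move=> ip; exists (fun=> 0); rewrite big1 ?subr0 // => x _; rewrite scale0r.
Qed.

Lemma spanned_mindex d x : x \in index_set d -> spanned d 'X_[mindex x].
Proof.
move=> xI; exists (fun y => (y == x)%:R); rewrite (bigD1 x) //= eqxx scale1r big1 => [|y].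
  by rewrite addr0 subrr; apply: ideal0.
by move=> /andP[_ /negPf->]; rewrite scale0r.
Qed.

(** Each replacement raises the weight, and degree [d] allows no weight above [d * #|E|]. *)
Lemma graded_spanned d w p : graded_ge d w p -> spanned d p.
Proof.
move: {2}(d * #|E| + 1 - w)%N (leqnn (d * #|E| + 1 - w)) => k.
elim: k w p => [|k IH] w p kw hp.
  suff -> : p = 0 by apply/spanned_ideal/ideal0.
  apply/eqP; rewrite -msupp_eq0; case e : (msupp p) => [//|m s].
  have [em wm] : mdeg m = d /\ (w <= wt m)%N by apply: hp; rewrite e inE eqxx.
  by move: (wt_le m); rewrite em; lia.
rewrite (mpolyE p) big_seq; apply: big_ind => [||m /hp[em wm]].
- exact/spanned_ideal/ideal0.
- exact: spannedD.
apply: spannedZ; case: (monomial_cases m) => [|[[x xI <-]|[q hq iq]]].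
- exact: spanned_ideal.
- by apply: spanned_mindex; rewrite -em.
- rewrite -(subrK q 'X_[m]); apply: spannedD; first exact: spanned_ideal.
  rewrite em in hq; apply: (IH (wt m).+1) => //.
  by move: kw wm; lia.
Qed.

Lemma homog_spanned d p : homog_deg d p -> spanned d p.
Proof.
move=> /allP hp; apply: (graded_spanned (w := 0)) => m /hp /eqP ->.
by [].
Qed.

End Reduction.

(** * Degree functionals *)

Section Violating.
Variables (X : finType) (rho : {set X} -> nat) (mu : X -> nat).
Hypothesis rho_submod : forall A B, rho (A :|: B) + rho (A :&: B) <= rho A + rho B.
Implicit Types (A B C V Y Z : {set X}).

Definition mass V := \sum_(x in V) mu x.

Lemma massUI A B : mass (A :|: B) + mass (A :&: B) = mass A + mass B.
Proof.
rewrite /mass big_mkcond [X in _ + X]big_mkcond [in RHS]big_mkcond [X in _ = _ + X]big_mkcond.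
rewrite -!big_split; apply: eq_bigr => x _; rewrite !inE.
by case: (x \in A); case: (x \in B); rewrite /= ?addn0 ?add0n.
Qed.

Definition violating V := (0 < mass V) && (rho V <= mass V).

(** If the intersection violates, minimality puts [C] inside [V]. Otherwise its mass is at most its
    rank, and submodularity passes the violation on to the union. *)
Lemma violatingU V C : violating V -> minset violating C -> violating (V :|: C).
Proof.
move=> /andP[V0 rV] mC; have /andP[C0 rC] := minsetp mC.
have := massUI V C; have := rho_submod V C; rewrite /violating.
case vI : (violating (V :&: C)).
  have eI := minsetinf mC vI (subsetIr _ _).
  by rewrite (setUidPl _) ?V0 ?rV //; apply/setIidPr.
by move: vI; rewrite /violating; lia.
Qed.

(* The union of all minimal violating sets is violating, so it misses a point of [Y]. *)
Lemma avoid_minset Y : Y != set0 -> (forall V, Y \subset V -> ~~ violating V) ->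
  exists2 y, y \in Y & forall C, minset violating C -> y \notin C.
Proof.
move=> Y0 hY; case: (pickP (fun C => minset violating C)) => [C0 mC0|none]; last first.
  by have /set0Pn[y yY] := Y0; exists y => // C; rewrite none.
pose U := C0 :|: \bigcup_(C | minset violating C) C.
have vU : violating U.
  rewrite /U; elim/big_rec: _ => [|C V mC vV]; first by rewrite setU0 (minsetp mC0).
  by rewrite setUCA setUC violatingU.
have /subsetPn[y yY yU] : ~~ (Y \subset U) by apply: contraL vU; apply: hY.
exists y => // C mC; apply: contra yU => yC.
by rewrite inE; apply/orP; right; apply/bigcupP; exists C.
Qed.

Definition stable V := [forall C : {set X}, (C \subset V) ==> ~~ violating C].

(** Any violation is witnessed by a minimal violating set, which avoids [y]. *)
Lemma stable_toggle y Z : (forall C, minset violating C -> y \notin C) ->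
  stable (y |: Z) = stable Z.
Proof.
move=> hy; apply/forallP/forallP => h C; apply/implyP=> CZ; apply/negP=> vC.
  by have := h C; rewrite vC (subset_trans CZ (subsetUr _ _)).
have [D mD DC] := minset_exists vC; have := h D; rewrite (minsetp mD) implybF => /negP; apply.
apply/subsetP=> x xD; have := subsetP (subset_trans DC CZ) x xD.
by rewrite !inE => /predU1P[ex|//]; have := hy D mD; rewrite -ex xD.
Qed.

End Violating.

(** * Exchange property of the dragon Hall-Rado condition *)

Section Functional.
Variables (E : finType) (r : {set E} -> nat) (BG : {set {set E}}) (W : {set {set E}}).
Hypotheses (rM : is_matroid_rank r) (rL : loopless r) (bG : building_set r BG).
Hypotheses (nW : nested r BG W) (TW : setT \in W).
Local Notation n := #|BG|.
Local Notation vG := (@vG E BG).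
Implicit Types (i j g : 'I_n) (D J Z : {set 'I_n}) (m : 'X_{1..n}) (P Q : {set E}).

(** The top of the minor [[J^P, P]] that accounts for the variable [i]. *)
Definition asg i := cov W (vG i).
Definition gspan D := \bigcup_(i in D) vG i.
Definition msum m D := \sum_(i in D) m i.

(* The dragon Hall-Rado condition on the minor [P / J^P]. *)
Definition rado P m := [forall D : {set 'I_n},
  ((D \subset [set i | asg i == P]) && (0 < msum m D)) ==>
  (r (JG r W P) + msum m D < r (JG r W P :|: gspan D))].
Definition good m := [forall P in W, rado P m].

Lemma asg_in i : asg i \in W.
Proof. by apply: (cov_in rM rL bG) => //; apply: (BG_neq0 rM rL bG); apply: vG_in. Qed.

Lemma asg_sub i : vG i \subset asg i.
Proof. exact: sub_cov. Qed.

Lemma asg_JG i : ~~ (vG i \subset JG r W (asg i)).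
Proof.
apply/negP=> /(sub_JG_ex rM rL bG nW (vG_in i)) [Y [YW + iY]].
by rewrite properE (cov_min YW iY) andbF.
Qed.

Lemma asgE i P : P \in W -> vG i \subset P -> ~~ (vG i \subset JG r W P) -> asg i = P.
Proof.
move=> PW iP iJ; apply/eqP; apply: contraNT iJ => ne.
apply: subset_trans (asg_sub i) _; apply: sub_JG; first exact: asg_in.
by rewrite properEneq ne cov_min.
Qed.

Lemma spanU D D' : gspan (D :|: D') = gspan D :|: gspan D'.
Proof. exact: bigcup_setU. Qed.

Section Toggle.
Variables (T : {set 'I_n}) (g : 'I_n) (m0 : 'X_{1..n}).
Hypothesis eg : vG g = bigjoin r (vG @: T).
Local Notation P := (asg g).
Local Notation K := (JG r W (asg g)).
Local Notation high := [set i in T | ~~ (vG i \subset K)].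
Local Notation block := [set i | asg i == P].

Lemma T_sub i : i \in T -> vG i \subset vG g.
Proof. by move=> iT; rewrite eg; apply: sub_bigjoin; apply: imset_f. Qed.

Lemma high_block i : i \in T -> (i \in high) = (i \in block).
Proof.
move=> iT; rewrite !inE iT /=; apply/idP/eqP => [h|<-]; last exact: asg_JG.
apply: asgE => //; first exact: asg_in.
exact: subset_trans (T_sub iT) (asg_sub g).
Qed.

Lemma span_high_sub : gspan high \subset vG g.
Proof. by apply/bigcupsP=> i; rewrite inE => /andP[iT _]; apply: T_sub. Qed.

Lemma sub_span_high : vG g \subset cl r (K :|: gspan high).
Proof.
rewrite eg; apply: (bigjoin_sub rM) => [|Y /imsetP[i iT ->]]; first exact: (flat_cl rM).
apply: subset_trans (sub_cl _ _); case iK : (vG i \subset K).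
  exact: subset_trans iK (subsetUl _ _).
apply: (subset_trans _ (subsetUr _ _)); apply: bigcup_sup.
by rewrite inE iT iK.
Qed.

Lemma high_neq0 : high != set0.
Proof.
apply/negP=> /eqP h0; have := sub_span_high; rewrite h0 /gspan big_set0 setU0.
by rewrite cl_flat ?flat_JG // (negPf (asg_JG g)).
Qed.

(* The left copies carry the multiplicities of [m0], the right copies stand for
   the factors [X_i] chosen in the expansion of the product of the [X_i - X_g]. *)
Local Notation X := ('I_n + 'I_n)%type.
Definition tagof (x : X) := match x with inl i => i | inr i => i end.
Definition rhoX (V : {set X}) := r (K :|: \bigcup_(x in V) vG (tagof x)) - r K.
Definition muX (x : X) :=
  match x with inl i => if i \in block then m0 i else 0 | inr i => (i \in high) : nat end.

Lemma rhoXE (V : {set X}) : r K + rhoX V = r (K :|: \bigcup_(x in V) vG (tagof x)).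
Proof. by rewrite /rhoX subnKC // rk_mono // subsetUl. Qed.

Lemma rhoX_submod A B : rhoX (A :|: B) + rhoX (A :&: B) <= rhoX A + rhoX B.
Proof.
suff : (r K + rhoX (A :|: B)) + (r K + rhoX (A :&: B)) <= (r K + rhoX A) + (r K + rhoX B) by lia.
rewrite !rhoXE bigcup_setU setUUr; apply: leq_trans (rk_submod rM _ _).
rewrite leq_add2l rk_mono // -setUIr setUS //; apply/bigcupsP=> x /setIP[xA xB].
by rewrite subsetI; apply/andP; split; apply: (bigcup_sup x).
Qed.

Definition lefts (V : {set X}) := [set i | inl i \in V].
Definition rights (V : {set X}) := [set i | inr i \in V].
Definition sumset D Z : {set X} := [set x | match x with inl i => i \in D | inr i => i \in Z end].

Lemma span_lr (V : {set X}) : \bigcup_(x in V) vG (tagof x) = gspan (lefts V) :|: gspan (rights V).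
Proof.
apply/setP=> e; rewrite inE; apply/bigcupP/orP => [[[i|i] xV ei]|].
- by left; apply/bigcupP; exists i; rewrite ?inE.
- by right; apply/bigcupP; exists i; rewrite ?inE.
by case=> /bigcupP[i]; rewrite inE => iV ei; [exists (inl i)|exists (inr i)].
Qed.

Lemma mass_lr (V : {set X}) : mass muX V = msum m0 (lefts V :&: block) + #|rights V :&: high|.
Proof.
rewrite /mass /msum -[#|_ :&: _|]sum1_card big_mkcond [X in _ = X + _]big_mkcond [X in _ = _ + X]big_mkcond.
rewrite big_sumType /=; congr (_ + _); apply: eq_bigr => i _; rewrite !in_setI !in_set.
  by case: (inl i \in V); case: (asg i == P).
by case: (inr i \in V) => //=; case: (i \in T) => //=; case: (vG i \subset K).
Qed.

Lemma lefts_sumset D Z : lefts (sumset D Z) = D.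
Proof. by apply/setP=> i; rewrite !inE. Qed.

Lemma rights_sumset D Z : rights (sumset D Z) = Z.
Proof. by apply/setP=> i; rewrite !inE. Qed.

Definition mset J : 'X_{1..n} := [multinom (i \in J : nat) | i < n].

Lemma msumD m m' D : msum (m + m')%MM D = msum m D + msum m' D.
Proof. by rewrite /msum -big_split; apply: eq_bigr => i _; rewrite mnmDE. Qed.

Lemma msum_mset J D : msum (mset J) D = #|J :&: D|.
Proof.
rewrite /msum -[#|_ :&: _|]sum1_card big_mkcond [RHS]big_mkcond; apply: eq_bigr => i _.
by rewrite mnmE inE; case: (i \in J); case: (i \in D).
Qed.

Lemma msumU i k D : msum (U_(i) *+ k)%MM D = if i \in D then k else 0.
Proof.
rewrite /msum; case: ifP => iD.
  rewrite (bigD1 i) //= mulmnE mnm1E eqxx mul1n big1 ?addn0 // => j /andP[_ /negPf ji].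
  by rewrite mulmnE mnm1E eq_sym ji.
by rewrite big1 // => j jD; rewrite mulmnE mnm1E; case: eqP jD iD => // <- ->.
Qed.

(** The Hall-Rado condition for the sets containing [g], with [k] additional factors below [g]: once
    [g] is present they add mass but no rank. *)
Definition room k := [forall D : {set 'I_n},
  (D \subset block) ==> (r K + (msum m0 D + k) < r (K :|: gspan D :|: vG g))].

Lemma room_le k k' : k <= k' -> room k' -> room k.
Proof.
move=> kk' /forallP h; apply/forallP=> D; apply/implyP=> Db.
have /implyP/(_ Db) := h D; apply: leq_ltn_trans.
by rewrite !leq_add2l.
Qed.

(** When [e > 0], a set containing [g] may as well absorb all of [J :&: high], which lies below [g];
    this is the [room] condition. All other sets only see [m0] and the factors of [J], which is
    stability. *)
Lemma rado_high J e : J \subset T ->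
  rado P (m0 + mset J + U_(g) *+ e)%MM =
  stable rhoX muX (sumset setT (J :&: high)) && ((0 < e) ==> room (#|J :&: high| + e)).
Proof.
move=> JT.
have mE D : msum (m0 + mset J + U_(g) *+ e)%MM D =
    msum m0 D + #|J :&: D| + (if g \in D then e else 0).
  by rewrite !msumD msum_mset msumU.
have JDhigh D : D \subset block -> J :&: D \subset J :&: high.
  move=> Db; apply/subsetP=> i /setIP[iJ iD]; rewrite inE iJ high_block ?(subsetP JT) //.
  exact: (subsetP Db).
have gb : g \in block by rewrite inE eqxx.
have hb : high \subset block.
  by apply/subsetP=> i ih; rewrite -high_block //; move: ih; rewrite inE => /andP[].
apply/forallP/andP => [h|[/forallP hs hr] D].
  split.
    apply/forallP=> V; apply/implyP=> VJ; apply/negP=> /andP[V0 rV].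
    pose D := (lefts V :&: block) :|: (rights V :&: high).
    have Db : D \subset block by rewrite subUset subsetIr (subset_trans (subsetIr _ _) hb).
    have massD : mass muX V <= msum (m0 + mset J + U_(g) *+ e)%MM D.
      rewrite mass_lr mE; apply: leq_trans (leq_addr _ _); apply: leq_add.
        rewrite /msum big_mkcond [leqRHS]big_mkcond; apply: leq_sum => i _.
        rewrite [i \in D]in_setU; by case: (i \in _ :&: block).
      apply: subset_leq_card; apply/subsetP=> i /[dup] ih /setIP[iV _].
      rewrite in_setI [i \in D]in_setU ih orbT andbT.
      have := subsetP VJ (inr i); rewrite [_ \in sumset _ _]in_set.
      by move: iV; rewrite [_ \in rights _]in_set => -> /(_ isT) /setIP[].
    have /implyP := h D; rewrite Db (leq_trans V0 massD) => /(_ isT).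
    rewrite ltnNge => /negP; apply; apply: leq_trans (_ : r K + mass muX V <= _); last first.
      by rewrite leq_add2l.
    apply: leq_trans (_ : r K + rhoX V <= _); last by rewrite leq_add2l.
    rewrite rhoXE rk_mono // span_lr setUS // spanU setUSS //.
      by apply/bigcupsP=> i /setIP[iV _]; apply: bigcup_sup.
    by apply/bigcupsP=> i /setIP[iV _]; apply: bigcup_sup.
  apply/implyP=> e0; apply/forallP=> D; apply/implyP=> Db.
  pose D' := D :|: (J :&: high) :|: [set g].
  have D'b : D' \subset block.
    by rewrite !subUset Db sub1set gb andbT /= (subset_trans (subsetIr _ _) hb).
  have mD' : msum m0 D + (#|J :&: high| + e) <= msum (m0 + mset J + U_(g) *+ e)%MM D'.
    rewrite mE addnA; have -> : g \in D' by rewrite !inE eqxx orbT.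
    rewrite leq_add2r; apply: leq_add.
      rewrite /msum big_mkcond [leqRHS]big_mkcond; apply: leq_sum => i _.
      by rewrite /D' !in_setU; case: (i \in D).
    apply: subset_leq_card; rewrite subsetI subsetIl /D'.
    exact: subset_trans (subsetUr _ _) (subsetUl _ _).
  have /implyP := h D'; rewrite D'b (leq_trans _ mD') => [/(_ isT)|]; last first.
    by rewrite addnA (leq_trans e0) // leq_addl.
  move=> lt; apply: leq_ltn_trans (leq_trans lt _); first by rewrite leq_add2l.
  rewrite rk_mono // !spanU -!setUA setUS // setUS // subUset; apply/andP; split.
    apply: subset_trans span_high_sub.
    by apply/bigcupsP=> i /setIP[_ iV]; apply: bigcup_sup.
  by rewrite /gspan big_set1.
apply/implyP=> /andP[Db]; rewrite mE.
have leJ := subset_leq_card (JDhigh D Db).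
case: (boolP ((g \in D) && (0 < e))) => [/andP[gD e0] _|ge].
  rewrite gD; have /implyP/(_ e0)/forallP/(_ D) := hr; rewrite Db /=.
  have -> : K :|: gspan D :|: vG g = K :|: gspan D.
    by apply/setUidPl; apply: (subset_trans (bigcup_sup g gD)); apply: subsetUr.
  apply: leq_ltn_trans; rewrite leq_add2l -addnA leq_add2l leq_add2r //.
have -> : (if g \in D then e else 0) = 0.
  by move: ge; case: (g \in D) => //=; rewrite -eqn0Ngt => /eqP.
rewrite addn0 => m_gt0; pose V := sumset D (J :&: D).
have VS : V \subset sumset setT (J :&: high).
  apply/subsetP=> -[i|i]; first by rewrite !in_set.
  rewrite !inE => iJD; have : i \in J :&: D by rewrite inE.
  by move/(subsetP (JDhigh D Db)); rewrite !inE.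
have := hs V; rewrite VS /= negb_and -leqNgt leqn0.
have -> : mass muX V = msum m0 D + #|J :&: D|.
  rewrite mass_lr lefts_sumset rights_sumset (setIidPl Db); congr (_ + #|pred_of_set _|).
  by apply/setIidPl; apply: (subset_trans (JDhigh D Db)); apply: subsetIr.
case/orP => [/eqP e00|]; first by move: m_gt0; rewrite e00.
rewrite -ltnNge => lt; rewrite -(ltn_add2l (r K)) rhoXE in lt.
apply: (leq_trans lt); rewrite rk_mono // setUS // span_lr lefts_sumset rights_sumset.
rewrite subUset subxx; apply/bigcupsP=> i /setIP[_ iD]; exact: bigcup_sup.
Qed.

Lemma rado_other Q m m' : (forall i, asg i = Q -> m i = m' i) -> rado Q m = rado Q m'.
Proof.
move=> h; apply: eq_forallb => D; case Db : (D \subset _) => //=.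
have -> // : msum m D = msum m' D.
by apply: eq_bigr => i /(subsetP Db); rewrite inE => /eqP/h.
Qed.

(** The index [i] must not depend on [J] and [e], so that one factor serves every expansion of the
    others. With room for all of [high], no set containing all its right copies is violating, and
    [avoid_minset] supplies a copy outside all minimal violating sets. Without that room, both
    monomials fail the condition at [P]. *)
Lemma toggle : exists2 i, i \in T & forall J e, J \subset T :\ i -> #|J| + e = #|T|.-1 ->
  good (m0 + mset J + U_(i) + U_(g) *+ e)%MM = good (m0 + mset J + U_(g) + U_(g) *+ e)%MM.
Proof.
have [y yh hy] : exists2 y, y \in high &
    room #|high| -> forall C, minset (violating rhoX muX) C -> inr y \notin C.
  case rm : (room #|high|); last by have /set0Pn[y yh] := high_neq0; exists y.
  have [||y] := @avoid_minset _ rhoX muX rhoX_submod (sumset set0 high).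
  - by have /set0Pn[y yh] := high_neq0; apply/set0Pn; exists (inr y); rewrite inE.
  - move=> V hV; rewrite negb_and -leqNgt leqn0 -ltnNge; apply/orP; right.
    have hR : high \subset rights V.
      by apply/subsetP=> i ih; have := subsetP hV (inr i); rewrite in_set ih inE => ->.
    rewrite mass_lr (setIidPr hR) -(ltn_add2l (r K)) rhoXE span_lr.
    have /forallP/(_ (lefts V :&: block)) := rm; rewrite subsetIr /= => lt.
    apply: (leq_trans lt); rewrite -[leqRHS](rk_cl rM) rk_mono // !subUset; apply/andP; split.
      apply/andP; split; apply: subset_trans (sub_cl _ _); first exact: subsetUl.
      apply: (subset_trans _ (subsetUr _ _)); apply: (subset_trans _ (subsetUl _ _)).
      by apply/bigcupsP=> i /setIP[iV _]; apply: bigcup_sup.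
    apply: (subset_trans sub_span_high); apply: cl_mono => //; apply: setUS.
    apply: (subset_trans _ (subsetUr _ _)).
    by apply/bigcupsP=> i ih; apply: bigcup_sup; apply: (subsetP hR).
  case: y => [i|i]; rewrite in_set; first by rewrite in_set0.
  by move=> ih hi; exists i.
have yT : y \in T by move: yh; rewrite inE => /andP[].
have ayP : asg y = P by apply/eqP; have := high_block yT; rewrite yh inE => <-.
exists y => // J e JT cJ; apply: eq_forallb_in => Q QW.
case: (eqVneq Q P) => [eQ|neQ]; last first.
  apply: rado_other => i ai; rewrite !mnmDE !mnm1E.
  case: eqP => [ey|_]; first by move: neQ; rewrite -ai -ey ayP eqxx.
  by case: eqP => [eg'|//]; move: neQ; rewrite -ai -eg' eqxx.
have yJ : y \notin J by apply/negP=> /(subsetP JT); rewrite !inE eqxx.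
have JT' : J \subset T := subset_trans JT (subsetDl _ _).
have -> : (m0 + mset J + U_(y) + U_(g) *+ e = m0 + mset (y |: J) + U_(g) *+ e)%MM.
  congr (_ + _)%MM; apply/mnmP=> i; rewrite !mnmDE !mnmE !inE -addnA; congr (_ + _).
  by rewrite eq_sym; case: eqP => [->|_]; rewrite ?(negPf yJ) ?addn0.
have -> : (m0 + mset J + U_(g) + U_(g) *+ e = m0 + mset J + U_(g) *+ e.+1)%MM.
  by rewrite mulmS addmA.
rewrite {Q QW}eQ !rado_high ?subUset ?sub1set ?yT //=.
have cyJ : #|(y |: J) :&: high| = (#|J :&: high|).+1.
  rewrite setIUl (setIidPl _) ?sub1set // cardsU1 inE (negPf yJ) //.
(* Exactly [e + 1] elements of [T], [y] included, are missing from [J]. *)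
have kap : #|high| <= #|J :&: high| + e.+1.
  have := cardsID high T; have := cardsID high J.
  rewrite (setIidPr (_ : high \subset T)); last by apply/subsetP=> i; rewrite inE => /andP[].
  have := subset_leq_card (setSD high JT'); move: cJ; rewrite (cardsD1 y T) yT /=.
  move: #|high| #|J :&: high| #|J| #|_| #|_| #|_| => *; lia.
(* Without room the right side fails. So does the left side: directly if [e > 0], and if [e = 0]
   because [y |: J = T] and stability with all of [high] would provide the room. *)
case rm : (room (#|J :&: high| + e.+1)); last first.
  rewrite andbF; apply/negP=> /andP[/forallP st]; rewrite cyJ addSnnS rm implybF -eqn0Ngt => /eqP e0.
  have eJ : y |: J = T.
    apply/eqP; rewrite eqEcard subUset sub1set yT JT' cardsU1 yJ.
    by move: cJ; rewrite e0 addn0 (cardsD1 y T) yT /= => ->.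
  move/negP: rm; apply; apply/forallP=> D; apply/implyP=> Db.
  have := st (sumset D high); rewrite eJ (setIidPr _); last first.
    by apply/subsetP=> i; rewrite inE => /andP[].
  have -> : sumset D high \subset sumset setT high.
    by apply/subsetP=> -[i|i]; rewrite !in_set.
  have hc : #|J :&: high| + e.+1 = #|high|.
    rewrite e0 addn1 -cyJ eJ; apply: eq_card => i; rewrite !inE.
    by case: (i \in T).
  rewrite hc /= negb_and -leqNgt leqn0 mass_lr lefts_sumset rights_sumset setIid (setIidPl Db).
  case/orP => [/eqP|]; first by rewrite -hc !addnS.
  rewrite -ltnNge -(ltn_add2l (r K)) rhoXE span_lr lefts_sumset rights_sumset => lt.
  by apply: (leq_trans lt); rewrite rk_mono // -setUA setUS // setUS // span_high_sub.
rewrite cyJ addSnnS rm implybT !andbT.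
have -> : sumset setT ((y |: J) :&: high) = inr y |: sumset setT (J :&: high).
  apply/setP=> -[i|i]; rewrite in_setU1 ![_ \in sumset _ _]in_set //=.
  rewrite (inj_eq (@inr_inj _ _)) !in_setI in_setU1.
  by case: (eqVneq i y) => [->|] //=; rewrite yh.
apply: stable_toggle; apply: hy; exact: room_le kap rm.
Qed.

End Toggle.
End Functional.

(** * Functionals vanishing on the Chow ideal *)

Section Degree.
Local Open Scope ring_scope.
Variables (E : finType) (r : {set E} -> nat) (BG : {set {set E}}) (W : {set {set E}}) (d : nat).
Hypotheses (rM : is_matroid_rank r) (rL : loopless r) (bG : building_set r BG).
Hypotheses (nW : nested r BG W) (TW : setT \in W).
Local Notation n := #|BG|.
Local Notation poly := {mpoly rat[n]}.
Local Notation vG := (@vG E BG).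
Local Notation good := (@good E r BG W).
Implicit Types (p q : poly) (i j g : 'I_n) (A B J T : {set 'I_n}) (m : 'X_{1..n}).

(** The variables of the argument stand for the [h_g], not for the [x_g]. *)
Definition degmap p : rat :=
  \sum_(m : 'X_{1..n < d.+1} | mdeg m == d) p@_m * (good m)%:R.

Lemma degmapD p q : degmap (p + q) = degmap p + degmap q.
Proof. by rewrite /degmap -big_split; apply: eq_bigr => m _; rewrite mcoeffD mulrDl. Qed.

Lemma degmapZ c p : degmap (c *: p) = c * degmap p.
Proof. by rewrite /degmap mulr_sumr; apply: eq_bigr => m _; rewrite mcoeffZ mulrA. Qed.

Lemma degmap0 : degmap 0 = 0.
Proof. by rewrite /degmap big1 // => m _; rewrite mcoeff0 mul0r. Qed.

Lemma degmapB p q : degmap (p - q) = degmap p - degmap q.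
Proof. by rewrite degmapD -scaleN1r degmapZ mulN1r. Qed.

Lemma degmap_sum (I : Type) (s : seq I) (P : pred I) (F : I -> poly) :
  degmap (\sum_(x <- s | P x) F x) = \sum_(x <- s | P x) degmap (F x).
Proof. by apply: (big_morph degmap degmapD degmap0). Qed.

Lemma degmapX m : degmap 'X_[m] = ((mdeg m == d) && good m)%:R.
Proof.
rewrite /degmap; case: eqP => [md|md] /=; last first.
  rewrite big1 // => m' /eqP md'; rewrite mcoeffX; case: eqP => [e|_]; last by rewrite mul0r.
  by case: md; rewrite e md'.
have lt : (mdeg m < d.+1)%N by rewrite md.
rewrite (bigD1 (BMultinom lt)) /=; last by rewrite md.
rewrite mcoeffX eqxx mul1r big1 ?addr0 // => m' /andP[_ ne]; rewrite mcoeffX.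
case: eqP => [e|_]; last by rewrite mul0r.
by case/eqP: ne; apply: val_inj; rewrite /= e.
Qed.

(** The largest ideal in the kernel of [degmap], so that only generators of the Chow ideal have to
    be tested. *)
Definition killed p := forall m, degmap ('X_[m] * p) = 0.

Lemma killedD p q : killed p -> killed q -> killed (p + q).
Proof. by move=> hp hq m; rewrite mulrDr degmapD hp hq addr0. Qed.

Lemma killed0 : killed 0.
Proof. by move=> m; rewrite mulr0 degmap0. Qed.

Lemma killedM q p : killed p -> killed (q * p).
Proof.
move=> hp m; rewrite (mpolyE q) mulr_suml mulr_sumr degmap_sum big1 // => m' _.
by rewrite -scalerAl -scalerAr degmapZ mulrA -mpolyXD hp mulr0.
Qed.

Lemma killed_sum (I : Type) (s : seq I) (P : pred I) (F : I -> poly) :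
  (forall x, P x -> killed (F x)) -> killed (\sum_(x <- s | P x) F x).
Proof. by move=> h; apply: big_ind => //; [exact: killed0|exact: killedD]. Qed.

Lemma killedB p q : killed p -> killed q -> killed (p - q).
Proof. by move=> hp hq; apply: killedD => //; rewrite -mulN1r; apply: killedM. Qed.

Lemma killed_degmap p : killed p -> degmap p = 0.
Proof. by move=> /(_ 0%MM); rewrite mpolyX0 mul1r. Qed.

(** Expanding all factors except the one of index [i] given by [toggle] leaves monomials times
    [X_i - X_g], on which the two values of the functional cancel. *)
Lemma killed_diff T g : vG g = bigjoin r (vG @: T) ->
  killed (\prod_(i in T) ('X_i - 'X_g)).
Proof.
move=> eg m0; have [i iT tog] := toggle rM rL bG nW TW m0 eg.
have mAC (a b c : 'X_{1..n}) : (a + b + c = a + c + b)%MM by rewrite -!addmA (addmC b).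
(* [J] and [e] record the factors expanded as [X_j] and as [X_g]; [B] indexes those still to
   expand. *)
have key k B J e : #|B| = k -> B \subset T :\ i -> J \subset T :\ i -> [disjoint B & J] ->
    (#|J| + e + #|B| = #|T|.-1)%N ->
    degmap ('X_[m0 + mset J + U_(g) *+ e] * (('X_i - 'X_g) * \prod_(j in B) ('X_j - 'X_g))) = 0.
  elim: k B J e => [|k IH] B J e cB BT JT dBJ cJ.
    move/eqP: cB; rewrite cards_eq0 => /eqP B0.
    rewrite B0 big_set0 mulr1 mulrBr degmapB -!mpolyXD !degmapX !mdegD !mdeg1.
    rewrite ![(m0 + _ + _ *+ _ + _)%MM]mAC tog ?subrr //.
    by move: cJ; rewrite B0 cards0 addn0.
  case: (set_0Vmem B) => [B0|[j jB]]; first by move: cB; rewrite B0 cards0.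
  have jJ : j \notin J by rewrite (disjointFr dBJ jB).
  have cBj : #|B :\ j| = k by move: cB; rewrite (cardsD1 j B) jB => -[].
  have BjT : B :\ j \subset T :\ i by apply: subset_trans BT; apply: subsetDl.
  have dj : [disjoint B :\ j & J] by apply: disjointWl dBJ; apply: subsetDl.
  rewrite (bigD1 j) //= (eq_bigl (mem (B :\ j))); last by move=> l; rewrite !inE andbC.
  set Q := \prod_(l in B :\ j) _; set M := (m0 + mset J + U_(g) *+ e)%MM.
  have -> : 'X_[M] * (('X_i - 'X_g) * (('X_j - 'X_g) * Q)) =
      'X_[m0 + mset (j |: J) + U_(g) *+ e] * (('X_i - 'X_g) * Q) -
      'X_[m0 + mset J + U_(g) *+ e.+1] * (('X_i - 'X_g) * Q).
    have -> : 'X_[m0 + mset (j |: J) + U_(g) *+ e] = 'X_[M] * 'X_j :> poly.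
      rewrite -mpolyXD; congr 'X_[_]; apply/mnmP=> l; rewrite !mnmDE !mnmE !inE.
      case: (eqVneq l j) => [->|_] /=; last by rewrite addn0.
      by rewrite (negPf jJ) addn0 !addn1 addSn.
    have -> : 'X_[m0 + mset J + U_(g) *+ e.+1] = 'X_[M] * 'X_g :> poly.
      by rewrite -mpolyXD mulmSr addmA.
    by move: ('X_[M] : poly) ('X_i : poly) ('X_j : poly) ('X_g : poly) => a b c f; ring.
  rewrite degmapB (IH (B :\ j) (j |: J) e) ?(IH (B :\ j) J e.+1) ?subrr //.
  - by rewrite cBj -cJ cB !addnS !addSn.
  - by rewrite subUset JT sub1set (subsetP BT).
  - by rewrite -setI_eq0 setIUr setU_eq0 !setI_eq0 dj andbT disjoint_sym disjoints1 !inE eqxx.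
  - by rewrite cBj -cJ cB cardsU1 jJ !addnS !addSn.
have := key _ (T :\ i) set0 0%N erefl; rewrite sub0set -setI_eq0 setI0 eqxx cards0.
rewrite (cardsD1 i T) iT subxx => /(_ isT isT isT erefl) h.
rewrite (bigD1 i) //= (eq_bigl (mem (T :\ i))); last by move=> l; rewrite !inE andbC.
move: h; suff -> : (m0 + mset set0 + U_(g) *+ 0 = m0)%MM by [].
by apply/mnmP=> l; rewrite !mnmDE mulmnE mnmE inE muln0 !addn0.
Qed.

(** The set [{g}] has positive mass but adds at most one to the rank of [J^P], against the strict
    inequality. *)
Lemma killed_var g : (r (vG g) <= 1)%N -> killed 'X_g.
Proof.
move=> rg m; rewrite -mpolyXD degmapX; case gd : (good _); rewrite ?andbF //.
have /forallP/(_ [set g]) := forall_inP gd _ (asg_in rM rL bG nW TW g).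
rewrite sub1set inE eqxx /= /msum big_set1 mnmDE mnm1E eqxx addn1 /= /gspan big_set1 ltnNge.
suff -> : (r (JG r W (asg W g) :|: vG g) <= r (JG r W (asg W g)) + (m g).+1)%N by [].
apply: leq_trans (rkU rM _ _) _; rewrite leq_add2l; exact: leq_trans rg _.
Qed.

(** [z i] is [x_i] expressed in the [h_g]: substituting it turns [hvar g] into [X_g]. *)
Variable z : 'I_n -> poly.
Hypothesis zE : forall g, \sum_(i | vG g \subset vG i) z i = 'X_g.

Lemma zvar_diff a g : vG a \subset vG g ->
  'X_a - 'X_g = \sum_(i | (vG a \subset vG i) && ~~ (vG g \subset vG i)) z i.
Proof.
move=> ag; rewrite -!zE (bigID (fun i => vG g \subset vG i)) /=.
rewrite (eq_bigl (fun i => vG g \subset vG i)) ?addrK //; last first.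
  by move=> i; rewrite andb_idl // => gi; apply: subset_trans gi.
by rewrite [X in X - _]addrC addrK.
Qed.

Lemma killed_prod_sub A B (F : 'I_n -> poly) : B \subset A ->
  killed (\prod_(i in B) F i) -> killed (\prod_(i in A) F i).
Proof.
move=> BA h; rewrite (big_setID B) /= (setIidPr BA) mulrC; exact: killedM.
Qed.

Lemma killed_prod_imset A (f : 'I_n -> 'I_n) (F : 'I_n -> poly) :
  killed (\prod_(i in f @: A) F i) -> killed (\prod_(i in A) F (f i)).
Proof.
move=> h; rewrite (partition_big_imset f) /=.
have -> : \prod_(j in f @: A) \prod_(i in A | f i == j) F (f i) =
    (\prod_(j in f @: A) F j ^+ (#|[set i in A | f i == j]|.-1)) * \prod_(j in f @: A) F j.
  rewrite -big_split /=; apply: eq_bigr => j /imsetP[i iA ej].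
  rewrite (eq_bigr (fun=> F j)) => [|l /andP[_ /eqP-> //]].
  rewrite -exprSr prednK; last by rewrite card_gt0; apply/set0Pn; exists i; rewrite inE iA ej eqxx.
  by rewrite prodr_const; congr (_ ^+ _); apply: eq_card => l; rewrite !inE.
exact: killedM.
Qed.

(** The successor makes every summand positive, so only the empty set has defect zero. Enlarging
    flats lowers the value, even if some of them become equal. *)
Definition defect A := (\sum_(i in A) (#|E|.+1 - #|vG i|))%N.

Lemma defect_sub A B : B \subset A -> (defect B <= defect A)%N.
Proof.
by move=> BA; rewrite /defect [leqRHS](big_setID B) /= (setIidPr BA) leq_addr.
Qed.

Lemma defect_imset A (f : 'I_n -> 'I_n) :
  (forall i, i \in A -> vG i \subset vG (f i)) -> (exists2 i, i \in A & f i != i) ->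
  (defect (f @: A) < defect A)%N.
Proof.
move=> hf [i iA fi].
have : (defect (f @: A) <= \sum_(i in A) (#|E|.+1 - #|vG (f i)|))%N.
  rewrite (partition_big_imset f) /=; apply: leq_sum => j /imsetP[l lA ->].
  by rewrite (bigD1 l) ?lA ?eqxx //= leq_addr.
move/leq_ltn_trans; apply; rewrite /defect (bigD1 i) //= [ltnRHS](bigD1 i) //=.
have lt : (#|vG i| < #|vG (f i)|)%N.
  apply: proper_card; rewrite properEneq hf // andbT.
  by apply: contraNneq fi => /vG_inj <-.
rewrite -addSn; apply: leq_add.
  by apply: ltn_sub2l lt; rewrite ltnS max_card.
by apply: leq_sum => j /andP[jA _]; rewrite leq_sub2l // subset_leq_card // hf.
Qed.

Lemma nonnested_ex A : ~~ nested r BG (vG @: A) -> exists B g,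
  [/\ B \subset A, vG g = bigjoin r (vG @: B) & forall i, i \in B -> ~~ (vG g \subset vG i)].
Proof.
rewrite /nested negb_and; have -> /= : vG @: A \subset BG.
  by apply/subsetP=> X /imsetP[i _ ->]; apply: vG_in.
rewrite negb_forall => /existsP[S]; rewrite negb_imply negb_forall.
move=> /andP[/andP[SA aS] /existsP[S']]; rewrite negb_imply negbK => /andP[/andP[S'S cS'] jB].
pose B := [set i in A | vG i \in S'].
have eB : vG @: B = S'.
  apply/setP=> X; apply/imsetP/idP => [[i]|XS]; first by rewrite inE => /andP[_ h] ->.
  have /imsetP[i iA eX] := subsetP SA _ (subsetP S'S _ XS).
  by exists i; rewrite // inE iA -eX.
have [g eg] := vG_ex jB; exists B, g; split; first by apply/subsetP=> i; rewrite inE => /andP[].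
  by rewrite eB.
move=> i; rewrite inE => /andP[_ iS]; apply/negP=> gi.
have := cS'; rewrite (_ : S' = [set vG i]) ?cards1 //; apply/eqP.
rewrite eqEsubset sub1set iS andbT; apply/subsetP=> X XS; rewrite inE.
move/forall_inP/(_ X (subsetP S'S _ XS))/forall_inP/(_ _ (subsetP S'S _ iS))/implyP: aS.
by apply; apply: subset_trans gi; rewrite eg; apply: sub_bigjoin.
Qed.

(* The product of the [X_i - X_g] expands into [prod z_i] plus products indexed by
   non-nested sets of larger flats. *)
Lemma killed_nonnested A : ~~ nested r BG (vG @: A) -> killed (\prod_(i in A) z i).
Proof.
move: {2}(defect A) (leqnn (defect A)) => k; elim: k A => [|k IH] A kA nA.
all: have [B [g [BA eg hB]]] := nonnested_ex nA.
  have /set0Pn[i iB] : B != set0.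
    apply/eqP=> B0; have := BG_neq0 rM rL bG (vG_in g).
    by rewrite eg B0 imset0 /bigjoin big_set0 (cl0 rM rL) eqxx.
  move: kA; rewrite /defect (bigD1 i) ?(subsetP BA) //= leqn0 addn_eq0 subn_eq0.
  by rewrite leqNgt ltnS max_card.
apply: (killed_prod_sub BA); have := killed_diff eg.
have Bg i : i \in B -> vG i \subset vG g.
  by move=> iB; rewrite eg; apply: sub_bigjoin; apply: imset_f.
rewrite (eq_bigr _ (fun i iB => zvar_diff (Bg i iB))).
rewrite (big_distr_big_dep g) /=; set Fam := pfamily _ _ _.
(* The choice of [z i] in each factor of index [i]; [g] is the default value outside [B]. *)
pose f0 : {ffun 'I_n -> 'I_n} := [ffun i => if i \in B then i else g].
have f0F : f0 \in Fam.
  apply/pfamilyP; split=> [|i iB]; last by rewrite unfold_in /= ffunE iB subxx hB.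
  by apply/supportP => i iB; rewrite ffunE (negPf iB).
rewrite (bigD1 f0) //=; set R := \sum_(f in Fam | f != f0) _ => h.
have eB : \prod_(i in B) z (f0 i) = \prod_(i in B) z i.
  by apply: eq_bigr => i iB; rewrite ffunE iB.
rewrite eB in h; rewrite -[\prod_(i in B) z i](addrK R); apply: killedB => //.
apply: killed_sum => f /andP[/pfamilyP[/supportP sf hf] nf].
have {}hf i : i \in B -> (vG i \subset vG (f i)) && ~~ (vG g \subset vG (f i)).
  by move=> /hf; rewrite unfold_in.
apply: killed_prod_imset; apply: IH.
  rewrite -ltnS (leq_trans _ kA) // (leq_trans _ (defect_sub BA)) //.
  apply: defect_imset => [i /hf/andP[]//|].
  case: (pickP [pred i in B | f i != i]) => [i /andP[iB fi]|none]; first by exists i.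
  case/eqP: nf; apply/ffunP=> i; rewrite ffunE; case: ifP => iB; last by rewrite sf ?iB.
  by apply/eqP; have := none i; rewrite /= iB => /negbFE.
(* The chosen flats still join to a flat above [g] and none of them is above [g]. *)
apply/negP=> nf'; have gs : vG g \subset bigjoin r (vG @: (f @: B)).
  rewrite eg; apply: (bigjoin_sub rM) => [|X /imsetP[i iB ->]]; first exact: flat_bigjoin.
  have /andP[ifi _] := hf i iB; apply: (subset_trans ifi).
  by apply: sub_bigjoin; apply: imset_f; apply: imset_f.
have [X /imsetP[j /imsetP[i iB ->] ->] gX] := nested_cover rM rL bG nf' (vG_in g) gs.
by have /andP[_ /negP] := hf i iB.
Qed.

Lemma degmap_ideal p : chow_ideal r p -> degmap (p \mPo [tuple z i | i < n]) = 0.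
Proof.
move=> [cI [cJ ->]]; apply: killed_degmap; rewrite rmorphD /=; apply: killedD.
  rewrite rmorph_sum /=; apply: killed_sum => A nA; rewrite rmorphM rmorph_prod /=.
  apply: killedM; under eq_bigr => i _ do rewrite comp_mpolyXU -tnth_nth tnth_mktuple.
  exact: killed_nonnested.
rewrite rmorph_sum /=; apply: killed_sum => a aa; rewrite rmorphM rmorph_sum /=.
apply: killedM; under eq_bigr => i _ do rewrite comp_mpolyXU -tnth_nth tnth_mktuple.
have [g eg] := vG_ex (atom_BG rM rL bG aa); rewrite -eg zE; apply: killed_var.
rewrite eg; case/and3P: aa => fa; rewrite (cl0 rM rL) => /set0Pn[e ea] /forallP h.
suff -> : a = cl r [set e] by rewrite rk_cl // rL.
apply/eqP; apply: contraT; rewrite eq_sym => ne; have := h (cl r [set e]).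
rewrite flat_cl //= properEneq ne cl_sub ?sub1set //= => /eqP c0.
by have := BG_neq0 rM rL bG (BG_atom rM rL bG e); rewrite c0 eqxx.
Qed.

End Degree.

Section ChangeOfVariables.
Local Open Scope ring_scope.

(** Moebius inversion for inclusion, from the largest flats downwards: stage [k] settles the flats
    whose complement has fewer than [k] elements. *)
Lemma zvars_ex (E : finType) (BG : {set {set E}}) : exists z : 'I_#|BG| -> {mpoly rat[#|BG|]},
  forall g, \sum_(i | vG g \subset vG i) z i = 'X_g.
Proof.
suff [z hz] : exists z : 'I_#|BG| -> {mpoly rat[#|BG|]}, forall g, (#|E| - #|vG g| < #|E|.+1)%N ->
    \sum_(i | vG g \subset vG i) z i = 'X_g.
  by exists z => g; apply: hz; rewrite ltnS leq_subr.
move: #|E|.+1 => k; elim: k => [|k [z hz]]; first by exists (fun=> 0).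
pose z' g : {mpoly rat[#|BG|]} := if (#|E| - #|vG g| < k)%N then z g
  else 'X_g - \sum_(i | vG g \proper vG i) z i.
have lt (i g : 'I_#|BG|) : vG g \proper vG i -> (#|E| - #|vG g| < k.+1)%N -> (#|E| - #|vG i| < k)%N.
  move=> /proper_card; have : (#|vG i| <= #|E|)%N by exact: max_card.
  by move: #|vG i| #|vG g| #|E| => a b c; lia.
have z'E (g : 'I_#|BG|) : (#|E| - #|vG g| < k.+1)%N ->
    \sum_(i | vG g \proper vG i) z' i = \sum_(i | vG g \proper vG i) z i.
  by move=> hg; apply: eq_bigr => i gi; rewrite /z' (lt i g).
have split (F : 'I_#|BG| -> {mpoly rat[#|BG|]}) (g : 'I_#|BG|) :
    \sum_(i | vG g \subset vG i) F i = F g + \sum_(i | vG g \proper vG i) F i.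
  rewrite (bigD1 g) //=; congr (_ + _); apply: eq_bigl => i.
  rewrite properEneq andbC; case: eqVneq => [->|ne]; first by rewrite eqxx.
  by rewrite [_ != _](_ : _ = true) //; apply: contra ne => /eqP /vG_inj ->.
exists z' => g hg; rewrite split z'E //; rewrite /z'; case: ifP => h; last by rewrite subrK.
by rewrite -split hz.
Qed.

End ChangeOfVariables.

(** * Independence and the theorem *)

Section Independence.
Local Open Scope ring_scope.
Variables (E : finType) (r : {set E} -> nat) (BG : {set {set E}}) (o : E -> nat).
Hypotheses (rM : is_matroid_rank r) (rL : loopless r) (bG : building_set r BG).
Hypotheses (EB : [set: E] \in BG) (oI : injective o) (cG : complete r o BG).
Local Notation n := #|BG|.
Local Notation poly := {mpoly rat[n]}.
Local Notation vG := (@vG E BG).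
Local Notation ideal := (@chow_ideal E r BG).
Local Notation hvar := (@hvar E BG).
Local Notation mindex := (@mindex E r BG).
Local Notation wt := (@wt E BG).
Local Notation index_set := (index_set r BG o).
Local Notation pair := ({set {set E}} * {set {set E}})%type.
Implicit Types (p q : poly) (i j g : 'I_n) (m : 'X_{1..n}) (x y : pair) (d : nat).

Definition nst x := x.1 :\: x.2.

Lemma nst_refines d x : x \in index_set d -> refines r BG o x.1 (nst x).
Proof. by rewrite inE => /and3P[mT /andP[VA _] _]; apply: refines_diff. Qed.

Lemma nst_nested d x : x \in index_set d -> nested r BG (nst x).
Proof. by move=> /nst_refines/refines_nested. Qed.

Lemma nst_setT d x : x \in index_set d -> setT \in nst x.
Proof. by move=> /nst_refines/(refines_setT EB). Qed.

Lemma nst_rk d x P : x \in index_set d -> P \in nst x ->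
  r P = (r (JG r (nst x) P) + (mexp r (nst x) P).+1)%N.
Proof.
move=> xI PW; have rT := nst_refines xI; case: (rT) => mT WT _.
rewrite -(card_block_mexp rM rL bG EB oI cG rT PW).
exact: (card_block rM rL bG EB oI cG mT WT (nst_setT xI) PW).
Qed.

Lemma mexp_in W P : (0 < mexp r W P)%N -> P \in W.
Proof. by rewrite /mexp; case: ifP. Qed.

(** In the block of [P] only the variable of [P] can occur; its exponent is one less than the rank
    of the minor, the largest value that the strict inequality allows. *)
Lemma good_mindex d x : x \in index_set d -> good r (nst x) (mindex x).
Proof.
move=> xI; apply/forall_inP=> P PW; apply/forallP=> D; apply/implyP=> /andP[Db m0].
have inD j : j \in D -> (0 < mindex x j)%N -> vG j = P.
  rewrite mnmE => /(subsetP Db); rewrite inE => /eqP <- /mexp_in jW.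
  by rewrite /asg cov_id.
have [i iD mi] : exists2 i, i \in D & (0 < mindex x i)%N.
  case: (pickP [pred i in D | (0 < mindex x i)%N]) => [i /andP[iD mi]|none]; first by exists i.
  move: m0; rewrite /msum big1 // => i iD; have := none i; rewrite /= iD /=.
  by rewrite lt0n => /negbFE/eqP.
have ei := inD i iD mi.
have -> : msum (mindex x) D = mexp r (nst x) P.
  rewrite /msum (bigD1 i) //= big1 ?addn0; first by rewrite mnmE ei.
  move=> j /andP[jD ji]; apply/eqP; rewrite -leqn0 leqNgt; apply: contra ji => mj.
  by apply/eqP/vG_inj; rewrite ei (inD j).
apply: leq_trans (_ : r P <= _)%N; first by rewrite (nst_rk xI PW) addnS.
rewrite rk_mono // -ei; apply: (subset_trans _ (subsetUr _ _)); exact: bigcup_sup iD.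
Qed.

Lemma sum_asg d x (F : 'I_n -> nat) : x \in index_set d ->
  (\sum_i F i = \sum_(P in nst x) \sum_(i | asg (nst x) i == P) F i)%N.
Proof.
move=> xI; rewrite (partition_big (asg (nst x)) (mem (nst x))) //= => i _.
exact: (asg_in rM rL bG (nst_nested xI) (nst_setT xI)).
Qed.

Lemma sum_nst d x (F : {set E} -> nat) : x \in index_set d ->
  (\sum_i mexp r (nst x) (vG i) * F (vG i) = \sum_(P in nst x) mexp r (nst x) P * F P)%N.
Proof.
move=> xI; rewrite -(sum_vG BG (fun P => mexp r (nst x) P * F P)%N).
rewrite big_mkcond [RHS]big_mkcond; apply: eq_bigr => P _.
case PW : (P \in nst x); first by rewrite (nested_BG (nst_nested xI) PW).
by rewrite /mexp PW mul0n if_same.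
Qed.

(** The condition for a whole block bounds its mass by the exponent of [P]; these bounds add up to
    [d], so all are attained. *)
Lemma good_fill d x m : x \in index_set d -> mdeg m = d -> good r (nst x) m ->
  forall P, P \in nst x -> (\sum_(i | asg (nst x) i == P) m i = mexp r (nst x) P)%N.
Proof.
move=> xI md gm; pose a P := (\sum_(i | asg (nst x) i == P) m i)%N.
have le P : P \in nst x -> (a P <= mexp r (nst x) P)%N.
  move=> PW; case: (posnP (a P)) => [->//|a0].
  have /forallP/(_ [set i | asg (nst x) i == P]) := forall_inP gm P PW.
  have -> : msum m [set i | asg (nst x) i == P] = a P by apply: eq_bigl => i; rewrite inE.
  rewrite subxx a0 /= => lt; rewrite -ltnS -(ltn_add2l (r (JG r (nst x) P))) -(nst_rk xI PW).
  apply: (leq_trans lt); rewrite rk_mono // subUset; apply/andP; split.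
    apply: JG_sub => //; apply: (BG_flat bG); exact: (nested_BG (nst_nested xI) PW).
  by apply/bigcupsP=> i; rewrite inE => /eqP <-; apply: asg_sub.
have : (\sum_(P in nst x) (mexp r (nst x) P - a P) = 0)%N.
  rewrite sumnB // -(sum_asg m xI) -mdegE md.
  have := mdeg_mindex rM rL bG EB oI cG xI; rewrite mdegE.
  under eq_bigr do rewrite mnmE.
  have := sum_nst (fun=> 1%N) xI.
  under eq_bigr do rewrite muln1.
  under [RHS]eq_bigr do rewrite muln1.
  by move=> -> ->; rewrite subnn.
move/eqP; rewrite sum_nat_eq0 => /forall_inP h P PW; apply/eqP; rewrite eqn_leq le //=.
by rewrite -subn_eq0 h.
Qed.

(** Moving the mass of each block to its top turns [m] into [mindex x] and enlarges every flat not
    already at the top. *)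
Lemma good_wt d x m : x \in index_set d -> mdeg m = d -> good r (nst x) m ->
  (wt m < wt (mindex x))%N \/ m = mindex x.
Proof.
move=> xI md gm; have fill := good_fill xI md gm.
have wE : wt (mindex x) = (\sum_i m i * #|asg (nst x) i|)%N.
  rewrite /wt; under eq_bigr do rewrite mnmE.
  rewrite (sum_nst (fun P => #|P|) xI) (sum_asg _ xI); apply: eq_bigr => P PW.
  rewrite -(fill P PW) big_distrl /=; apply: eq_bigr => i /eqP-> //.
have le i : (m i * #|vG i| <= m i * #|asg (nst x) i|)%N.
  by rewrite leq_mul2l subset_leq_card ?orbT // asg_sub.
case: (ltnP (wt m) (wt (mindex x))) => [|ge]; [by left|right].
have tight i : (0 < m i)%N -> vG i = asg (nst x) i.
  move=> mi; apply/eqP; rewrite eqEcard asg_sub /= -(leq_pmul2l mi).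
  have : (\sum_j (m j * #|asg (nst x) j| - m j * #|vG j|) = 0)%N.
    by rewrite sumnB // -wE; apply/eqP; rewrite subn_eq0.
  by move/eqP; rewrite sum_nat_eq0 => /forall_inP/(_ i isT); rewrite subn_eq0.
apply/mnmP=> i; rewrite mnmE; case iW : (vG i \in nst x); last first.
  rewrite /mexp iW; apply/eqP; rewrite -leqn0 leqNgt; apply: contraFN iW => mi.
  by rewrite tight // (asg_in rM rL bG (nst_nested xI) (nst_setT xI)).
rewrite -(fill _ iW) (bigD1 i) /=; last by rewrite /asg cov_id.
rewrite big1 ?addn0 // => j /andP[/eqP aj ji]; apply/eqP; rewrite -leqn0 leqNgt.
by apply: contra ji => mj; apply/eqP/vG_inj; rewrite (tight j mj).
Qed.

Lemma mindex_inj d : {in index_set d &, injective mindex}.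
Proof.
move=> [T V] [T' V']; rewrite !inE /= => /and3P[mT aV _] /and3P[mT' aV' _] e.
apply: (mexp_inj rM rL bG EB oI cG mT mT' aV aV') => P.
case PB : (P \in BG).
  have [i <-] := vG_ex PB; have := congr1 (fun m : 'X_{1..n} => m i) e.
  by rewrite !mnmE.
have nin T0 V0 : max_nested r BG T0 -> mexp r (T0 :\: V0) P = 0%N.
  move=> mT0; rewrite /mexp; case: ifP => // /setDP[PT _].
  by move: PB; rewrite (nested_BG (max_nested_nested mT0) PT).
by rewrite !nin.
Qed.

Definition hmon x : poly := \prod_i hvar i ^+ mindex x i.

Lemma homog_hmon d x : x \in index_set d -> homog_deg d (hmon x).
Proof.
move=> xI; suff h : graded_ge (mdeg (mindex x)) (wt (mindex x)) (hmon x).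
  by apply/allP => m /h[-> _]; rewrite (mdeg_mindex rM rL bG EB oI cG xI).
rewrite mdegE /wt /hmon; elim/big_rec3: _ => [|i p w k _ IH].
  by move=> m; rewrite -mpolyX0 msuppX inE => /eqP->; rewrite mdeg0.
apply: graded_geM IH; rewrite -[X in graded_ge X]muln1.
exact: graded_geX (@graded_ge_hvar _ _ i).
Qed.

(** Besides [x] itself, the functional of [nst x] only sees indices of smaller weight, whose
    coefficients vanish by induction. *)
Lemma hmon_indep d (c : pair -> rat) :
  ideal (\sum_(x in index_set d) c x *: hmon x) -> forall x, x \in index_set d -> c x = 0.
Proof.
move=> id x; have [z zE] := zvars_ex BG.
move: {2}(wt (mindex x)).+1 (ltnSn (wt (mindex x))) => k; elim: k x => // k IH x wx xI.
have := degmap_ideal d rM rL bG (nst_nested xI) (nst_setT xI) zE id.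
rewrite rmorph_sum /= degmap_sum.
have hE y : hmon y \mPo [tuple z i | i < n] = 'X_[mindex y].
  rewrite /hmon rmorph_prod mpolyXE_id /=; apply: eq_bigr => i _; rewrite rmorphXn /=.
  congr (_ ^+ _); rewrite /hvar rmorph_sum /= -zE; apply: eq_bigr => j _.
  by rewrite comp_mpolyXU -tnth_nth tnth_mktuple.
under eq_bigr => y _ do rewrite comp_mpolyZ degmapZ hE degmapX.
rewrite (bigD1 x) //= (good_mindex xI) (mdeg_mindex rM rL bG EB oI cG xI) eqxx mulr1.
rewrite big1 ?addr0 // => y /andP[yI yx].
have my := mdeg_mindex rM rL bG EB oI cG yI; rewrite my eqxx /=.
case gy : (good _ _ _); last by rewrite mulr0.
case: (good_wt xI my gy) => [lt|e]; last by case/eqP: yx; apply: (mindex_inj yI xI e).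
by rewrite (IH y) ?mul0r //; apply: leq_trans lt _.
Qed.

Lemma rows_dependent (a b : nat) (C : 'M[rat]_(a, b)) : (b < a)%N ->
  exists2 u : 'rV[rat]_a, u != 0 & u *m C = 0.
Proof.
move=> ba; exists (nz_row (kermx C)); last by apply/sub_kermxP; apply: nz_row_sub.
rewrite nz_row_eq0 kermx_eq0 /row_free neq_ltn.
by rewrite (leq_ltn_trans (rank_leq_col C) ba).
Qed.

(** Modulo the ideal, the independent [b j] are combinations of the [#|I|] monomials in the [x_G],
    and the [#|I|] independent products [hmon] are combinations of the [b j]. *)
Lemma chow_dim d k : chow_dim_is r BG d k -> k = #|index_set d|.
Proof.
move=> [b [hb spb indb]]; pose I := index_set d; pose v (a : 'I_#|I|) : pair := enum_val a.
have vI a : v a \in I by apply: enum_valP.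
have sumI (F : pair -> poly) : \sum_(t in I) F t = \sum_a F (v a) by exact: big_enum_val.
apply/eqP; rewrite eqn_leq; apply/andP; split; rewrite leqNgt; apply/negP => lt.
  have /fin_all_exists[c hc] a := homog_spanned rM rL bG EB oI cG (hb a).
  have [u u0 uC] := rows_dependent (\matrix_(a, t) c a (v t)) lt.
  case/eqP: u0; apply/rowP=> a; rewrite mxE.
  apply: (indb (fun a => u 0 a)).
  have -> : \sum_a u 0 a *: b a =
      \sum_a u 0 a *: (b a - \sum_(t in index_set d) c a t *: 'X_[mindex t]).
    under [RHS]eq_bigr => l _ do rewrite scalerBr.
    rewrite sumrB [X in _ - X](_ : _ = 0) ?subr0 //.
    under eq_bigr => l _ do rewrite sumI scaler_sumr.
    rewrite exchange_big big1 //= => t _.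
    under eq_bigr => l _ do rewrite scalerA.
    rewrite -scaler_suml; move/rowP/(_ t): uC; rewrite !mxE.
    under eq_bigr do rewrite mxE.
    by move=> ->; rewrite scale0r.
  by apply: ideal_sum => l _; apply: idealZ.
have /fin_all_exists[c hc] (t : 'I_#|I|) := spb _ (homog_hmon (vI t)).
have [u u0 uC] := rows_dependent (\matrix_(t, a) c t a) lt.
pose uu (y : pair) := \sum_(t | v t == y) u 0 t.
have uuE t : uu (v t) = u 0 t.
  rewrite /uu (big_pred1 t) // => l; apply/eqP/eqP => [/enum_val_inj//|->//].
case/eqP: u0; apply/rowP=> t; rewrite mxE -uuE; apply: (hmon_indep (d := d)) (vI t).
rewrite sumI; under eq_bigr => l _ do rewrite uuE.
have -> : \sum_l u 0 l *: hmon (v l) = \sum_l u 0 l *: (hmon (v l) - \sum_a c l a *: b a).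
  under [RHS]eq_bigr => l _ do rewrite scalerBr.
  rewrite sumrB [X in _ - X](_ : _ = 0) ?subr0 //.
  under eq_bigr => l _ do rewrite scaler_sumr.
  rewrite exchange_big big1 //= => a _.
  under eq_bigr => l _ do rewrite scalerA.
  rewrite -scaler_suml; move/rowP/(_ a): uC; rewrite !mxE.
  under eq_bigr do rewrite mxE.
  by move=> ->; rewrite scale0r.
by apply: ideal_sum => l _; apply: idealZ.
Qed.

End Independence.

Local Open Scope ring_scope.

Theorem theorem5p13 (E : finType) (r : {set E} -> nat) (BG : {set {set E}})
    (o : E -> nat) :
  is_matroid_rank r -> loopless r -> building_set r BG ->
  [set: E] \in BG -> injective o -> complete r o BG ->
  forall H : {poly rat},
    (forall i : nat, exists k : nat, chow_dim_is r BG i k /\ H`_i = k%:R) ->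
    is_gamma_poly H (\sum_(S in stable_max_nested r o BG) 'X^(des r o S)).
Proof.
move=> rM rL bG EB oI cG H hH; apply: (gamma_of_index_set rM rL bG EB oI cG) => i.
by have [k [dk ->]] := hH i; rewrite (chow_dim rM rL bG EB oI cG dk).
Qed.
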